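(* For every integer $d \geq 1$ there exist a totally real number field $k$ of degree $d$ over $\mathbb{Q}$ and a maximal quasi-arithmetic lattice $\Gamma < \mathrm{Isom}\,\mathbb{H}^2$ generated by reflections, whose field of definition is exactly $k$.
   Context: $\mathbb{H}^n$ is hyperbolic $n$-space in the hyperboloid model: the upper sheet $\{x : \langle x,x\rangle=-1,\ x_0>0\}$ in $\mathbb{R}^{n,1}$, i.e. $\mathbb{R}^{n+1}$ with the Lorentzian product $\langle x,y\rangle=-x_0y_0+x_1y_1+\dots+x_ny_n$; $\mathrm{Isom}\,\mathbb{H}^n\cong \mathrm{O}^+_{n,1}\cong\mathrm{PO}_{n,1}$. A lattice is a discrete subgroup of $\mathrm{Isom}\,\mathbb{H}^n$ of finite covolume. A Coxeter polytope $P\subset\mathbb{H}^n$ is a convex polytope all of whose dihedral angles are of the form $\pi/m$ with $m\ge 2$ an integer. The reflection group $\Gamma(P)$ is the group generated by the reflections in the facets of $P$; it is a lattice when $P$ has finite volume. The Gram matrix of $P$ is $G=G(P)=(\langle e_i,e_j\rangle)_{i,j}$, where $e_1,\dots,e_m\in\mathbb{R}^{n,1}$ are the unit outer normals to the facets of $P$. Let $K=K(G)$ be the field generated over $\mathbb{Q}$ by the entries of $G$, and $k=k(G)$ the field generated over $\mathbb{Q}$ by all cyclic products $g_{i_1i_2}g_{i_2i_3}\cdots g_{i_si_1}$ of entries of $G$. For a finite-volume Coxeter polytope $P$, the lattice $\Gamma(P)$ is called quasi-arithmetic if (a) $K$ is a totally real number field, and (b) for every embedding $\sigma:K\to\mathbb{R}$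 with $\sigma|_k\neq\mathrm{id}$, the matrix $G^\sigma$ obtained by applying $\sigma$ to each entry of $G$ is positive semi-definite. The field of definition of a lattice $\Gamma$ is the smallest field containing the traces of the adjoint representation $\mathrm{Ad}\,\Gamma$; for a quasi-arithmetic reflection group $\Gamma(P)$ it equals $k(G)$. A lattice $\Gamma<\mathrm{Isom}\,\mathbb{H}^2$ is maximal if it is not properly contained in any other lattice of $\mathrm{Isom}\,\mathbb{H}^2$. *)

(* Defs.v *)
From HB Require Import structures.
From mathcomp Require Import all_boot all_order all_algebra all_field.
From mathcomp Require Import all_classical all_reals all_analysis.
From mathcomp Require Import complex.

Set Implicit Arguments.
Unset Strict Implicit.
Unset Printing Implicit Defensive.

Import Order.TTheory GRing.Theory Num.Theory.
Import numFieldNormedType.Exports.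

Local Open Scope classical_set_scope.
Local Open Scope ring_scope.

Section Fields.
Variable R : realType.

(* Inverses need no nonzero guard: [0^-1 = 0] in MathComp. *)
Definition is_subfield (F : set R) : Prop :=
  [/\ F 1,
      forall x y, F x -> F y -> F (x - y) &
      forall x y, F x -> F y -> F (x / y)].

(* Every subfield contains Q, so this is the field generated over Q by [S]. *)
Definition field_generated (S : set R) : set R := smallest is_subfield S.

(* A number field is an abstract finite extension [L] of [rat]. *)
Definition totally_real (L : fieldExtType rat) : Prop :=
  forall (s : {rmorphism L -> R[i]}) (x : L), s x \is Num.real.

End Fields.

Section Hyperbolic.
Variables (R : realType) (n : nat).

Definition lorentz_mx : 'M[R]_n.+1 :=
  diag_mx (\row_i (if i == 0 then -1 else 1)).

Definition lorentz (x y : 'cV[R]_n.+1) : R :=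
  - (x 0 0 * y 0 0) + \sum_(i < n) x (lift 0 i) 0 * y (lift 0 i) 0.

Definition hyperbolic_space : set 'cV[R]_n.+1 :=
  [set x | lorentz x x = -1 /\ 0 < x 0 0].

(* Isom H^n, as the group O^+_{n,1} of matrices acting on column vectors. *)
Definition isom_hyperbolic : set 'M[R]_n.+1 :=
  [set A | (forall x y, lorentz (A *m x) (A *m y) = lorentz x y) /\
           (forall x, hyperbolic_space x -> hyperbolic_space (A *m x))].

Definition is_isom_subgroup (G : set 'M[R]_n.+1) : Prop :=
  [/\ G `<=` isom_hyperbolic,
      G 1%:M,
      forall A B, G A -> G B -> G (A *m B) &
      forall A, G A -> G (invmx A)].

Definition discrete_subset (G : set 'M[R]_n.+1) : Prop := G `<=` isolated G.

(* For [lorentz e e = 1], the matrix of x |-> x - 2 <x, e> e, the reflection in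
   the hyperplane orthogonal to [e]. *)
Definition reflection_mx (e : 'cV[R]_n.+1) : 'M[R]_n.+1 :=
  1%:M - 2%:R *: (e *m e^T *m lorentz_mx).

Lemma lorentzE (x y : 'cV[R]_n.+1) : (x^T *m lorentz_mx *m y) 0 0 = lorentz x y.
Proof.
rewrite /lorentz /lorentz_mx mul_mx_diag !mxE big_ord_recl !mxE eqxx mulrN1 mulNr.
congr (_ + _); apply: eq_bigr => i _; rewrite !mxE.
by rewrite -[lift 0 i == 0]/(false) mulr1.
Qed.

Lemma reflection_mxE (e x : 'cV[R]_n.+1) :
  reflection_mx e *m x = x - (2%:R * lorentz x e) *: e.
Proof.
have lC : lorentz x e = lorentz e x.
  by rewrite /lorentz mulrC; congr (_ + _); apply: eq_bigr => i _; rewrite mulrC.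
rewrite /reflection_mx mulmxBl mul1mx -scalemxAl -!mulmxA; congr (_ - _).
rewrite -scalerA; congr (_ *: _).
rewrite lC -lorentzE -mulmxA.
by rewrite [e^T *m _]mx11_scalar mul_mx_scalar !mxE eqxx mulr1n.
Qed.

(* The Lie algebra so(n,1), on which [adjoint] is Ad. *)
Definition lie_algebra : {vspace 'M[R]_n.+1} :=
  lker (linfun (fun X : 'M[R]_n.+1 => X^T *m lorentz_mx + lorentz_mx *m X)).

Lemma mem_lie_algebra (X : 'M[R]_n.+1) :
  (X \in lie_algebra) = (X^T *m lorentz_mx + lorentz_mx *m X == 0).
Proof.
pose f (Y : 'M[R]_n.+1) := Y^T *m lorentz_mx + lorentz_mx *m Y.
have fL : linear f.
  move=> a Y Z; rewrite /f linearP /= mulmxDl mulmxDr -scalemxAl -scalemxAr.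
  by rewrite scalerDr addrACA.
pose fl : {linear _ -> _} := HB.pack f (GRing.isLinear.Build _ _ _ _ f fL).
by rewrite memv_ker (lfunE fl).
Qed.

Definition adjoint (g X : 'M[R]_n.+1) : 'M[R]_n.+1 := g *m X *m invmx g.

Definition adjoint_trace (g : 'M[R]_n.+1) : R :=
  \sum_(i < \dim lie_algebra)
    coord (vbasis lie_algebra) i (adjoint g (vbasis lie_algebra)`_i).

Definition field_of_definition (G : set 'M[R]_n.+1) : set R :=
  field_generated (adjoint_trace @` G).

Section Polytope.
Variables (m : nat) (e : 'I_m -> 'cV[R]_n.+1).

Definition polytope : set 'cV[R]_n.+1 :=
  [set x | hyperbolic_space x /\ forall i, lorentz x (e i) <= 0].

(* Points of the polytope lying on exactly the hyperplanes indexed by [S]. *)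
Definition open_stratum (S : {set 'I_m}) : set 'cV[R]_n.+1 :=
  [set x | hyperbolic_space x /\
     forall i, if i \in S then lorentz x (e i) = 0 else lorentz x (e i) < 0].

(* [e] lists the unit outer normals to the facets, once each, of a polytope with
   nonempty interior. *)
Definition is_polytope : Prop :=
  [/\ forall i, lorentz (e i) (e i) = 1,
      open_stratum finset.set0 !=set0 &
      forall i, open_stratum (finset.set1 i) !=set0].

(* The facets [i] and [j] meet in a face of codimension 2; in any polytope such
   a face lies in exactly two facets. *)
Definition adjacent (i j : 'I_m) : Prop :=
  i != j /\ open_stratum [set i; j]%SET !=set0.

(* The angle between the outer normals is pi minus the dihedral angle. *)
Definition dihedral_angle (i j : 'I_m) : R := acos (- lorentz (e i) (e j)).

Definition is_Coxeter : Prop :=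
  is_polytope /\
  forall i j, adjacent i j ->
    exists2 q : nat, (2 <= q)%N & dihedral_angle i j = pi / q%:R.

Definition reflection_group : set 'M[R]_n.+1 :=
  smallest is_isom_subgroup [set reflection_mx (e i) | i in [set: 'I_m]].

Definition Gram : 'M[R]_m := \matrix_(i, j) lorentz (e i) (e j).

End Polytope.

End Hyperbolic.

Section QuasiArithmetic.
Variables (R : realType) (m : nat).

Definition entry_field (G : 'M[R]_m) : set R :=
  field_generated [set x | exists i j, x = G i j].

(* The product along the cycle [i :: s], closing up at [i]. *)
Definition cyclic_product (G : 'M[R]_m) (i : 'I_m) (s : seq 'I_m) : R :=
  \prod_(p <- zip (i :: s) (rcons s i)) G p.1 p.2.

Definition cyclic_field (G : 'M[R]_m) : set R :=
  field_generated [set x | exists i s, x = cyclic_product G i s].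

Definition positive_semidefinite (A : 'M[R]_m) : Prop :=
  A^T = A /\ forall x : 'cV[R]_m, 0 <= (x^T *m A *m x) 0 0.

(* [K], embedded in R by [j], is the field of the entries of [G], and [A] is
   [G] seen over [K], so that [map_mx s A] is the conjugate of [G] by [s]. *)
Definition quasi_arithmetic_Gram (G : 'M[R]_m) : Prop :=
  exists (K : fieldExtType rat) (j : {rmorphism K -> R}) (A : 'M[K]_m),
    [/\ range j = entry_field G,
        map_mx j A = G,
        totally_real R K &
        forall s : {rmorphism K -> R},
          (exists2 x, cyclic_field G (j x) & s x <> j x) ->
          positive_semidefinite (map_mx s A)].

End QuasiArithmetic.

Section Plane.
Variable R : realType.

(* The hyperboloid as a graph over the coordinates (x_1, x_2). *)
Definition graph_chart (p : R * R) : 'cV[R]_3 :=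
  \col_i [:: Num.sqrt (1 + p.1 ^+ 2 + p.2 ^+ 2); p.1; p.2]`_i.

Definition Borel_plane (D : set 'cV[R]_3) : Prop :=
  measurable (graph_chart @^-1` D : set (measurableTypeR R * measurableTypeR R)).

(* The Riemannian area element of the hyperboloid is dx_1 dx_2 / x_0. *)
Definition area (D : set 'cV[R]_3) : \bar R :=
  (\int[(lebesgue_measure \x lebesgue_measure)%E]_(p in graph_chart @^-1` D)
     ((graph_chart p 0 0)^-1)%:E)%E.

Definition fundamental_domain (G : set 'M[R]_3) (D : set 'cV[R]_3) : Prop :=
  [/\ D `<=` @hyperbolic_space R 2,
      Borel_plane D,
      @hyperbolic_space R 2 `<=`
        \bigcup_(g in G) [set g *m x | x in D] &
      forall g, G g -> g <> 1%:M ->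
        area (D `&` [set g *m x | x in D]) = 0%E].

(* The covolume is the area of any fundamental domain. *)
Definition is_lattice (G : set 'M[R]_3) : Prop :=
  [/\ is_isom_subgroup G,
      discrete_subset G &
      exists2 D, fundamental_domain G D & (area D < +oo)%E].

Definition is_maximal_lattice (G : set 'M[R]_3) : Prop :=
  is_lattice G /\
  forall G' : set 'M[R]_3, is_lattice G' -> G `<=` G' -> G' = G.

Definition is_quasi_arithmetic_reflection_group (G : set 'M[R]_3) : Prop :=
  exists (m : nat) (e : 'I_m -> 'cV[R]_3),
    [/\ is_Coxeter e,
        (area (polytope e) < +oo)%E,
        G = reflection_group e &
        quasi_arithmetic_Gram (Gram e)].

End Plane.

(* Main.v *)
(* For u > 0 let P be the hyperbolic quadrilateral with angles pi/2, pi/2, pi/2,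
   pi/3 whose pairs of opposite sides have distances with hyperbolic cosines
   C = sqrt (1 + u) and D = sqrt (1 + 1/(4u)). The cyclic products of its Gram
   matrix lie in Q(u), and a conjugate of the Gram matrix is positive
   semidefinite when the conjugate of u lies in (-1, -1/4).

   Such a u comes from the polynomial 2 c prod_i (y - a_i) + 1: for a large odd
   integer c its roots are real and close to the integers a_i, one of them small
   and positive and the others scaled into (-1, -1/4), and it is irreducible of
   degree d by Eisenstein's criterion at 2 after y -> 1/y. The constant term 1
   moreover keeps q y, for q odd, from being an algebraic integer; therefore no
   prime multiple of 2 C is one.

   For maximality, let G be a discrete group containing the reflections in the
   sides of P. When two mirrors of G with normals f, g cross, 2 <f, g> is twice
   the cosine of a rational multiple of pi, hence an algebraic integer that
   divides a rational prime unless it vanishes. The mirrors of the reflection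
   group orthogonal to one side of P have normals n_j with n_(j-1) + n_(j+1) =
   2 C n_j; a mirror f crossing three consecutive ones with <f, n_j> <> 0 would
   make a prime multiple of 2 C an algebraic integer. If a mirror of G met the
   interior of P, then it or another mirror obtained from it by a few explicit
   reflections would be such an f. So no mirror of G meets the interior of P,
   every element of G is, up to the reflection group, a symmetry of P, and P has
   none because C <> D. *)
Require Import Defs.
From HB Require Import structures.
From mathcomp Require Import all_boot all_order all_algebra all_field.
From mathcomp Require Import all_classical all_reals all_analysis.
From mathcomp Require Import measurable_realfun polyrcf complex ring lra zify.

Set Implicit Arguments.
Unset Strict Implicit.
Unset Printing Implicit Defensive.

Import Order.TTheory GRing.Theory Num.Theory.
Import numFieldNormedType.Exports.

Local Open Scope classical_set_scope.
Local Open Scope ring_scope.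

(** * Mirrors crossing the quadrilateral *)

(** Four normals in a 3-dimensional space have a singular Gram matrix. For the angles of P this
    reads (C^2 - 1)(D^2 - 1) = 1/4, which ties D to C and leaves u as the only free parameter. At a
    negative conjugate of u the numbers C and D keep real conjugates exactly when -1 <= u <= -1/4,
    whence the interval. Maximality is the obstacle: a discrete overgroup need not be generated by
    reflections, and its mirrors are unknown. The prime that 2 <f, n_j> divides depends on the order
    of an unknown rotation, so the multiples of 2 C by every prime have to be excluded. The bound u
    <= 1/100 places neighbouring n_j at distance at most arsinh (1/10), close enough for a line
    through P, or an explicit image of it, to cross three of them; this is the source of the
    numerical estimates. They use only the closure of the set of mirrors under reflection, and so
    are carried out for an abstract set of normals over an ordered field. *)

(* [S, C, D] are the coordinates in the normals (0,-1,0), (0,0,-1), (S,C,0),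
   (1/(2S),0,D) of the quadrilateral; its first and third sides have distance
   arcosh C, the second and fourth arcosh D. *)
Record quad_params (R : realFieldType) (u C S D : R) : Prop := QuadParams {
  qS_gt0 : 0 < S;
  qC_gt0 : 0 < C;
  qD_gt0 : 0 < D;
  qS2 : S ^+ 2 = u;
  qC2 : C ^+ 2 = 1 + u;
  qD2 : 4 * u * D ^+ 2 = 1 + 4 * u;
  qu_le : u <= 1 / 100 }.

(* [p], [C p - S q], [C p + S q] are the Lorentzian products of [f] with
   n = (sh, ch, 0) and with its two neighbours, whose sum is 2 C n. In
   [mirror_system], n runs over n_(-1), n_0, n_1, n_2. *)
Definition frame_sparse (R : realFieldType) (C S : R) (M : R -> R -> R -> Prop)
    (sh ch : R) : Prop :=
  forall f0 f1 f2, M f0 f1 f2 ->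
  let p := ch * f1 - sh * f0 in let q := ch * f0 - sh * f1 in
  p != 0 -> -1 <= p <= 1 -> -1 <= C * p - S * q <= 1 ->
  -1 <= C * p + S * q <= 1 -> False.

Record mirror_system (R : realFieldType) (u C S D : R)
    (M : R -> R -> R -> Prop) : Prop := MirrorSystem {
  mirror_norm : forall f0 f1 f2, M f0 f1 f2 -> f1 ^+ 2 + f2 ^+ 2 - f0 ^+ 2 = 1;
  mirror_refl : forall f0 f1 f2 g0 g1 g2, M f0 f1 f2 -> M g0 g1 g2 ->
    let s := 2 * (f1 * g1 + f2 * g2 - f0 * g0) in
    M (f0 - s * g0) (f1 - s * g1) (f2 - s * g2);
  mirror_a : M 0 (-1) 0;
  mirror_b : M 0 0 (-1);
  mirror_c : M S C 0;
  mirror_d : M (1 / (2 * S)) 0 D;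
  sparse_m1 : frame_sparse C S M (- S) C;
  sparse_0 : frame_sparse C S M 0 1;
  sparse_1 : frame_sparse C S M S C;
  sparse_2 : frame_sparse C S M (2 * S * C) (1 + 2 * u) }.

Lemma le_of_sqr (R : realFieldType) (x y : R) :
  0 <= y -> x ^+ 2 <= y ^+ 2 -> x <= y.
Proof.
move=> y0; have [x0|/ltW x0 _] := leP 0 x; last exact: le_trans x0 y0.
by rewrite ler_pXn2r.
Qed.

Lemma lt_of_sqr (R : realFieldType) (x y : R) :
  0 <= y -> x ^+ 2 < y ^+ 2 -> x < y.
Proof.
move=> y0; have [x0|x0 _] := leP 0 x; last exact: lt_le_trans x0 y0.
by rewrite ltr_pXn2r.
Qed.

(** The last four inequalities are the signs of the products with the four side normals. *)
Record quad_point (R : realFieldType) (C S D x0 x1 x2 : R) : Prop := QuadPoint {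
  pt_norm : x0 ^+ 2 = 1 + x1 ^+ 2 + x2 ^+ 2;
  pt_gt0 : 0 < x0;
  pt_a : 0 < x1;
  pt_b : 0 < x2;
  pt_c : C * x1 < S * x0;
  pt_d : D * x2 < x0 / (2 * S) }.

Section Params.
Variables (R : realFieldType) (u C S D : R).
Hypothesis P : quad_params u C S D.

Lemma u_gt0 : 0 < u. Proof. by rewrite -(qS2 P) exprn_gt0 // (qS_gt0 P). Qed.

Lemma C_bounds : 1 < C /\ C <= 1 + u / 2.
Proof. have := u_gt0; have := qC2 P; have := qC_gt0 P; split; nra. Qed.

Lemma S_bounds : 10 * u <= S /\ S <= 1 / 10.
Proof.
have := u_gt0; have := qS2 P; have := qS_gt0 P; have := qu_le P => ? ? S2 ?.
have S10 : S <= 1 / 10 by nra.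
by split; rewrite // -S2; nra.
Qed.

End Params.

(** * Mirrors that meet the line of the second side, possibly at infinity *)

Section MirrorExclusion.
Variables (R : realFieldType) (u C S D : R) (M : R -> R -> R -> Prop).
Hypotheses (P : quad_params u C S D) (Q : mirror_system u C S D M).

Lemma mirror_opp f0 f1 f2 : M f0 f1 f2 -> M (- f0) (- f1) (- f2).
Proof.
move=> Mf; have := mirror_refl Q Mf Mf => /=.
have -> : 2 * (f1 * f1 + f2 * f2 - f0 * f0) = 2.
  by have := mirror_norm Q Mf; rewrite !expr2 => ->; rewrite mulr1.
by rewrite !mulr_natl !mulr2n !opprD !addrA !subrr !add0r.
Qed.

(* The mirror is orthogonal to the second side; reflecting it in the first side
   about doubles [f0], until [f0] is comparable to [S]. *)
Lemma no_mirror_perp n f0 f1 : M f0 f1 0 -> 0 < f1 -> 0 < f0 < S ->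
  S <= 2 ^+ n * f0 -> False.
Proof.
have [C1 C1'] := C_bounds P; have [uS S10] := S_bounds P.
have u0 := u_gt0 P; have S2 := qS2 P; have C2 := qC2 P; have u100 := qu_le P.
have S0 := qS_gt0 P.
elim: n f0 f1 => [|n IHn] f0 f1 Mf f1_gt0 /andP[f0_gt0 f0_lt]; first by rewrite expr0; lra.
rewrite exprSr => le_S.
have Nf : f1 ^+ 2 = 1 + f0 ^+ 2 by have := mirror_norm Q Mf; rewrite expr0n /=; lra.
have f1_ge1 : 1 <= f1 by clear -P Q Nf f1_gt0; nra.
have f0u : f0 ^+ 2 <= u by rewrite -S2; clear -P Q f0_gt0 f0_lt S0; nra.
have f1_le : f1 <= 1 + u / 2.
  by apply: le_of_sqr; [lra | rewrite Nf; clear -P Q f0u; nra].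
case: (ltP f0 (S / 8)) => [f0_small | f0_large].
  (* The image of the first side under [f]: if [f] = (sinh t, cosh t, 0), this replaces t by 2 t. *)
  have := mirror_refl Q (mirror_opp (mirror_a Q)) Mf => /= /mirror_opp.
  set s := 2 * _; have -> : s = 2 * f1 by rewrite /s; ring.
  move=> Mf'; apply: (IHn (2 * f1 * f0) (2 * f1 ^+ 2 - 1)).
  - by move: Mf'; congr M; ring.
  - by clear -P Q f1_ge1; nra.
  - apply/andP; split; first by rewrite !mulr_gt0.
    have : f1 * f0 <= (1 + u / 2) * f0 by rewrite ler_pM2r.
    have : (1 + u / 2) * f0 <= 2 * f0 by rewrite ler_pM2r //; lra.
    lra.
  - apply: le_trans le_S _; rewrite -!mulrA ler_pM2l ?exprn_gt0 ?ltr0n //.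
    by rewrite ler_pM2l ?ltr0n //; clear -P Q f1_ge1 f0_gt0; nra.
have [y yE] : {y | y = f0 / (2 * S)} by exists (f0 / (2 * S)).
have f0E : f0 = 2 * S * y by rewrite yE; field; lra.
have y_ge : 1 / 16 <= y by rewrite yE ler_pdivlMr; lra.
have y_lt : y < 1 / 2 by rewrite yE ltr_pdivrMr; lra.
(* Now [f0] lies between S / 8 and S, and the image of [f] in the fourth side crosses n_1, n_2 and
   n_3. *)
have := mirror_refl Q Mf (mirror_d Q) => /=; set s := 2 * _.
have -> : s = - (2 * y) by rewrite /s yE; field; lra.
move=> /(sparse_2 Q) /=.
have -> : (1 + 2 * u) * (f1 - - (2 * y) * 0) -
    2 * S * C * (f0 - - (2 * y) * (1 / (2 * S))) = (1 + 2 * u) * (f1 - 2 * C * y).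
  by rewrite f0E -S2; field; lra.
set p := (X in X != 0); set q := (_ - 2 * S * C * _).
have Sq : S * q = (1 + 2 * u) * (2 * u + 1) * y - 2 * u * C * f1.
  by rewrite /q f0E -S2; field; lra.
have e1 : C * p + S * q = C * f1 - (1 + 2 * u) * y.
  by rewrite Sq /p; ring: C2.
have e2 : C * p - S * q = C * (1 + 4 * u) * f1 - (1 + 2 * u) * (3 + 4 * u) * y.
  by rewrite Sq /p; ring: C2.
rewrite e1 e2 /p {e1 e2 Sq p q s le_S IHn Mf f0_large f0u uS S10 S2}.
have Cf1 : 1 <= C * f1 <= 1011/1000.
  have c1 : C <= 201 / 200 by lra.
  have c2 : f1 <= 201 / 200 by lra.
  by clear -P Q C1 c1 f1_ge1 c2; apply/andP; split; nra.
have f1_gt : 0 < f1 - 2 * C * y.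
  have : (2 * C * y) ^+ 2 < f1 ^+ 2.
    rewrite Nf f0E !exprMn C2 (qS2 P); clear -P Q y_lt y_ge u0; nra.
  by clear -P Q f1_ge1 y_ge C1; rewrite ltr_pXn2r ?nnegrE //; [lra | nra | lra].
have g2 : f1 - 2 * C * y <= 881/1000 by clear -P Q C1 y_ge f1_le u100; nra.
have uy : 0 <= u * y <= u / 2 by clear -P Q u0 y_lt y_ge; apply/andP; split; nra.
have uuy : 0 <= u * (u * y) <= u / 2 by clear -P Q u0 u100 uy; apply/andP; split; nra.
have uCf : 0 <= u * (C * f1) <= 2 * u by clear -P Q u0 u100 Cf1; apply/andP; split; nra.
apply.
- by clear -P Q f1_gt u0; rewrite mulf_neq0 //; lra.
- by clear -P Q f1_gt g2 u0 u100; apply/andP; split; nra.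
- clear -P Q uy uuy uCf Cf1 y_ge y_lt u100; apply/andP; split; lra.
- clear -P Q uy uuy uCf Cf1 y_ge y_lt u100; apply/andP; split; lra.
Qed.

(** The samples of p cosh t - q sinh t at spacing arsinh S can have a minimum in the middle only if
    |q| is small against p. Then p^2 is close to 1 - w^2 <= 3/4, and the neighbours exceed p by at
    most u p. *)
Lemma locmin_bound p q w : p ^+ 2 = q ^+ 2 + 1 - w ^+ 2 -> 1 / 4 <= w ^+ 2 -> 0 < p ->
  p <= C * p - S * q -> p <= C * p + S * q ->
  p <= 1 /\ (C * p - S * q <= 1 /\ C * p + S * q <= 1).
Proof.
move=> Np w2 p0 h1 h2.
have [C1 C1'] := C_bounds P; have [uS S10] := S_bounds P.
have u0 := u_gt0 P; have u100 := qu_le P; have S0 := qS_gt0 P.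
have k1 : S * q <= u / 2 * p by clear -P Q h1 C1' p0; nra.
have k2 : - (S * q) <= u / 2 * p by clear -P Q h2 C1' p0; nra.
have k3 : (S * q) ^+ 2 <= (u / 2 * p) ^+ 2 by clear -P Q k1 k2; nra.
have k4 : q ^+ 2 <= p ^+ 2 / 400.
  have : u * q ^+ 2 <= u * (u / 4 * p ^+ 2).
    move: k3; rewrite exprMn (qS2 P); have -> // : (u / 2 * p) ^+ 2 = u * (u / 4 * p ^+ 2).
    by field.
  rewrite ler_pM2l // => k; apply: le_trans k _.
  have := sqr_ge0 p; clear -P Q u100; nra.
have k5 : p <= 87 / 100 by apply: le_of_sqr; lra.
have k6 : u * p <= p / 100 by clear -P Q u100 p0; nra.
have k7 : C * p <= p + u * p / 2 by clear -P Q C1' p0; nra.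
lra.
Qed.

(** The contradiction that [no_mirror_crossing] aims at: the products with the n_j are samples of a
    function convex where it is positive, and a mirror through P has its minimum near P. *)
Lemma no_locmin sh ch f0 f1 f2 : frame_sparse C S M sh ch -> ch ^+ 2 - sh ^+ 2 = 1 ->
  M f0 f1 f2 -> f2 != 0 -> f2 ^+ 2 <= 1 ->
  let p := ch * f1 - sh * f0 in let q := ch * f0 - sh * f1 in
  0 < p -> p <= C * p - S * q -> p <= C * p + S * q -> False.
Proof.
move=> sparse Nch; have [C1 C1'] := C_bounds P.
have main g0 g1 g2 : M g0 g1 g2 -> 1 / 4 <= g2 ^+ 2 ->
    let p := ch * g1 - sh * g0 in let q := ch * g0 - sh * g1 in
    0 < p -> p <= C * p - S * q -> p <= C * p + S * q -> False.
  move=> Mg w2 p q p0 h1 h2.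
  have Np : p ^+ 2 = q ^+ 2 + 1 - g2 ^+ 2.
    have N := mirror_norm Q Mg.
    have -> : p ^+ 2 = q ^+ 2 + (ch ^+ 2 - sh ^+ 2) * (g1 ^+ 2 - g0 ^+ 2).
      by rewrite /p /q; ring.
    by rewrite Nch mul1r; lra.
  have [b1 [b2 b3]] := locmin_bound Np w2 p0 h1 h2.
  apply: (sparse _ _ _ Mg); rewrite -/p -/q.
  - by rewrite gt_eqF.
  - by apply/andP; split; lra.
  - by apply/andP; split; lra.
  - by apply/andP; split; lra.
move=> Mf f2_neq0 f2_le p q p0 h1 h2.
(* If [f2 ^+ 2 < 1 / 4], replace [f] by the image of the second side under its
   reflection, which multiplies all products with the n_j by [2 f2] up to sign. *)
have [w2|w2] := leP (1 / 4) (f2 ^+ 2); first exact: main Mf w2 p0 h1 h2.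
have Mf' : M (2 * f2 * f0) (2 * f2 * f1) (2 * f2 ^+ 2 - 1).
  have := mirror_refl Q (mirror_b Q) Mf => /=.
  by congr M; ring.
have w2' : 1 / 4 <= (2 * f2 ^+ 2 - 1) ^+ 2 by clear -P Q w2; have := sqr_ge0 f2; nra.
have E1 : ch * (2 * f2 * f1) - sh * (2 * f2 * f0) = 2 * f2 * p by rewrite /p; ring.
have E2 : ch * (2 * f2 * f0) - sh * (2 * f2 * f1) = 2 * f2 * q by rewrite /q; ring.
have [f2_gt|f2_lt|f2_0] := ltgtP 0 f2; last by rewrite -f2_0 eqxx in f2_neq0.
- apply: (main _ _ _ Mf' w2'); rewrite ?E1 ?E2.
  + by rewrite !mulr_gt0.
  + by rewrite !(mulrCA _ (2 * f2)) -mulrBr ler_pM2l // mulr_gt0.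
  + by rewrite !(mulrCA _ (2 * f2)) -mulrDr ler_pM2l // mulr_gt0.
- have := mirror_opp Mf' => {}Mf'; rewrite -sqrrN in w2'.
  have E1' : ch * - (2 * f2 * f1) - sh * - (2 * f2 * f0) = 2 * - f2 * p by rewrite /p; ring.
  have E2' : ch * - (2 * f2 * f0) - sh * - (2 * f2 * f1) = 2 * - f2 * q by rewrite /q; ring.
  have k : 0 < 2 * - f2 by rewrite mulr_gt0 // oppr_gt0.
  apply: (main _ _ _ Mf' w2'); rewrite ?E1' ?E2'.
  + by rewrite mulr_gt0.
  + by rewrite !(mulrCA _ (2 * - f2)) -mulrBr ler_pM2l.
  + by rewrite !(mulrCA _ (2 * - f2)) -mulrDr ler_pM2l.
Qed.

Lemma frame_m1 : C ^+ 2 - (- S) ^+ 2 = 1.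
Proof. by rewrite sqrrN (qC2 P) (qS2 P); ring. Qed.

Lemma frame_2 : (1 + 2 * u) ^+ 2 - (2 * S * C) ^+ 2 = 1.
Proof. by rewrite !exprMn (qC2 P) (qS2 P); ring. Qed.

Section Meets.
Variables (x0 x1 x2 : R).
Hypothesis X : quad_point C S D x0 x1 x2.

Lemma x2_lt : x2 < x0.
Proof.
have Nx := pt_norm X; have x0_gt0 := pt_gt0 X.
by apply: lt_of_sqr; [lra | rewrite Nx; have := sqr_ge0 x1; lra].
Qed.

(** This is [x2_lt] in the frame of the third side: C x0 - S x1 is the time coordinate after the
    boost that takes n_1 to n_0. *)
Lemma x2_lt_boost : x2 < C * x0 - S * x1.
Proof.
have Nx := pt_norm X; have x0_gt0 := pt_gt0 X; have x1_gt0 := pt_a X.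
have [C1 _] := C_bounds P; have [_ S10] := S_bounds P; have S0 := qS_gt0 P.
have x10 : x1 < x0 by apply: lt_of_sqr; [lra | rewrite Nx; have := sqr_ge0 x2; lra].
have k : 0 < C * x0 - S * x1 by clear -P Q X C1 S10 S0 x0_gt0 x10 x1_gt0; nra.
apply: lt_of_sqr; first exact: ltW.
have -> : (C * x0 - S * x1) ^+ 2 = 1 + x2 ^+ 2 + (C * x1 - S * x0) ^+ 2.
  have -> : 1 + x2 ^+ 2 = x0 ^+ 2 - x1 ^+ 2 by rewrite Nx; ring.
  by ring: (qS2 P) (qC2 P).
by have := sqr_ge0 (C * x1 - S * x0); lra.
Qed.

(** The square of [pt_d] with D eliminated by [qD2], the form in which the fourth side enters the
    estimates. *)
Lemma xd_sqr : (1 + 4 * u) * x2 ^+ 2 < x0 ^+ 2.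
Proof.
have x0_gt0 := pt_gt0 X; have x2_gt0 := pt_b X; have xd := pt_d X.
have S0 := qS_gt0 P; have D0 := qD_gt0 P.
have : (2 * S * (D * x2)) ^+ 2 < x0 ^+ 2.
  rewrite ltr_pXn2r ?nnegrE ?ltW ?mulr_gt0 //.
  by move: xd; rewrite ltr_pdivlMr ?mulr_gt0 // mulrC.
by rewrite -(qD2 P) !exprMn (qS2 P) mulrA; congr (_ < _); ring.
Qed.

(** The products with the n_j are values of f1 cosh t - f0 sinh t, whose derivative is -f0 at n_0
    and -g0 at n_1. The three cases place its minimum left of the first side, right of the third, or
    between them. *)
Lemma no_mirror_crossing f0 f1 f2 : M f0 f1 f2 -> f2 != 0 -> f2 ^+ 2 <= 1 -> 0 < f1 ->
  x0 * f0 = x1 * f1 + x2 * f2 -> False.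
Proof.
move=> Mf f2_neq0 f2_le f1_gt0 xf.
have Nx := pt_norm X; have x0_gt0 := pt_gt0 X; have x1_gt0 := pt_a X.
have x2_gt0 := pt_b X; have xc := pt_c X.
have [C1 C1'] := C_bounds P; have [uS S10] := S_bounds P.
have u0 := u_gt0 P; have S0 := qS_gt0 P; have S2 := qS2 P; have C2 := qC2 P.
have Nf := mirror_norm Q Mf.
have f01 : f0 ^+ 2 <= f1 ^+ 2 by lra.
have f0_le : f0 <= f1 by apply: le_of_sqr; lra.
have f0_ge : - f0 <= f1 by apply: le_of_sqr; rewrite ?sqrrN; lra.
set y1 := C * f1 - S * f0; set g0 := C * f0 - S * f1.
have y1_gt0 : 0 < y1 by rewrite /y1; clear -P Q X C1 S0 S10 f0_le f0_ge f1_gt0; nra.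
have f0E : f0 = C * g0 + S * y1 by rewrite /g0 /y1; ring: S2 C2.
have f1E : f1 = C * y1 + S * g0 by rewrite /g0 /y1; ring: S2 C2.
have [f0_le0|f0_gt0] := leP f0 0.
  (* Since x1 > 0, incidence with x gives |f0| <= |f2|, hence f1^2 = 1 + f0^2 - f2^2 <= 1. *)
  have f1_le1 : f1 <= 1.
    have k : x0 * - f0 <= x2 * - f2.
      have : 0 < x1 * f1 by rewrite mulr_gt0.
      lra.
    have k2 : - f0 <= - f2.
      rewrite leNgt; apply/negP => h.
      have := ltr_pM2l x0_gt0 (- f2) (- f0); rewrite h => /idP h2.
      have := x2_lt; have := mulr_gt0 x1_gt0 f1_gt0; clear -P Q X k h h2 x2_gt0 f0_le0 xf.
      move=> h3 h4.
      have : x2 * - f2 <= x2 * - f0 by rewrite ler_pM2l // ltW.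
      have : x2 * - f0 <= x0 * - f0 by rewrite ler_wpM2r ?oppr_ge0 // ltW.
      lra.
    have k3 : f0 ^+ 2 <= f2 ^+ 2 by clear -P Q X k2 f0_le0; nra.
    by clear -P Q X k3 f2_le Nf; apply: le_of_sqr; lra.
  set z := C * f1 + S * f0.
  have z_gt0 : 0 < z by rewrite /z; clear -P Q X C1 S0 S10 f0_le f0_ge f1_gt0; nra.
  have Sf0 : S * f0 <= 0 by rewrite pmulr_rle0.
  (* [z] is the product with n_(-1), and 2 C z - f1 the one with n_(-2). Either n_0 or n_(-1)
     carries a local minimum, or n_(-2), n_(-1), n_0 are all crossed. *)
  have [zge|zlt] := leP f1 z.
    apply: (no_locmin (sparse_0 Q) _ Mf f2_neq0 f2_le); rewrite ?mul1r ?mul0r ?subr0 //.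
    - by rewrite expr1n expr0n subr0.
    - by move: zge; rewrite /z; lra.
  have [zz|zz] := leP (2 * C * z - f1) 1.
    apply: (sparse_m1 Q Mf); rewrite ?mulNr ?opprK -?/z.
    - by rewrite gt_eqF.
    - by clear -P Q X z_gt0 zlt f1_le1; apply/andP; split; lra.
    - have -> : C * z - S * (C * f0 + S * f1) = f1 by rewrite /z; ring: S2 C2.
      by clear -P Q X f1_gt0 f1_le1; apply/andP; split; lra.
    - have -> : C * z + S * (C * f0 + S * f1) = 2 * C * z - f1 by rewrite /z; ring: S2 C2.
      rewrite zz andbT /z.
      have -> : 2 * C * (C * f1 + S * f0) - f1 = (1 + 2 * u) * f1 + 2 * C * S * f0.
        by ring: C2.
      clear -P Q X f0_ge f1_gt0 f1_le1 u0 C1 C1' S0 S10 f0_le0 uS.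
      have : 0 <= C * S by rewrite mulr_ge0; lra.
      have : C * S <= 1/5 by nra.
      nra.
  apply: (no_locmin (sparse_m1 Q) frame_m1 Mf f2_neq0 f2_le); rewrite ?mulNr ?opprK -?/z //.
  - have -> : C * z - S * (C * f0 + S * f1) = f1 by rewrite /z; ring: S2 C2.
    exact: ltW.
  - have -> : C * z + S * (C * f0 + S * f1) = 2 * C * z - f1 by rewrite /z; ring: S2 C2.
    by clear -P Q X zz z_gt0 zlt f1_le1; lra.
have [g0_ge0|g0_lt0] := leP 0 g0.
  (* The counterpart of the bound on [f1] above, in the frame of the third side. *)
  have y1_le1 : y1 <= 1.
    have Eb : x2 * f2 = (C * x0 - S * x1) * g0 - (C * x1 - S * x0) * y1.
      have -> : x2 * f2 = x0 * f0 - x1 * f1 by lra.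
      by rewrite /g0 /y1; ring: S2 C2.
    have kb : 0 <= (S * x0 - C * x1) * y1 by rewrite mulr_ge0 // ltW // subr_gt0.
    have x2b := x2_lt_boost.
    have k2 : g0 <= f2.
      rewrite leNgt; apply/negP => h.
      have : x2 * f2 < x2 * g0 by rewrite ltr_pM2l.
      have : x2 * g0 <= (C * x0 - S * x1) * g0 by rewrite ler_wpM2r // ltW.
      lra.
    have k3 : g0 ^+ 2 <= f2 ^+ 2 by clear -P Q X k2 g0_ge0; nra.
    have Ng : y1 ^+ 2 = 1 + g0 ^+ 2 - f2 ^+ 2.
      have -> : 1 + g0 ^+ 2 - f2 ^+ 2 = g0 ^+ 2 + f1 ^+ 2 - f0 ^+ 2 by lra.
      by rewrite /y1 /g0; ring: S2 C2.
    by clear -P Q X Ng k3; apply: le_of_sqr; lra.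
  have [yge|ylt] := leP y1 (C * y1 - S * g0).
    apply: (no_locmin (sparse_1 Q) _ Mf f2_neq0 f2_le); rewrite -?/y1 -?/g0 //.
    - by rewrite C2 S2; ring.
    - have : 0 <= S * g0 by rewrite mulr_ge0 // ltW.
      lra.
  set y2 := C * y1 - S * g0 in ylt *.
  have p2E : (1 + 2 * u) * f1 - 2 * S * C * f0 = y2 by rewrite /y2 f1E f0E; ring: S2 C2.
  have q2E : (1 + 2 * u) * f0 - 2 * S * C * f1 = C * g0 - S * y1.
    by rewrite f1E f0E; ring: S2 C2.
  have e1 : C * y2 - S * (C * g0 - S * y1) = 2 * C * y2 - y1 by rewrite /y2; ring: S2 C2.
  have e2 : C * y2 + S * (C * g0 - S * y1) = y1 by rewrite /y2; ring: S2 C2.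
  have g0_le : g0 <= y1.
    have Ng : g0 ^+ 2 - y1 ^+ 2 = f0 ^+ 2 - f1 ^+ 2 by rewrite /y1 /g0; ring: S2 C2.
    by clear -P Q X Ng Nf f2_le y1_gt0; apply: le_of_sqr; lra.
  have y2_gt0 : 0 < y2 by rewrite /y2; clear -P Q X C1 S0 S10 g0_ge0 g0_le y1_gt0; nra.
  have [zz|zz] := leP (2 * C * y2 - y1) 1.
    apply: (sparse_2 Q Mf); rewrite ?p2E ?q2E ?e1 ?e2.
    - by rewrite gt_eqF.
    - by clear -P Q X y2_gt0 ylt y1_le1; apply/andP; split; lra.
    - rewrite zz andbT; have := mulr_gt0 (qC_gt0 P) y2_gt0; clear -P Q X y1_le1; lra.
    - by clear -P Q X y1_gt0 y1_le1; apply/andP; split; lra.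
  apply: (no_locmin (sparse_2 Q) frame_2 Mf f2_neq0 f2_le); rewrite ?p2E ?q2E ?e1 ?e2 //.
  - by clear -P Q X zz ylt y1_le1; lra.
  - exact: ltW.
have Sg0 : S * g0 < 0 by rewrite pmulr_rlt0.
have Sf0 : 0 < S * f0 by rewrite mulr_gt0.
have [yge|ylt] := leP f1 y1.
  apply: (no_locmin (sparse_0 Q) _ Mf f2_neq0 f2_le); rewrite ?mul1r ?mul0r ?subr0 //.
  - by rewrite expr1n expr0n subr0.
  - by clear -P Q X yge Sf0; move: yge; rewrite /y1; lra.
apply: (no_locmin (sparse_1 Q) _ Mf f2_neq0 f2_le); rewrite -?/y1 -?/g0 //.
- by rewrite C2 S2; ring.
- have : y1 <= C * y1 by rewrite ler_peMl ?ltW.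
  lra.
- by rewrite -f1E ltW.
Qed.

End Meets.

End MirrorExclusion.

(** * Mirrors disjoint from the second side and orthogonal to the first or third *)

Section MirrorExclusion.
Variables (R : realFieldType) (u C S D : R) (M : R -> R -> R -> Prop).
Hypotheses (P : quad_params u C S D) (Q : mirror_system u C S D M).

(** The mirror is orthogonal to the first side, so its product with n_j is odd in j. If the product
    with n_2 exceeds 1 in absolute value, the image of the third side under [f] takes the place of
    [f]. *)
Lemma no_mirror_ultra_a f0 f2 : M f0 0 f2 -> 0 < f0 -> S * f0 < 1 / 2 -> False.
Proof.
move=> Mf f0_gt0; set y := S * f0 => y_lt.
have [C1 C1'] := C_bounds P; have [uS S10] := S_bounds P.
have u0 := u_gt0 P; have S0 := qS_gt0 P; have S2 := qS2 P; have C2 := qC2 P.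
have u100 := qu_le P; have C0 := qC_gt0 P.
have y_gt0 : 0 < y by rewrite mulr_gt0.
have [small|large] := leP (2 * C * y) 1.
  apply: (sparse_1 Q Mf); rewrite mulr0 sub0r -/y.
  - by rewrite oppr_eq0 gt_eqF.
  - by apply/andP; split; lra.
  - have -> : C * - y - S * (C * f0 - S * 0) = - (2 * C * y) by rewrite /y; ring.
    by apply/andP; split; nra.
  - have -> : C * - y + S * (C * f0 - S * 0) = 0 by rewrite /y; ring.
    by apply/andP; split; lra.
have Mg : M (S + 2 * y * f0) C (2 * y * f2).
  by have := mirror_refl Q (mirror_c Q) Mf => /=; rewrite /y; congr M; ring.
have yy : y * f0 * S = y ^+ 2 by rewrite /y; ring.
have yu : y ^+ 2 = u * f0 ^+ 2 by rewrite /y exprMn S2.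
have p2E : (1 + 2 * u) * C - 2 * S * C * (S + 2 * y * f0) = C * (1 - 4 * y ^+ 2).
  by rewrite -yy -S2; ring.
have e1 : C * (C * (1 - 4 * y ^+ 2)) -
    S * ((1 + 2 * u) * (S + 2 * y * f0) - 2 * S * C * C) =
    (1 + 2 * u) - (6 + 8 * u) * y ^+ 2.
  by rewrite -yy /y -S2; ring: C2 S2.
have e2 : C * (C * (1 - 4 * y ^+ 2)) +
    S * ((1 + 2 * u) * (S + 2 * y * f0) - 2 * S * C * C) = 1 - 2 * y ^+ 2.
  by rewrite -yy /y -S2; ring: C2 S2.
have y2_lt : y ^+ 2 < 1 / 4 by clear -P Q y_lt y_gt0; nra.
have y2_gt : 24 / 100 < y ^+ 2.
  have : 1 ^+ 2 < (2 * C * y) ^+ 2 by rewrite ltr_pXn2r ?nnegrE ?mulr_ge0 // ltW.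
  by rewrite !exprMn C2 expr1n; clear -P Q u100 y2_lt u0; nra.
have uy : 0 <= u * y ^+ 2 <= 1 / 400 by clear -P Q u100 y2_lt y2_gt u0; apply/andP; split; nra.
apply: (sparse_2 Q Mg); rewrite p2E ?e1 ?e2; clear -P Q C0 C1 C1' u0 u100 y2_lt y2_gt uy.
- by rewrite mulf_neq0 ?gt_eqF // subr_gt0; lra.
- by clear -P Q C1 C1' u100 y2_lt y2_gt; apply/andP; split; nra.
- by apply/andP; split; lra.
- by apply/andP; split; lra.
Qed.

(** The mirror is orthogonal to the third side and has products y with n_0 and 2 C y with n_(-1). If
    the latter exceeds 1, the image of [f] in the fourth side is used; its products with n_1, n_0,
    n_(-1) are q, y, 2 C y - q. *)
Lemma no_mirror_ultra_c g y f2 : S * g = y -> M (C * g) y f2 -> 0 < y -> 0 < f2 ->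
  3 * y ^+ 2 < 1 + u -> False.
Proof.
move=> Sg Mf y_gt0 f2_gt0 y_lt.
have [C1 C1'] := C_bounds P; have [uS S10] := S_bounds P.
have u0 := u_gt0 P; have S0 := qS_gt0 P; have S2 := qS2 P; have C2 := qC2 P.
have u100 := qu_le P; have C0 := qC_gt0 P; have D0 := qD_gt0 P; have D2 := qD2 P.
have y_lt' : y < 59 / 100 by apply: lt_of_sqr; lra.
have Cy0 : 0 < 2 * C * y by rewrite !mulr_gt0.
have [small|large] := leP (2 * C * y) 1.
  apply: (sparse_0 Q Mf); rewrite !mul0r !mul1r !subr0.
  - by rewrite gt_eqF.
  - by apply/andP; split; lra.
  - have -> : C * y - S * (C * g) = 0 by rewrite -Sg; ring.
    by apply/andP; split; lra.
  - have -> : C * y + S * (C * g) = 2 * C * y by rewrite -Sg; ring.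
    by apply/andP; split; lra.
have Nf := mirror_norm Q Mf.
have [k kE] : {k | k = C * y / (2 * u)} by exists (C * y / (2 * u)).
have [w wE] : {w | w = f2 * D} by exists (f2 * D).
have [q qE] : {q | q = w - k} by exists (w - k).
have gE : g = y / S by rewrite -Sg; field; lra.
have Sk : C * g / (2 * S) = k by rewrite gE kE -S2; field; lra.
have Mh : M (C * g - q / S) y (f2 - 2 * q * D).
  have := mirror_refl Q Mf (mirror_d Q) => /=; set s := 2 * _.
  have -> : s = 2 * q by rewrite /s qE wE -Sk; field; lra.
  by congr M; [field; lra | ring].
have w0 : 0 < w by rewrite wE mulr_gt0.
have k0 : 0 < k by rewrite kE divr_gt0 ?mulr_gt0.
have uk : 2 * u * k = C * y by rewrite kE; field; lra.
have uf2 : u * f2 ^+ 2 = u + y ^+ 2.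
  have -> : f2 ^+ 2 = 1 + (C * g) ^+ 2 - y ^+ 2 by lra.
  by rewrite gE -S2; field: C2 S2; lra.
have w2 : 4 * u ^+ 2 * w ^+ 2 = (u + y ^+ 2) * (1 + 4 * u).
  by rewrite wE exprMn -D2 -uf2; ring.
have Cy : 1 / 2 < C * y <= 6 / 10 by clear -P Q large C1 C1' u100 y_lt' y_gt0; apply/andP; split; nra.
have y2 : 0 < y ^+ 2 by rewrite exprn_gt0.
have u2 : 0 < 4 * u ^+ 2 by rewrite mulr_gt0 ?exprn_gt0.
(* Squared and multiplied by 4 u^2, the two bounds on [w] become polynomial in u, C y and y^2. *)
have q_le : w <= 1 + k.
  apply: le_of_sqr; first by lra.
  rewrite -(ler_pM2l u2) w2.
  have -> : 4 * u ^+ 2 * (1 + k) ^+ 2 = 4 * u ^+ 2 + 4 * u * (C * y) + (1 + u) * y ^+ 2.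
    have -> : (1 + u) * y ^+ 2 = (2 * u * k) ^+ 2 by rewrite uk exprMn C2.
    by rewrite -uk; ring.
  rewrite -subr_ge0.
  have -> : 4 * u ^+ 2 + 4 * u * (C * y) + (1 + u) * y ^+ 2 - (u + y ^+ 2) * (1 + 4 * u) =
    u * (4 * (C * y) - 1 - 3 * y ^+ 2) by ring.
  have yC : y ^+ 2 <= 59 / 100 * (C * y) by clear -P Q C1 y_lt' y_gt0; nra.
  rewrite mulr_ge0 ?ltW //; clear -P Q yC Cy; lra.
have q_ge : 2 * C * y - 1 + k <= w.
  apply: le_of_sqr; first by lra.
  rewrite -(ler_pM2l u2) w2.
  have -> : 4 * u ^+ 2 * (2 * C * y - 1 + k) ^+ 2 = 4 * u ^+ 2 * (2 * C * y - 1) ^+ 2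
     + 4 * u * (2 * (1 + u) * y ^+ 2 - C * y) + (1 + u) * y ^+ 2.
    have -> : (1 + u) * y ^+ 2 = (2 * u * k) ^+ 2 by rewrite uk exprMn C2.
    have -> : 2 * (1 + u) * y ^+ 2 - C * y = (2 * C * y - 1) * (2 * u * k).
      by rewrite uk; ring: C2.
    ring.
  rewrite -subr_ge0.
  set z := (_ - _ : R).
  have -> : z = u * (1 + 4 * (C * y) + 4 * u - 5 * y ^+ 2 - 8 * (u * y ^+ 2)
     - 4 * (u * (2 * C * y - 1) ^+ 2)) by rewrite /z; ring.
  rewrite mulr_ge0 ?ltW //; clear -P Q Cy y_gt0 y_lt' u0 u100 y_lt.
  have k1 : (2 * C * y - 1) ^+ 2 <= 1 by clear -P Q Cy; case/andP: Cy => *; nra.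
  have k2 : u * (2 * C * y - 1) ^+ 2 <= u by rewrite ler_piMr // ltW.
  have k3 : u * y ^+ 2 <= u by rewrite ler_piMr ?ltW //; lra.
  lra.
have e0 : C * y + S * (C * g - q / S) = 2 * C * y - q by rewrite -Sg; field; rewrite gt_eqF.
have e1 : C * y - S * (C * g - q / S) = q by rewrite -Sg; field; rewrite gt_eqF.
apply: (sparse_0 Q Mh); rewrite !mul0r !mul1r !subr0 ?e0 ?e1;
  clear -P Q q_le q_ge qE Cy large y_gt0 y_lt'.
- by rewrite gt_eqF.
- by apply/andP; split; lra.
- by apply/andP; split; lra.
- by apply/andP; split; lra.
Qed.

End MirrorExclusion.

(** * Mirrors disjoint from the second side, by the position of their common perpendicular with
    it *)

Section MirrorExclusion.
Variables (R : realFieldType) (u C S D : R) (M : R -> R -> R -> Prop).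
Hypotheses (P : quad_params u C S D) (Q : mirror_system u C S D M).

(** Here |f1| < f0, so f1 cosh t - f0 sinh t decreases and has a single zero. This lemma and the
    next two treat a zero left of the first side, between the first and third, and right of the
    third; the three mirrors n_j are chosen around the zero. *)
Lemma no_mirror_ultra_left f0 f1 f2 : M f0 f1 f2 -> 0 < f0 -> - f0 < f1 -> f1 < 0 ->
  4 * u * f0 ^+ 2 + f1 ^+ 2 < 1 -> False.
Proof.
move=> Mf f0_gt0 f1_gt f1_lt0 A.
have [C1 C1'] := C_bounds P; have [uS S10] := S_bounds P.
have u0 := u_gt0 P; have S0 := qS_gt0 P; have S2 := qS2 P; have C2 := qC2 P.
have f1_sqr := sqr_ge0 f1.
have uf0 : 0 <= u * f0 ^+ 2 by rewrite mulr_ge0 ?sqr_ge0 // ltW.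
have f1_gt1 : - f1 < 1 by apply: lt_of_sqr; rewrite ?sqrrN; lra.
have Sf0_lt : S * f0 < 1 / 2.
  by apply: lt_of_sqr; rewrite ?[(S * _) ^+ 2]exprMn ?S2; lra.
have Sf0_gt0 : 0 < S * f0 by rewrite mulr_gt0.
have k : S * - f1 < S * f0 by rewrite ltr_pM2l //; lra.
have [z zE] : {z | z = C * f1 + S * f0} by exists (C * f1 + S * f0).
have eq1 : C * z - S * (C * f0 + S * f1) = f1 by rewrite zE; ring: S2 C2.
have eq2 : C * z + S * (C * f0 + S * f1) = 2 * C * z - f1 by rewrite zE; ring: S2 C2.
have eq3 : 2 * C * z - f1 = (1 + 2 * u) * f1 + 2 * (C * (S * f0)).
  by rewrite zE; ring: C2.
have Cf1 : C * f1 < 0 by rewrite pmulr_rlt0 // (qC_gt0 P).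
clear uf0 A f1_sqr; have [z_lt0|z_gt0|z_0] := ltgtP z 0; last first.
- apply: (sparse_0 Q Mf); rewrite !mul0r !mul1r !subr0 -?zE.
  + by rewrite lt_eqF.
  + by apply/andP; split; lra.
  + by apply/andP; split; lra.
  + by apply/andP; split; lra.
- apply: (sparse_0 Q Mf); rewrite !mul0r !mul1r !subr0 -?zE.
  + by rewrite lt_eqF.
  + by apply/andP; split; lra.
  + by apply/andP; split; lra.
  + by apply/andP; split; lra.
have z_ge : f1 <= z by rewrite zE; clear -P Q C1 C1' k uS f1_lt0 u0; nra.
have Cz : C * z < 0 by rewrite pmulr_rlt0 // (qC_gt0 P).
have kk : 1 * (S * f0) <= C * (S * f0) by rewrite ler_pM2r // ltW.
have ku : 10 * u * - f1 <= S * - f1 by rewrite ler_wpM2r; lra.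
have ku0 : 0 <= u * - f1 by rewrite mulr_ge0; lra.
apply: (sparse_m1 Q Mf); rewrite ?mulNr ?opprK -?zE ?eq1 ?eq2;
  clear eq1 eq2 zE S2 C2 Mf.
- by rewrite lt_eqF.
- by apply/andP; split; lra.
- by apply/andP; split; lra.
- by apply/andP; split; [rewrite eq3; lra | lra].
Qed.

Lemma no_mirror_ultra_between f0 f1 f2 q : M f0 f1 f2 -> 0 < f1 ->
  q = S * (C * f0 - S * f1) -> 0 < q ->
  3 * q ^+ 2 + (1 + u) * (C * f1 - S * f0) ^+ 2 < 1 + u -> C * f1 - S * f0 < 0 -> False.
Proof.
have [C1 C1'] := C_bounds P; have [uS S10] := S_bounds P.
have u0 := u_gt0 P; have S0 := qS_gt0 P; have S2 := qS2 P; have C2 := qC2 P.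
have u100 := qu_le P; have C0 := qC_gt0 P.
have [y1 y1E] : {y1 | y1 = C * f1 - S * f0} by exists (C * f1 - S * f0).
rewrite -y1E => Mf f1_gt0 qE q_gt0 B y1_lt0.
have e10 : C * y1 + S * (C * f0 - S * f1) = f1 by rewrite y1E; ring: S2 C2.
have e12 : C * y1 - S * (C * f0 - S * f1) = C * y1 - q by rewrite qE.
have e0m : C * f1 + S * f0 = 2 * C * f1 - y1 by rewrite y1E; ring.
have f1q : f1 = C * y1 + q by rewrite qE.
have y1_sqr := sqr_ge0 y1; have q_sqr := sqr_ge0 q.
have u1 : 0 < 1 + u by lra.
have q_lt : q < 59 / 100.
  apply: lt_of_sqr; first by lra.
  have : 0 <= (1 + u) * y1 ^+ 2 by rewrite mulr_ge0 // ltW.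
  lra.
have y1_gt : - y1 < 1.
  apply: lt_of_sqr; rewrite // sqrrN expr1n -(ltr_pM2l u1) mulr1; lra.
have Cy1 : 102 / 100 * y1 <= C * y1 <= y1.
  by clear -P Q C1 C1' u100 y1_lt0; apply/andP; split; nra.
clear B y1_sqr q_sqr qE; have [small|large] := leP (q - C * y1) 1.
  apply: (sparse_1 Q Mf); rewrite -?y1E ?e10 ?e12; clear e10 e12 e0m y1E S2 C2 Mf.
  - by rewrite lt_eqF.
  - by apply/andP; split; lra.
  - by apply/andP; split; lra.
  - by apply/andP; split; lra.
apply: (sparse_0 Q Mf); rewrite !mul0r !mul1r !subr0 ?e0m -?y1E;
  clear e10 e12 e0m y1E S2 C2 Mf.
- by rewrite gt_eqF.
- by apply/andP; split; lra.
- by apply/andP; split; lra.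
- have f1_le : f1 <= 1 / 5 by lra.
  have Cf1 : f1 <= C * f1 <= 102 / 100 * f1.
    by clear -P Q C1 C1' u100 f1_gt0; apply/andP; split; nra.
  by apply/andP; split; lra.
Qed.

Lemma no_mirror_ultra_right f0 f1 f2 q : M f0 f1 f2 -> 0 < f1 ->
  q = S * (C * f0 - S * f1) -> 0 < q ->
  3 * q ^+ 2 + (1 + u) * (C * f1 - S * f0) ^+ 2 < 1 + u ->
  0 < C * f1 - S * f0 -> S * (C * f1 - S * f0) < q -> False.
Proof.
have [C1 C1'] := C_bounds P; have [uS S10] := S_bounds P.
have u0 := u_gt0 P; have S0 := qS_gt0 P; have S2 := qS2 P; have C2 := qC2 P.
have u100 := qu_le P; have C0 := qC_gt0 P.
have [y1 y1E] : {y1 | y1 = C * f1 - S * f0} by exists (C * f1 - S * f0).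
rewrite -y1E => Mf f1_gt0 qE q_gt0 B y1_gt0 qS.
have e10 : C * y1 + S * (C * f0 - S * f1) = f1 by rewrite y1E; ring: S2 C2.
have e12 : C * y1 - S * (C * f0 - S * f1) = C * y1 - q by rewrite qE.
have f1q : f1 = C * y1 + q by rewrite qE.
have [y2 y2E] : {y2 | y2 = C * y1 - q} by exists (C * y1 - q).
have p2E : (1 + 2 * u) * f1 - 2 * S * C * f0 = y2.
  by rewrite y2E qE y1E; ring: S2 C2.
have e1 : C * y2 - S * ((1 + 2 * u) * f0 - 2 * S * C * f1) = 2 * C * y2 - y1.
  by rewrite y2E qE y1E; ring: S2 C2.
have e2 : C * y2 + S * ((1 + 2 * u) * f0 - 2 * S * C * f1) = y1.
  by rewrite y2E qE y1E; ring: S2 C2.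
have y1_sqr := sqr_ge0 y1; have q_sqr := sqr_ge0 q.
have u1 : 0 < 1 + u by lra.
have q_lt : q < 59 / 100.
  apply: lt_of_sqr; first by lra.
  have : 0 <= (1 + u) * y1 ^+ 2 by rewrite mulr_ge0 // ltW.
  lra.
have y1_lt : y1 < 1.
  apply: lt_of_sqr; rewrite // expr1n -(ltr_pM2l u1) mulr1; lra.
have Cy1 : y1 <= C * y1 <= 102 / 100 * y1.
  by clear -P Q C1 C1' u100 y1_gt0; apply/andP; split; nra.
have y2_le : y2 <= (C - S) * y1 by rewrite y2E; lra.
have y2_le' : y2 <= y1.
  by apply: le_trans y2_le _; rewrite ler_piMl ?ltW //; lra.
clear y1_sqr q_sqr; have [y2_lt0|y2_gt0|y2_0] := ltgtP y2 0; last first.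
(* The zero lies on n_2 itself. Reflection in the third side moves it to n_0, where
   [no_mirror_ultra_a] applies. *)
- have Mg := mirror_refl Q Mf (mirror_c Q); move: Mg => /=; set s := 2 * _.
  have -> : s = 2 * y1 by rewrite /s y1E; ring.
  have k : C * y1 = q by lra.
  have E1 : f1 - 2 * y1 * C = 0 by rewrite f1q -k; ring.
  have E0 : S * (f0 - 2 * y1 * S) = y1.
    have -> : S * (f0 - 2 * y1 * S) = S * f0 - 2 * y1 * S ^+ 2 by ring.
    have -> : S * f0 = C * f1 - y1 by rewrite y1E; ring.
    by rewrite f1q -k S2; ring: C2.
  rewrite E1 => Mg; apply: (no_mirror_ultra_a P Q Mg).
  + by rewrite -(pmulr_rgt0 _ S0) E0.
  + rewrite E0; apply: lt_of_sqr; first by lra.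
    move: B; rewrite -k [(C * y1) ^+ 2]exprMn C2.
    have -> : 3 * ((1 + u) * y1 ^+ 2) + (1 + u) * y1 ^+ 2 = (1 + u) * (4 * y1 ^+ 2) by ring.
    by rewrite gtr_pMr //; lra.
- clear B; have Cy2 : 0 < C * y2 by rewrite mulr_gt0.
  have k1 : C * y2 <= C * ((C - S) * y1) by rewrite ler_pM2l.
  have k2 : C * (C - S) * y1 <= y1.
    rewrite ler_piMl ?ltW // mulrBr -expr2 C2.
    have : 1 * S <= C * S by rewrite ler_pM2r // ltW.
    lra.
  apply: (sparse_2 Q Mf); rewrite ?p2E ?e1 ?e2;
    clear -P Q k1 k2 Cy2 y2_gt0 y2_le' y1_gt0 y1_lt.
  + by rewrite gt_eqF.
  + by apply/andP; split; lra.
  + by apply/andP; split; lra.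
  + by apply/andP; split; lra.
- clear B; have [f1_le|f1_ge] := leP f1 1.
    apply: (sparse_1 Q Mf); rewrite -?y1E ?e10 ?e12 -?y2E;
      clear -P Q f1q f1_le y2E y2_lt0 y1_gt0 y1_lt q_gt0 q_lt Cy1 f1_gt0 y2_le'.
    + by rewrite gt_eqF.
    + by apply/andP; split; lra.
    + by apply/andP; split; lra.
    + by apply/andP; split; lra.
  have y2_ge : - (1 / 5) <= y2 by lra.
  have Cy2 : 102 / 100 * y2 <= C * y2 <= y2.
    by clear -P Q C1 C1' u100 y2_lt0; apply/andP; split; nra.
  apply: (sparse_2 Q Mf); rewrite ?p2E ?e1 ?e2;
    clear -P Q y2_ge Cy2 y2_lt0 y1_gt0 y1_lt y2_le' f1q f1_ge q_lt y2E Cy1.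
  + by rewrite lt_eqF.
  + by apply/andP; split; lra.
  + by apply/andP; split; lra.
  + by apply/andP; split; lra.
Qed.

End MirrorExclusion.

(** * No mirror through an interior point of the quadrilateral *)

Section MirrorExclusion.
Variables (R : realFieldType) (u C S D : R) (M : R -> R -> R -> Prop).
Hypotheses (P : quad_params u C S D) (Q : mirror_system u C S D M).

Section MeetsUltra.
Variables (x0 x1 x2 : R).
Hypothesis X : quad_point C S D x0 x1 x2.

(** Incidence with x turns [xd_sqr] into a bound on [f] alone. It is the fourth side that keeps the
    products with the n_j small: a line far from the second side can have arbitrarily large ones.
    For f1 >= 0 the computation is done in the frame of the third side. *)
Lemma ultra_bounds f0 f1 f2 : M f0 f1 f2 -> 1 < f2 -> x0 * f0 = x1 * f1 + x2 * f2 ->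
  [/\ 0 < f0, - f0 < f1 < f0,
    f1 <= 0 -> 4 * u * f0 ^+ 2 + f1 ^+ 2 < 1 &
    0 <= f1 -> 3 * (S * (C * f0 - S * f1)) ^+ 2 + (1 + u) * (C * f1 - S * f0) ^+ 2 < 1 + u].
Proof.
move=> Mf f2_gt xf.
have Nx := pt_norm X; have x0_gt0 := pt_gt0 X; have x1_gt0 := pt_a X.
have x2_gt0 := pt_b X; have xc := pt_c X.
have [C1 C1'] := C_bounds P; have [uS S10] := S_bounds P.
have u0 := u_gt0 P; have S0 := qS_gt0 P; have S2 := qS2 P; have C2 := qC2 P.
have C0 := qC_gt0 P; have Nf := mirror_norm Q Mf.
have f22 : 1 < f2 ^+ 2 by rewrite exprn_egt1.
have x10 : x1 < x0 by apply: lt_of_sqr; [lra | rewrite Nx; have := sqr_ge0 x2; lra].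
have x2f2 : 0 < x2 * f2 by rewrite mulr_gt0 // (lt_trans ltr01).
have f0_gt0 : 0 < f0.
  rewrite ltNge; apply/negP => h.
  have h1 : - f1 <= - f0 by apply: le_of_sqr; rewrite ?sqrrN; lra.
  have : x1 * - f1 <= x1 * - f0 by rewrite ler_pM2l.
  have : x1 * - f0 <= x0 * - f0 by rewrite ler_wpM2r ?oppr_ge0 // ltW.
  lra.
have f1_lt : f1 < f0 by apply: lt_of_sqr; lra.
have f1_gt : - f0 < f1.
  by rewrite ltrNl; apply: lt_of_sqr; rewrite ?sqrrN; lra.
have xd2 : (1 + 4 * u) * (x2 * f2) ^+ 2 < x0 ^+ 2 * f2 ^+ 2.
  by rewrite exprMn mulrA ltr_pM2r ?(xd_sqr P X) //; lra.
have x02 : 0 < x0 ^+ 2 by rewrite exprn_gt0.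
have u41 : 0 < 1 + 4 * u by lra.
split; [by [] | by rewrite f1_gt | move=> f1_le0 | move=> f1_ge0].
  have k : (x0 * f0) ^+ 2 <= (x2 * f2) ^+ 2.
    have h1 : x1 * f1 <= 0 by rewrite pmulr_rle0.
    have h2 := mulr_gt0 x0_gt0 f0_gt0.
    by rewrite ler_pXn2r // ?nnegrE; lra.
  have : x0 ^+ 2 * ((1 + 4 * u) * f0 ^+ 2) < x0 ^+ 2 * f2 ^+ 2.
    apply: le_lt_trans xd2.
    have -> : x0 ^+ 2 * ((1 + 4 * u) * f0 ^+ 2) = (1 + 4 * u) * (x0 * f0) ^+ 2 by ring.
    by rewrite ler_pM2l.
  rewrite ltr_pM2l //; lra.
have [g gE] : {g | g = C * f0 - S * f1} by exists (C * f0 - S * f1).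
have g_gt0 : 0 < g.
  rewrite gE; have : S * f1 <= 1 * f1 by rewrite ler_wpM2r //; lra.
  have : 1 * f0 <= C * f0 by rewrite ler_pM2r // ltW.
  lra.
have k : (x0 * g) ^+ 2 <= (C * (x2 * f2)) ^+ 2.
  have n1 : 0 <= x0 * g by rewrite mulr_ge0 ?ltW.
  have n2 : 0 <= C * (x2 * f2) by rewrite mulr_ge0 // ltW.
  rewrite ler_pXn2r ?nnegrE //.
  have -> : C * (x2 * f2) = x0 * g + (S * x0 - C * x1) * f1.
    have -> : x2 * f2 = x0 * f0 - x1 * f1 by lra.
    by rewrite gE; ring.
  by rewrite lerDl mulr_ge0 // ltW // subr_gt0.
have : x0 ^+ 2 * ((1 + 4 * u) * g ^+ 2) < x0 ^+ 2 * ((1 + u) * f2 ^+ 2).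
  have -> : x0 ^+ 2 * ((1 + 4 * u) * g ^+ 2) = (1 + 4 * u) * (x0 * g) ^+ 2 by ring.
  have -> : x0 ^+ 2 * ((1 + u) * f2 ^+ 2) = C ^+ 2 * (x0 ^+ 2 * f2 ^+ 2).
    by rewrite C2; ring.
  apply: (@le_lt_trans _ _ ((1 + 4 * u) * (C * (x2 * f2)) ^+ 2)); first by rewrite ler_pM2l.
  by rewrite exprMn mulrCA ltr_pM2l ?exprn_gt0.
rewrite ltr_pM2l // -gE exprMn S2.
have -> : f2 ^+ 2 = 1 + g ^+ 2 - (C * f1 - S * f0) ^+ 2.
  have -> : f2 ^+ 2 = 1 + f0 ^+ 2 - f1 ^+ 2 by lra.
  by rewrite gE; ring: S2 C2.
lra.
Qed.

Lemma no_mirror_ultra f0 f1 f2 : M f0 f1 f2 -> 1 < f2 ->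
  x0 * f0 = x1 * f1 + x2 * f2 -> False.
Proof.
move=> Mf f2_gt xf.
have [f0_gt0 /andP[f1_gt f1_lt] A B] := ultra_bounds Mf f2_gt xf.
have u0 := u_gt0 P; have S0 := qS_gt0 P; have S2 := qS2 P; have C2 := qC2 P.
have C0 := qC_gt0 P.
have [f1_lt0|f1_gt0|f1_0] := ltgtP f1 0; last first.
- have := A _; rewrite f1_0 lexx expr0n /= => /(_ isT) b.
  apply: (no_mirror_ultra_a P Q (f0 := f0) (f2 := f2)) => //; first by rewrite -[X in M _ X]f1_0.
  by apply: lt_of_sqr; rewrite ?[(S * _) ^+ 2]exprMn ?S2; lra.
- have {A}B := B (ltW f1_gt0).
  have q_gt0 : 0 < S * (C * f0 - S * f1).
    have [C1 _] := C_bounds P; have [_ S10] := S_bounds P.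
    rewrite mulr_gt0 //; have : S * f1 <= 1 * f1 by rewrite ler_pM2r //; lra.
    have : 1 * f0 <= C * f0 by rewrite ler_pM2r // ltW.
    lra.
  have [y1_lt0|y1_gt0|y1_0] := ltgtP (C * f1 - S * f0) 0; last first.
  + have f1E : S * (C * f0 - S * f1) = f1.
      have -> : S * (C * f0 - S * f1) = C * (C * f1 - (C * f1 - S * f0)) - S ^+ 2 * f1 by ring.
      by rewrite y1_0 S2; ring: C2.
    have f0E : C * (C * f0 - S * f1) = f0.
      have -> : C * (C * f0 - S * f1) = C ^+ 2 * f0 - S * (S * f0 + (C * f1 - S * f0)) by ring.
      by rewrite y1_0 C2; ring: S2.
    apply: (@no_mirror_ultra_c _ _ _ _ _ _ P Q (C * f0 - S * f1) f1 f2) => //.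
    * by rewrite f0E.
    * by rewrite (lt_trans ltr01).
    * by move: B; rewrite y1_0 f1E expr0n mulr0 addr0.
  + apply: (no_mirror_ultra_right P Q Mf _ erefl) => //.
    rewrite ltr_pM2l //.
    have : 0 < (C + S) * (f0 - f1) by rewrite mulr_gt0 ?subr_gt0 // addr_gt0.
    by rewrite mulrBr !mulrDl; lra.
  + exact: (no_mirror_ultra_between P Q Mf _ erefl).
- exact: (no_mirror_ultra_left P Q Mf f0_gt0 f1_gt f1_lt0 (A (ltW f1_lt0))).
Qed.

(** The hypothesis [archi] ends the doubling in [no_mirror_perp]; over a general ordered field it
    has to be assumed. Since [f] and [- f] define the same mirror, the sign of [f] can be chosen in
    each case. *)
Lemma no_mirror_meets f0 f1 f2 :
  (forall e, 0 < e -> exists n, S <= 2 ^+ n * e) ->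
  M f0 f1 f2 -> x0 * f0 = x1 * f1 + x2 * f2 -> False.
Proof.
move=> archi Mf xf.
have x0_gt0 := pt_gt0 X; have x1_gt0 := pt_a X; have x2_gt0 := pt_b X.
have xc := pt_c X; have Nf := mirror_norm Q Mf.
have xfN : x0 * - f0 = x1 * - f1 + x2 * - f2 by rewrite !mulrN xf opprD.
have MfN := mirror_opp Q Mf.
have [f2_le|f2_gt] := leP (f2 ^+ 2) 1; last first.
  have [f2_ge0|f2_lt0] := leP 0 f2.
    by apply: (no_mirror_ultra Mf _ xf); apply: lt_of_sqr; rewrite // expr1n.
  by apply: (no_mirror_ultra MfN _ xfN); apply: lt_of_sqr; rewrite ?sqrrN ?expr1n // oppr_ge0 ltW.
have [f2_0|f2_neq0] := eqVneq f2 0.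
  rewrite f2_0 in Mf MfN Nf xf xfN.
  (* The point x between the first and third sides forces 0 < g0 < S. *)
  have main g0 g1 : M g0 g1 0 -> 0 < g1 -> x0 * g0 = x1 * g1 -> False.
    move=> Mg g1_gt0 xg.
    have Ng : g1 ^+ 2 = 1 + g0 ^+ 2.
      by have := mirror_norm Q Mg; rewrite expr0n /=; lra.
    have g0_gt0 : 0 < g0 by rewrite -(pmulr_rgt0 _ x0_gt0) xg mulr_gt0.
    have [n le_n] := archi _ g0_gt0.
    apply: (no_mirror_perp P Q Mg g1_gt0 _ le_n); rewrite g0_gt0 /=.
    have S0 := qS_gt0 P; have C0 := qC_gt0 P.
    have : C * g0 < S * g1.
      rewrite -(ltr_pM2l x0_gt0).
      have -> : x0 * (C * g0) = C * x1 * g1 by rewrite mulrCA xg mulrA.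
      have -> : x0 * (S * g1) = S * x0 * g1 by ring.
      by rewrite ltr_pM2r.
    move=> h; have : (C * g0) ^+ 2 < (S * g1) ^+ 2.
      by rewrite ltr_pXn2r ?nnegrE ?mulr_ge0 ?ltW.
    rewrite !exprMn (qC2 P) (qS2 P) Ng => h2.
    by apply: lt_of_sqr; rewrite ?ltW // (qS2 P); lra.
  have [f1_lt0|f1_gt0|f1_0] := ltgtP f1 0.
  - by apply: (main (- f0) (- f1)); rewrite ?oppr_gt0 //; [rewrite -oppr0 | lra].
  - by apply: (main f0 f1) => //; lra.
  - by have := sqr_ge0 f0; rewrite f1_0 !expr0n /= in Nf; lra.
have [f1_lt0|f1_gt0|f1_0] := ltgtP f1 0.
- apply: (no_mirror_crossing P Q X MfN _ _ _ xfN); rewrite ?oppr_eq0 ?sqrrN //.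
  by rewrite oppr_gt0.
- exact: (no_mirror_crossing P Q X Mf).
- have f0_0 : f0 = 0.
    apply/eqP; rewrite -sqrf_eq0 eq_le sqr_ge0 andbT.
    by rewrite f1_0 expr0n /= in Nf; lra.
  have : x2 * f2 == 0 by rewrite f1_0 f0_0 in xf; apply/eqP; lra.
  by rewrite mulf_eq0 (negPf f2_neq0) orbF gt_eqF.
Qed.

End MeetsUltra.

End MirrorExclusion.

(** * The Lorentzian form *)

Section LorentzForm.
Variables (R : realType) (n : nat).
Implicit Types x y z : 'cV[R]_n.+1.

Lemma lorentzC x y : lorentz x y = lorentz y x.
Proof.
by rewrite /lorentz mulrC; congr (_ + _); apply: eq_bigr => i _; rewrite mulrC.
Qed.

Lemma lorentzDl x y z : lorentz (x + y) z = lorentz x z + lorentz y z.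
Proof. by rewrite -!lorentzE linearD /= !mulmxDl mxE. Qed.

Lemma lorentzZl a x y : lorentz (a *: x) y = a * lorentz x y.
Proof. by rewrite -!lorentzE linearZ /= -!scalemxAl mxE. Qed.

Lemma lorentzDr x y z : lorentz x (y + z) = lorentz x y + lorentz x z.
Proof. by rewrite lorentzC lorentzDl !(lorentzC x). Qed.

Lemma lorentzZr a x y : lorentz x (a *: y) = a * lorentz x y.
Proof. by rewrite lorentzC lorentzZl lorentzC. Qed.

Lemma lorentzNl x y : lorentz (- x) y = - lorentz x y.
Proof. by rewrite -scaleN1r lorentzZl mulN1r. Qed.

Lemma lorentzNr x y : lorentz x (- y) = - lorentz x y.
Proof. by rewrite lorentzC lorentzNl lorentzC. Qed.

Lemma lorentzBl x y z : lorentz (x - y) z = lorentz x z - lorentz y z.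
Proof. by rewrite lorentzDl lorentzNl. Qed.

Lemma lorentzBr x y z : lorentz x (y - z) = lorentz x y - lorentz x z.
Proof. by rewrite lorentzDr lorentzNr. Qed.

Definition lorentz_simp := (lorentzDl, lorentzDr, lorentzNl, lorentzNr, lorentzZl, lorentzZr).

Lemma lorentz_mx_invol : lorentz_mx R n *m lorentz_mx R n = 1%:M.
Proof.
apply/matrixP => i j; rewrite /lorentz_mx mul_diag_mx !mxE.
by case: (i == 0); case: (i == j); rewrite ?mulr0n ?mulr1n ?mulr0 ?mulrNN ?mulr1.
Qed.

Lemma lorentz_mx_trmx : (lorentz_mx R n)^T = lorentz_mx R n.
Proof. exact: tr_diag_mx. Qed.

Lemma lorentz_nondeg x y : (forall z, lorentz z x = lorentz z y) -> x = y.
Proof.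
move=> xy; have E : lorentz_mx R n *m x = lorentz_mx R n *m y.
  apply/matrixP => i j; rewrite ord1; have := xy (delta_mx i 0).
  by rewrite -!lorentzE !trmx_delta -!rowE -!row_mul !mxE.
by rewrite -[x]mul1mx -[y]mul1mx -lorentz_mx_invol -!mulmxA E.
Qed.

Definition is_isometry (A : 'M[R]_n.+1) :=
  forall x y, lorentz (A *m x) (A *m y) = lorentz x y.

Lemma isometry_mxE A : is_isometry A ->
  lorentz_mx R n *m A^T *m lorentz_mx R n *m A = 1%:M.
Proof.
move=> isoA; rewrite -!mulmxA -[RHS]lorentz_mx_invol; congr (_ *m _).
rewrite mulmxA; apply/matrixP => i j.
have := isoA (delta_mx i 0) (delta_mx j 0).
rewrite -!lorentzE trmx_mul !trmx_delta !mulmxA.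
rewrite -2!(mulmxA (delta_mx 0 i)) -!(mulmxA (delta_mx 0 i)) -!rowE -!colE.
by rewrite !mxE.
Qed.

Lemma isometry_unit A : is_isometry A -> A \in unitmx.
Proof. by move/isometry_mxE/mulmx1_unit => []. Qed.

Lemma isometry_inv A : is_isometry A ->
  invmx A = lorentz_mx R n *m A^T *m lorentz_mx R n.
Proof.
move=> isoA; rewrite -[LHS]mul1mx -(isometry_mxE isoA).
by rewrite -!mulmxA mulmxV ?isometry_unit // mulmx1.
Qed.

Lemma lorentz_inv A x y : is_isometry A ->
  lorentz (invmx A *m x) y = lorentz x (A *m y).
Proof.
move=> isoA; rewrite -(isoA (invmx A *m x)) mulmxA mulmxV ?isometry_unit //.
by rewrite mul1mx.
Qed.

Lemma isometryM A B : is_isometry A -> is_isometry B -> is_isometry (A *m B).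
Proof. by move=> iA iB x y; rewrite -!mulmxA iA iB. Qed.

Lemma isometryV A : is_isometry A -> is_isometry (invmx A).
Proof.
move=> iA x y; rewrite lorentz_inv // mulmxA mulmxV ?isometry_unit //.
by rewrite mul1mx.
Qed.

Lemma reflection_isometry (e : 'cV[R]_n.+1) : lorentz e e = 1 -> is_isometry (reflection_mx e).
Proof.
move=> ee x y; rewrite !reflection_mxE !lorentz_simp ee (lorentzC e y).
ring.
Qed.

Lemma reflection_invol (e : 'cV[R]_n.+1) : lorentz e e = 1 ->
  reflection_mx e *m reflection_mx e = 1%:M.
Proof.
move=> ee; apply/matrixP => i j.
suff: reflection_mx e *m reflection_mx e *m delta_mx j 0 = delta_mx j (0 : 'I_1).
  by rewrite -colE => /matrixP /(_ i 0); rewrite !mxE eqxx andbT.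
rewrite -mulmxA !reflection_mxE !lorentz_simp ee -addrA -opprD -scalerDl.
set s := (X in X *: e).
suff -> : s = 0 by rewrite scale0r subr0.
by rewrite /s; ring.
Qed.

Lemma reflection_inv (e : 'cV[R]_n.+1) : lorentz e e = 1 -> invmx (reflection_mx e) = reflection_mx e.
Proof.
move=> ee; rewrite -[LHS]mulmx1 -(reflection_invol ee) mulmxA mulVmx ?mul1mx //.
exact/isometry_unit/reflection_isometry.
Qed.

Lemma reflection_conj A (e : 'cV[R]_n.+1) : is_isometry A ->
  A *m reflection_mx e *m invmx A = reflection_mx (A *m e).
Proof.
move=> iA; rewrite /reflection_mx mulmxBr mulmxBl mulmx1 mulmxV ?isometry_unit //.
congr (_ - _); rewrite -scalemxAr -scalemxAl trmx_mul !mulmxA; congr (_ *: _).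
by rewrite (isometry_inv iA) !mulmxA -(mulmxA _ (lorentz_mx R n) (lorentz_mx R n))
  lorentz_mx_invol mulmx1.
Qed.

Lemma reflection_mxN (e : 'cV[R]_n.+1) : reflection_mx (- e) = reflection_mx e.
Proof. by rewrite /reflection_mx linearN mulmxN !mulNmx opprK. Qed.

Lemma reflection_self (e : 'cV[R]_n.+1) : lorentz e e = 1 -> reflection_mx e *m e = - e.
Proof.
by move=> ee; rewrite reflection_mxE ee mulr1 scaler_nat mulr2n opprD addrA subrr sub0r.
Qed.

Lemma isom_isometry A : isom_hyperbolic A -> is_isometry A.
Proof. by case. Qed.

End LorentzForm.

(** * The hyperbolic plane in coordinates *)

Section LorentzPlane.
Variable R : realType.
Implicit Types a b c : R.

Definition vec3 a b c : 'cV[R]_3 := \col_i [:: a; b; c]`_i.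

Lemma vec3P (x : 'cV[R]_3) : {a & {b & {c | x = vec3 a b c}}}.
Proof.
exists (x 0 0), (x 1 0), (x (lift 0 1) 0).
apply/matrixP => i j; rewrite ord1 !mxE.
case: i => [[|[|[|i]]] //= lt_i]; congr (x _ _); exact: val_inj.
Qed.

Lemma vec3_0 a b c : vec3 a b c 0 0 = a. Proof. by rewrite mxE. Qed.

Lemma lorentz_vec3 a b c a' b' c' :
  lorentz (vec3 a b c) (vec3 a' b' c') = - (a * a') + b * b' + c * c'.
Proof. by rewrite /lorentz !big_ord_recl big_ord0 !mxE /= addr0 addrA. Qed.

Lemma vec3D a b c a' b' c' : vec3 a b c + vec3 a' b' c' = vec3 (a + a') (b + b') (c + c').
Proof. by apply/matrixP => i j; rewrite !mxE; case: i => [[|[|[|i]]] //=]. Qed.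

Lemma vec3N a b c : - vec3 a b c = vec3 (- a) (- b) (- c).
Proof. by apply/matrixP => i j; rewrite !mxE; case: i => [[|[|[|i]]] //=]. Qed.

Lemma vec3B a b c a' b' c' : vec3 a b c - vec3 a' b' c' = vec3 (a - a') (b - b') (c - c').
Proof. by rewrite vec3N vec3D. Qed.

Lemma vec3Z k a b c : k *: vec3 a b c = vec3 (k * a) (k * b) (k * c).
Proof. by apply/matrixP => i j; rewrite !mxE; case: i => [[|[|[|i]]] //=]. Qed.

Lemma hyperbolic_vec3 a b c :
  @hyperbolic_space R 2 (vec3 a b c) <-> a ^+ 2 = 1 + b ^+ 2 + c ^+ 2 /\ 0 < a.
Proof.
rewrite /hyperbolic_space /= lorentz_vec3 mxE /=.
by split => -[h1 h2]; split => //; move: h1; rewrite -!expr2 => h1; lra.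
Qed.

(** The reversed Cauchy-Schwarz inequality for two vectors in the same half of the closed light
    cone. *)
Lemma hyperbolic_neg (x y : 'cV[R]_3) : hyperbolic_space x -> lorentz y y <= 0 ->
  0 < y 0 0 -> lorentz x y < 0.
Proof.
have [a [b [c ->]]] := vec3P x; have [a' [b' [c' ->]]] := vec3P y.
rewrite hyperbolic_vec3 !lorentz_vec3 vec3_0 => -[Na a0] yy a'0.
suff: b * b' + c * c' < a * a' by lra.
have aa' : 0 < a * a' by rewrite mulr_gt0.
have [h|h] := leP (b * b' + c * c') 0; first exact: le_lt_trans h aa'.
rewrite -(@ltr_pXn2r _ 2) ?nnegrE ?ltW // exprMn Na.
have a'2 : 0 < a' ^+ 2 by rewrite exprn_gt0.
have k : b' ^+ 2 + c' ^+ 2 <= a' ^+ 2 by rewrite -!expr2 in yy; lra.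
have bc : 0 <= b ^+ 2 + c ^+ 2 by rewrite addr_ge0 ?sqr_ge0.
have : (b ^+ 2 + c ^+ 2) * (b' ^+ 2 + c' ^+ 2) <= (b ^+ 2 + c ^+ 2) * a' ^+ 2.
  exact: ler_wpM2l.
have := sqr_ge0 (b * c' - c * b').
have -> : (b * b' + c * c') ^+ 2 =
  (b ^+ 2 + c ^+ 2) * (b' ^+ 2 + c' ^+ 2) - (b * c' - c * b') ^+ 2 by ring.
lra.
Qed.

(** Serves to show that reflections and inverses of isometries preserve the upper sheet. *)
Lemma hyperbolic_sheet (x y : 'cV[R]_3) : hyperbolic_space x -> lorentz y y < 0 ->
  lorentz x y < 0 -> 0 < y 0 0.
Proof.
move=> Hx yy xy; have [//|y0] := ltP 0 (y 0 0).
have [y00|y0'] := eqVneq (y 0 0) 0.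
  have [a [b [c E]]] := vec3P y; rewrite E lorentz_vec3 in yy.
  have : a = 0 by rewrite -y00 E mxE.
  by have := sqr_ge0 b; have := sqr_ge0 c; rewrite !expr2 => ? ? a0; rewrite a0 in yy; lra.
have := @hyperbolic_neg x (- y) Hx.
rewrite lorentzNl lorentzNr opprK lorentzNr mxE => /(_ (ltW yy)).
by rewrite !oppr_gt0 lt_neqAle y0' y0 => /(_ isT); rewrite oppr_lt0; lra.
Qed.

Lemma reflection_isom (e : 'cV[R]_3) : lorentz e e = 1 ->
  @isom_hyperbolic R 2 (reflection_mx e).
Proof.
move=> ee; have iso := reflection_isometry ee; split=> // x Hx.
have Nx : lorentz x x = -1 by case: Hx.
have Nrx : lorentz (reflection_mx e *m x) (reflection_mx e *m x) = -1 by rewrite iso.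
split=> //; apply: (hyperbolic_sheet Hx); first by rewrite Nrx ltrN10.
rewrite reflection_mxE lorentzBr lorentzZr Nx.
by have := sqr_ge0 (lorentz x e); rewrite expr2; lra.
Qed.

Lemma isom_mul A B : @isom_hyperbolic R 2 A -> isom_hyperbolic B -> isom_hyperbolic (A *m B).
Proof.
move=> [iA hA] [iB hB]; split; first exact: isometryM.
by move=> x Hx; rewrite -mulmxA; apply/hA/hB.
Qed.

Lemma isom_inv A : @isom_hyperbolic R 2 A -> isom_hyperbolic (invmx A).
Proof.
move=> [iA hA]; split; first exact: isometryV.
move=> x Hx; have Nx : lorentz x x = -1 by case: Hx.
have N : lorentz (invmx A *m x) (invmx A *m x) = -1 by rewrite isometryV.
split=> //; apply: (hyperbolic_sheet Hx); first by rewrite N ltrN10.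
rewrite lorentzC lorentz_inv //.
have [_ x0] := hA _ Hx.
by apply: hyperbolic_neg => //; rewrite iA Nx lerN10.
Qed.

Lemma isom1 : @isom_hyperbolic R 2 1%:M.
Proof. by split => [x y|x]; rewrite !mul1mx. Qed.

End LorentzPlane.

(** * Discrete groups of isometries *)

Section Discrete.
Variables (R : realType) (G : set 'M[R]_3).
Hypotheses (Gsub : @is_isom_subgroup R 2 G) (Gdisc : @discrete_subset R 2 G).

Lemma subgroup_isom A : G A -> @isom_hyperbolic R 2 A.
Proof. by case: Gsub => sub _ _ _; apply: sub. Qed.

Lemma discrete_near1 : exists2 eta : R, 0 < eta &
  forall g, G g -> (forall i j, `|g i j - 1%:M i j| < eta) -> g = 1%:M.
Proof.
have [_ G1 _ _] := Gsub; have [_ [V nV VG]] := Gdisc G1.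
move/nbhs_ballP: nV => [e /= e0 sub].
exists e => // g Gg near1.
suff : (V `&` G) g by rewrite VG.
by split=> //; apply: sub; split=> // i j; rewrite /ball /= distrC near1.
Qed.

(** Each column has norm 1 or -1 and so is bounded by its entry in row 0. Row 0 is up to signs
    column 0 of the inverse, which is bounded by [g 0 0] in the same way. *)
Lemma isometry_entry_sqr (g : 'M[R]_3) i j : is_isometry g ->
  (g i j) ^+ 2 <= 2 + (g 0 0) ^+ 2.
Proof.
move=> iso.
have col_le (h : 'M[R]_3) k l : is_isometry h -> (h k l) ^+ 2 <= 1 + (h 0 l) ^+ 2.
  move=> isoh; have := isoh (delta_mx l 0) (delta_mx l 0).
  have -> : lorentz (delta_mx l 0) (delta_mx l 0) = (if l == 0 then -1 else 1 : R).
    rewrite -lorentzE trmx_delta -rowE -colE !mxE eqxx mulr1n.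
    by case: ifP.
  rewrite -colE; have -> : h k l = col l h k 0 by rewrite mxE.
  have -> : h 0 l = col l h 0 0 by rewrite mxE.
  have [a [b [c ->]]] := vec3P (col l h); rewrite lorentz_vec3 !mxE /= => E.
  have := sqr_ge0 a; have := sqr_ge0 b; have := sqr_ge0 c; rewrite !expr2 => h1 h2 h3.
  by case: k => [[|[|[|k]]] //= _]; case: ifP E => _ E; lra.
apply: le_trans (col_le _ _ _ iso) _.
have -> : (g 0 j) ^+ 2 = (invmx g j 0) ^+ 2.
  rewrite (isometry_inv iso) /lorentz_mx mul_mx_diag mul_diag_mx !mxE eqxx.
  by case: ifP => _; rewrite ?mulN1r ?mul1r ?mulrN1 ?opprK ?sqrrN.
have := col_le _ j 0 (isometryV iso).
have -> : invmx g 0 0 = g 0 0.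
  rewrite (isometry_inv iso) /lorentz_mx mul_mx_diag mul_diag_mx !mxE eqxx.
  by rewrite mulN1r mulrN1 opprK.
lra.
Qed.

(** [g 0 0] is cosh of the displacement of the base point [o], and replacing [o] by [p] costs a
    factor 2 p_0. Thus isometries that take [p] into a bounded region have bounded entries. *)
Lemma isom_entry_bound (g : 'M[R]_3) (p : 'cV[R]_3) i j :
  @isom_hyperbolic R 2 g -> hyperbolic_space p ->
  `|g i j| <= 4 * p 0 0 * (g *m p) 0 0.
Proof.
move=> [iso hg] Hp.
pose o : 'cV[R]_3 := vec3 1 0 0.
have Ho : hyperbolic_space o by rewrite hyperbolic_vec3 expr1n expr0n /=; split; lra.
have go0 : (g *m o) 0 0 = g 0 0.
  rewrite /o; have -> : vec3 1 0 0 = delta_mx 0 0 :> 'cV[R]_3.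
    by apply/matrixP => k l; rewrite ord1 !mxE; case: k => [[|[|[|k]]] //=].
  by rewrite -colE mxE.
have := iso o p; have := hg _ Ho; have := hg _ Hp; move: Hp.
have [z0 [z1 [z2 Ez]]] := vec3P (g *m p); have [y0 [y1 [y2 Ey]]] := vec3P (g *m o).
have [p0 [p1 [p2 Ep]]] := vec3P p; rewrite Ez Ey Ep.
have g00 : g 0 0 = y0 by rewrite -go0 Ey vec3_0.
rewrite !hyperbolic_vec3 !vec3_0 /o !lorentz_vec3 !mul0r !addr0 mul1r.
move=> [_ p0_gt] [Nz z0_gt] [Ny y0_gt] Eyz.
have y0_ge1 : 1 <= y0.
  have n0 := ltW y0_gt; rewrite -(@ler_pXn2r _ 2) ?nnegrE // Ny expr1n.
  by have := sqr_ge0 y1; have := sqr_ge0 y2; lra.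
have z0_ge1 : 1 <= z0.
  have n0 := ltW z0_gt; rewrite -(@ler_pXn2r _ 2) ?nnegrE // Nz expr1n.
  by have := sqr_ge0 z1; have := sqr_ge0 z2; lra.
have y0_le : y0 <= 2 * z0 * p0.
  have k : (y0 * z0 - p0) ^+ 2 <= y0 ^+ 2 * (z0 ^+ 2 - 1).
    have -> : y0 * z0 - p0 = y1 * z1 + y2 * z2 by lra.
    have -> : z0 ^+ 2 - 1 = z1 ^+ 2 + z2 ^+ 2 by lra.
    have := sqr_ge0 (y1 * z2 - y2 * z1); have := sqr_ge0 z1; have := sqr_ge0 z2.
    have -> : (y1 * z1 + y2 * z2) ^+ 2 =
      (y0 ^+ 2 - 1) * (z1 ^+ 2 + z2 ^+ 2) - (y1 * z2 - y2 * z1) ^+ 2.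
      by rewrite Ny; ring.
    by lra.
  rewrite -(ler_pM2l y0_gt); have := sqr_ge0 p0; lra.
have k : `|g i j| <= 2 * y0.
  rewrite -(@ler_pXn2r _ 2) ?nnegrE //; last by lra.
  rewrite real_normK ?num_real //; apply: le_trans (isometry_entry_sqr _ _ iso) _.
  have : 1 <= y0 ^+ 2 by rewrite exprn_ege1.
  rewrite g00 exprMn; lra.
lra.
Qed.

(** Pigeonhole: finitely many cells of size [del] contain all the matrices, and two group elements
    in one cell have a quotient within [eta] of 1. *)
Lemma no_bounded_seq (h : nat -> 'M[R]_3) (B : R) : (forall k, G (h k)) -> injective h ->
  (forall k i j, `|h k i j| <= B) -> False.
Proof.
move=> Gh inj_h bound.
have [eta eta0 near1] := discrete_near1.
have B0 : 0 <= B by apply: le_trans (bound 0%N 0 0).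
have [del del0 dB] : exists2 del : R, 0 < del & 3 * B * del < eta.
  exists (eta / (3 * B + 1)); first by rewrite divr_gt0 //; lra.
  have k : 0 < 3 * B + 1 by lra.
  by rewrite mulrA ltr_pdivrMr // mulrC ltr_pM2l //; lra.
pose N := Num.truncn (2 * B / del).
pose T := {ffun 'I_3 * 'I_3 -> 'I_N.+1}.
pose code (k : nat) : T := [ffun p => inord (Num.truncn ((h k p.1 p.2 + B) / del))].
pose f (k : 'I_(#|T|.+1)) := code k.
have : ~ injective f by move/leq_card; rewrite card_ord ltnn.
apply; move=> k l kl; apply/val_inj/inj_h => /=.
have close i j : `|h k i j - h l i j| < del.
  have := congr1 (fun c : T => c (i, j)) kl; rewrite !ffunE /=.
  have nn (m : nat) : 0 <= (h m i j + B) / del.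
    rewrite divr_ge0 ?(ltW del0) //; have := bound m i j; rewrite ler_norml => /andP[]; lra.
  have lt_N (m : nat) : (Num.truncn ((h m i j + B) / del) < N.+1)%N.
    rewrite ltnS /N; apply: le_truncn; rewrite ler_pM2r ?invr_gt0 //.
    by have := bound m i j; rewrite ler_norml => /andP[_]; lra.
  move/(congr1 val); rewrite /= !inordK // => E.
  have /andP[a1 a2] := truncn_itv (nn k); have /andP[b1 b2] := truncn_itv (nn l).
  move: a1 a2 b1 b2; rewrite E; move: (Num.truncn _) => n.
  rewrite !ler_pdivlMr // !ltr_pdivrMr // -natr1 mulrDl mul1r => a1 a2 b1 b2.
  by rewrite ltr_norml; apply/andP; split; lra.
have isok : is_isometry (h k) by case: (subgroup_isom (Gh k)).
have Ggl : G (invmx (h k) *m h l) by have [_ _ GM GV] := Gsub; apply: GM; [apply: GV|].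
suff E : invmx (h k) *m h l = 1%:M.
  by rewrite -[LHS]mulmx1 -E mulmxA mulmxV ?isometry_unit // mul1mx.
apply: near1 => // i j.
have -> : (invmx (h k) *m h l) i j - 1%:M i j =
    \sum_s invmx (h k) i s * (h l s j - h k s j).
  rewrite -(mulVmx (isometry_unit isok)) !mxE -sumrB.
  by apply: eq_bigr => s _; rewrite mulrBr.
apply: le_lt_trans dB; apply: le_trans (ler_norm_sum _ _ _) _.
have -> : 3 * B * del = \sum_(s < 3) B * del.
  by rewrite sumr_const card_ord -mulrA mulr_natl.
apply: ler_sum => s _; rewrite normrM ler_pM //; last by rewrite distrC ltW.
rewrite (isometry_inv isok) /lorentz_mx mul_mx_diag mul_diag_mx !mxE !normrM.
have -> (t : 'I_3) : `|if t == 0 then -1 else 1 : R| = 1.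
  by case: ifP; rewrite ?normrN normr1.
have -> : `|if s == 0 then -1 else 1 : R| = 1 by case: ifP; rewrite ?normrN normr1.
by rewrite mulr1 mul1r.
Qed.

(** All powers of [A] fix [p], so they have bounded entries and cannot all be distinct. *)
Lemma finite_order_of_fixed_point A p : G A -> hyperbolic_space p -> A *m p = p ->
  exists2 q, (0 < q)%N & A ^+ q = 1.
Proof.
move=> GA Hp Ap; apply: contrapT => no_q.
have [_ G1 GM _] := Gsub.
have GX k : G (A ^+ k) by elim: k => [|k IHk]; rewrite ?expr0 // exprS; apply: GM.
have Ak k : A ^+ k *m p = p.
  by elim: k => [|k IHk]; rewrite ?expr0 ?mul1mx // exprS -mulmxA IHk.
apply: (@no_bounded_seq (fun k => A ^+ k) (4 * p 0 0 * p 0 0)) => //.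
- have main k l : (k < l)%N -> A ^+ k = A ^+ l -> False.
    move=> lt_kl E; apply: no_q; exists (l - k)%N; first by rewrite subn_gt0.
    have U : A ^+ k \in unitmx by apply/isometry_unit/isom_isometry/subgroup_isom.
    have E2 : A ^+ k *m A ^+ (l - k) = A ^+ k *m 1%:M.
      by rewrite mulmxE -exprD subnKC ?(ltnW lt_kl) // -E mulr1.
    by rewrite -[LHS]mul1mx -(mulVmx U) -mulmxA E2 mulmxA mulVmx ?mul1mx.
  move=> k l /= E; have [/main/(_ E)|/main/(_ (esym E))|] := ltngtP k l => //.
- by move=> k i j; rewrite -{2}(Ak k); apply: isom_entry_bound => //; apply: subgroup_isom.
Qed.

End Discrete.

Lemma timelike_normalize (R : realType) (v : 'cV[R]_3) : lorentz v v < 0 ->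
  exists2 k, k != 0 & @hyperbolic_space R 2 (k *: v).
Proof.
have [a [b [c ->]]] := vec3P v; rewrite lorentz_vec3 -!expr2 => vv.
pose s := Num.sqrt (a ^+ 2 - b ^+ 2 - c ^+ 2).
have s0 : 0 < s by rewrite sqrtr_gt0; lra.
have s2 : s ^+ 2 = a ^+ 2 - b ^+ 2 - c ^+ 2 by rewrite sqr_sqrtr //; lra.
have a_neq0 : a != 0.
  by apply: contraTneq vv => ->; have := sqr_ge0 b; have := sqr_ge0 c; rewrite expr0n /= -leNgt; lra.
have ns : s != 0 by rewrite gt_eqF.
have main k : k ^+ 2 = s ^- 2 -> 0 < k * a -> hyperbolic_space (k *: vec3 a b c).
  move=> k2 ka; rewrite vec3Z hyperbolic_vec3 !exprMn k2; split=> //.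
  have -> : a ^+ 2 = s ^+ 2 + b ^+ 2 + c ^+ 2 by rewrite s2; ring.
  by field.
have [a0|a0] := ltP 0 a.
  exists s^-1; rewrite ?invr_eq0 //; apply: main; rewrite ?exprVn //.
  by rewrite mulr_gt0 ?invr_gt0.
exists (- s^-1); rewrite ?oppr_eq0 ?invr_eq0 //; apply: main; rewrite ?sqrrN ?exprVn //.
by rewrite mulNr oppr_gt0 pmulr_rlt0 ?invr_gt0 // lt_neqAle a_neq0.
Qed.

Lemma crossing_point (R : realType) (f g : 'cV[R]_3) : lorentz f f = 1 -> lorentz g g = 1 ->
  -1 < lorentz f g < 1 ->
  exists p, [/\ @hyperbolic_space R 2 p, lorentz p f = 0 & lorentz p g = 0].
Proof.
have [f0 [f1 [f2 ->]]] := vec3P f; have [g0 [g1 [g2 ->]]] := vec3P g.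
rewrite !lorentz_vec3 => Nf Ng /andP[lb ub].
(* The Lorentzian cross product of the normals: orthogonal to both, with <v, v> = <f, g>^2 - <f, f>
   <g, g>. *)
pose v := vec3 (f2 * g1 - f1 * g2) (f2 * g0 - f0 * g2) (f0 * g1 - f1 * g0).
have vv : lorentz v v < 0.
  rewrite /v lorentz_vec3.
  have -> : - ((f2 * g1 - f1 * g2) * (f2 * g1 - f1 * g2)) +
     (f2 * g0 - f0 * g2) * (f2 * g0 - f0 * g2) +
     (f0 * g1 - f1 * g0) * (f0 * g1 - f1 * g0) =
     (- (f0 * g0) + f1 * g1 + f2 * g2) ^+ 2 -
     (- (f0 * f0) + f1 * f1 + f2 * f2) * (- (g0 * g0) + g1 * g1 + g2 * g2) by ring.
  by rewrite Nf Ng mulr1; nra.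
have [k k0 Hk] := timelike_normalize vv.
by exists (k *: v); split => //; rewrite lorentzZl /v lorentz_vec3; ring.
Qed.

(** * Angles between crossing mirrors *)

Section AlgebraicIntegers.
Variable K : fieldType.

Definition alg_int (x : K) := integralOver (intr : int -> K) x.

Lemma alg_intD x y : alg_int x -> alg_int y -> alg_int (x + y).
Proof. exact: integral_add. Qed.

Lemma alg_intB x y : alg_int x -> alg_int y -> alg_int (x - y).
Proof. exact: integral_sub. Qed.

Lemma alg_intN x : alg_int x -> alg_int (- x).
Proof. exact: integral_opp. Qed.

Lemma alg_intM x y : alg_int x -> alg_int y -> alg_int (x * y).
Proof. exact: integral_mul. Qed.

Lemma alg_int_nat n : alg_int n%:R.
Proof. exact: integral_nat. Qed.

Lemma alg_intX x n : alg_int x -> alg_int (x ^+ n).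
Proof.
move=> ix; elim: n => [|n IHn]; first exact: (alg_int_nat 1).
by rewrite exprS; apply: alg_intM.
Qed.

Lemma alg_int_sum (I : Type) (r : seq I) (P : pred I) (F : I -> K) :
  (forall i, P i -> alg_int (F i)) -> alg_int (\sum_(i <- r | P i) F i).
Proof. by move=> iF; apply: big_ind iF => //; [exact: (alg_int_nat 0) | exact: alg_intD]. Qed.

Lemma alg_int_root n x : (0 < n)%N -> alg_int (x ^+ n) -> alg_int x.
Proof.
move=> n0 ix; apply: (@integral_root_monic _ _ _ _ ('X^n - (x ^+ n)%:P)).
- exact: monicXnsubC.
- by rewrite rootE !hornerE subrr.
- apply/integral_poly => i; rewrite coefB coefXn coefC.
  by apply: alg_intB; [exact: alg_int_nat | case: ifP => // _; exact: (alg_int_nat 0)].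
Qed.

(** Some power e of w has prime order r, and 1 - w divides 1 - e. As the e^i sum to 0 over i < r,
    the sum of the 1 - e^i is r, and every term is a multiple of 1 - e. *)
Lemma unity_root_dvd_prime (w : K) n : (0 < n)%N -> w ^+ n = 1 -> w != 1 ->
  exists r v, [/\ prime r, alg_int v & (1 - w) * v = r%:R].
Proof.
move=> n0 wn1 w1.
have iw : alg_int w by apply: (alg_int_root n0); rewrite wn1; exact: (alg_int_nat 1).
have [m prim_w _] := prim_order_exists n0 wn1.
have m1 : (1 < m)%N.
  have m0 := prim_order_gt0 prim_w.
  rewrite ltn_neqAle m0 andbT; apply: contraNneq w1 => m1.
  by rewrite -[w]expr1 m1 (prim_expr_order prim_w).
set r := pdiv m; have pr : prime r by apply: pdiv_prime.
set e := w ^+ (m %/ r).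
have er1 : e ^+ r = 1.
  by rewrite /e -exprM divnK ?pdiv_dvd // (prim_expr_order prim_w).
have e1 : e != 1.
  rewrite /e -(prim_order_dvd prim_w); apply: contraL m1 => dvd.
  have : (m <= m %/ r)%N.
    by apply: dvdn_leq => //; rewrite divn_gt0 ?prime_gt0 ?(pdiv_leq (prim_order_gt0 prim_w)).
  by have := @ltn_Pdiv m r (prime_gt1 pr) (prim_order_gt0 prim_w); rewrite ltnNge => /negPf ->.
have ie : alg_int e by apply: alg_intX.
have sum0 : \sum_(i < r) e ^+ i = 0.
  have /eqP := subrX1 e r; rewrite er1 subrr eq_sym mulf_eq0 subr_eq0 (negPf e1).
  by move/eqP.
exists r, ((\sum_(i < m %/ r) w ^+ i) * \sum_(i < r) \sum_(k < i) e ^+ k); split => //.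
  by apply: alg_intM; apply: alg_int_sum => i _; [|apply: alg_int_sum => k _];
    apply: alg_intX.
have -> : (1 - w) * ((\sum_(i < m %/ r) w ^+ i) * \sum_(i < r) \sum_(k < i) e ^+ k) =
    (1 - e) * \sum_(i < r) \sum_(k < i) e ^+ k.
  by rewrite mulrA -[1 - w]opprB mulNr -subrX1 opprB.
rewrite mulr_sumr (eq_bigr (fun i : 'I_r => 1 - e ^+ i)) => [|i _]; last first.
  by rewrite -[1 - e]opprB mulNr -subrX1 opprB.
by rewrite sumrB sum0 subr0 sumr_const card_ord.
Qed.

End AlgebraicIntegers.

(** * Divisibility of numbers 2 cos of a rational angle *)

Section CosineNumbers.
Variables (K : fieldType).

(* Satisfied by [2 cos] of every rational multiple of [pi]. *)
Definition cosine_like (z : K) : Prop :=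
  alg_int z /\ (z != 0 -> exists r v, [/\ prime r, alg_int v & z * v = r%:R]).

(** The model is w = exp (2 i a) and z = 2 cos a. By [unity_root_dvd_prime] for - w, a prime r
    equals (1 + w) v, and then (r / z)^2 = v^2 w is an algebraic integer. *)
Lemma cosine_like_unity (z w : K) n : (0 < n)%N -> w ^+ n = 1 ->
  z ^+ 2 * w = (1 + w) ^+ 2 -> cosine_like z.
Proof.
move=> n0 wn1 zw.
have w0 : w != 0.
  by apply: contra_eq_neq wn1 => ->; rewrite expr0n gtn_eqF // eq_sym oner_eq0.
have iw : alg_int w by apply: (alg_int_root n0); rewrite wn1; exact: (alg_int_nat K 1).
have iw' : alg_int w^-1.
  have -> : w^-1 = w ^+ n.-1.
    by apply: (mulfI w0); rewrite mulfV // -exprS prednK.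
  exact: alg_intX.
have i1 : alg_int (1 : K) by exact: (alg_int_nat K 1).
split.
  apply: (@alg_int_root _ 2) => //.
  have -> : z ^+ 2 = (1 + w) ^+ 2 * w^-1 by rewrite -zw mulfK.
  by apply: alg_intM => //; apply/alg_intX/alg_intD.
move=> z0; have [] := @unity_root_dvd_prime K (- w) (2 * n).
- by rewrite muln_gt0.
- by rewrite exprM sqrrN -exprM mulnC exprM wn1 expr1n.
- apply: contra_neq z0 => /eqP; rewrite eqr_oppLR => /eqP w1.
  apply/eqP; rewrite -sqrf_eq0 -(inj_eq (mulIf w0)) zw w1 subrr expr0n mul0r //.
move=> r [v [pr iv]]; rewrite opprK => wv.
exists r, (r%:R / z); split=> //; last by rewrite mulrC divfK.
apply: (@alg_int_root _ 2) => //.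
suff -> : (r%:R / z) ^+ 2 = v ^+ 2 * w by apply: alg_intM => //; apply: alg_intX.
have z2 : z ^+ 2 != 0 by rewrite sqrf_eq0.
by rewrite expr_div_n -wv exprMn -zw; field.
Qed.

(** Applied with t = 2 C to the products with three consecutive n_j: dividing by the middle one
    costs no more than a prime. *)
Lemma cosine_like_ratio (t z1 z2 z3 : K) : cosine_like z1 -> cosine_like z2 ->
  cosine_like z3 -> z2 != 0 -> t * z2 = z1 + z3 ->
  exists2 r, prime r & alg_int (r%:R * t).
Proof.
move=> [i1 _] [_ d2] [i3 _] z20 E; have [r [v [pr iv zv]]] := d2 z20.
exists r => //; have -> : r%:R * t = v * (z1 + z3) by rewrite -zv -E; ring.
by apply: alg_intM => //; apply: alg_intD.
Qed.

Lemma cosine_like_2 : cosine_like 2.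
Proof.
split=> [|_]; first exact: alg_int_nat.
by exists 2%N, 1; split => //; [exact: (alg_int_nat K 1) | rewrite mulr1].
Qed.

Lemma cosine_likeN z : cosine_like z -> cosine_like (- z).
Proof.
move=> [iz dz]; split; first exact: alg_intN.
rewrite oppr_eq0 => /dz [r [v [pr iv zv]]]; exists r, (- v).
by split=> //; [exact: alg_intN | rewrite mulrNN].
Qed.

End CosineNumbers.

Section MirrorAngles.
Variables (R : realType) (G : set 'M[R]_3).
Hypotheses (Gsub : @is_isom_subgroup R 2 G) (Gdisc : @discrete_subset R 2 G).

(* The product of the two reflections fixes the crossing point, so it has finite
   order, and its eigenvalue [w <> 1] satisfies (2<f,g>)^2 w = (1 + w)^2. *)
Lemma mirror_angle (f g : 'cV[R]_3) : lorentz f f = 1 -> lorentz g g = 1 ->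
  G (reflection_mx f) -> G (reflection_mx g) -> -1 <= lorentz f g <= 1 ->
  cosine_like (real_complex R (2 * lorentz f g)).
Proof.
move=> Nf Ng Gf Gg; set c := lorentz f g => /andP[lb ub].
have [c1|c1] := eqVneq c 1; first by rewrite c1 mulr1 rmorph_nat; exact: cosine_like_2.
have [c1'|c1'] := eqVneq c (-1).
  by rewrite c1' mulrN1 rmorphN rmorph_nat; apply: cosine_likeN; exact: cosine_like_2.
have [->|c0] := eqVneq c 0.
  rewrite mulr0 rmorph0; split; first exact: (alg_int_nat _ 0).
  by rewrite eqxx.
have cc : -1 < c < 1 by rewrite !lt_neqAle lb ub c1 eq_sym c1'.
have [p [Hp pf pg]] := crossing_point Nf Ng cc.
have [_ _ GM _] := Gsub.
set h := reflection_mx f *m reflection_mx g.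
have hp : h *m p = p.
  by rewrite -mulmxA !reflection_mxE pg mulr0 scale0r subr0 pf mulr0 scale0r subr0.
have [q q0 hq] := finite_order_of_fixed_point Gsub Gdisc (GM _ _ Gf Gg) Hp hp.
have hf : h *m f = (4 * c ^+ 2 - 1) *: f + (- (2 * c)) *: g.
  rewrite -mulmxA !reflection_mxE !lorentz_simp Nf -/c (lorentzC g f) -/c.
  apply/matrixP => i j; rewrite !mxE; ring.
have hg : h *m g = (2 * c) *: f + (-1) *: g.
  rewrite -mulmxA !reflection_mxE !lorentz_simp Ng (lorentzC g f) -/c.
  apply/matrixP => i j; rewrite !mxE; ring.
pose z := real_complex R (2 * c).
(* The characteristic polynomial of [h] on the span of [f] and [g]. Its roots are not real, hence
   the passage to [R[i]]. *)
have [w /rootP] : {w : R[i] | root ('X^2 - (z ^+ 2 - 2)%:P * 'X + 1) w}.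
  apply/sigW/closed_rootP.
  rewrite -addrA size_polyDl size_polyXn // (leq_ltn_trans (size_polyD _ _)) //.
  rewrite gtn_max size_polyN size_poly1 andbT mul_polyC.
  by rewrite (leq_ltn_trans (size_scale_leq _ _)) // size_polyX.
rewrite !hornerE => Ew.
pose step (ab : R * R) := ((4 * c ^+ 2 - 1) * ab.1 + 2 * c * ab.2, - (2 * c) * ab.1 - ab.2).
pose s k := iter k step (1, 0).
have hs k : h ^+ k *m f = (s k).1 *: f + (s k).2 *: g.
  elim: k => [|k IHk]; first by rewrite expr0 mul1mx scale1r scale0r addr0.
  rewrite exprS -mulmxA IHk mulmxDr -!scalemxAr hf hg /s iterS -/(s k) /step /=.
  by apply/matrixP => i j; rewrite !mxE; ring.
(* A linear functional that [step] multiplies by [w]; it replaces a diagonalisation of [h]. *)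
pose phi (ab : R * R) := (1 + w) * real_complex R ab.1 + z * real_complex R ab.2.
have phiS ab : phi (step ab) = w * phi ab.
  have zE : z = 2 * real_complex R c by rewrite /z rmorphM rmorph_nat.
  have c2E : real_complex R (4 * c ^+ 2 - 1) = z ^+ 2 - 1.
    by rewrite rmorphB rmorphM rmorphXn rmorph_nat rmorph1 zE; ring.
  have -> : phi (step ab) = (1 + w) * ((z ^+ 2 - 1) * real_complex R ab.1 + z * real_complex R ab.2)
      + z * (- z * real_complex R ab.1 - real_complex R ab.2).
    rewrite /phi /step /=.
    have -> : real_complex R ((4 * c ^+ 2 - 1) * ab.1 + 2 * c * ab.2) =
        real_complex R (4 * c ^+ 2 - 1) * real_complex R ab.1 + z * real_complex R ab.2.
      by rewrite rmorphD; congr (_ + _); exact: rmorphM.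
    have -> : real_complex R (- (2 * c) * ab.1 - ab.2) =
        - z * real_complex R ab.1 - real_complex R ab.2.
      rewrite rmorphB; congr (_ - _); rewrite rmorphM; congr (_ * _); exact: rmorphN.
    by rewrite c2E.
  rewrite /phi; move: (real_complex R ab.1) (real_complex R ab.2) => a b.
  apply/eqP; rewrite -subr_eq0; apply/eqP.
  transitivity (- (w ^+ 2 - (z ^+ 2 - 2) * w + 1) * a); first by ring.
  by rewrite Ew oppr0 mul0r.
have phis k : phi (s k) = w ^+ k * (1 + w).
  elim: k => [|k IHk]; first by rewrite /phi /= rmorph1 rmorph0 mulr1 mulr0 addr0 mul1r.
  by rewrite /s iterS -/(s k) phiS IHk exprS mulrA.
(* As c^2 <> 1, the normals [f] and [g] are linearly independent, so h^q = 1 can be read off in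
   coordinates. *)
have sq : s q = (1, 0).
  have := hs q; rewrite hq mul1mx; case: (s q) => a b /= E.
  have E1 : 1 = a + b * c by rewrite -Nf {1}E !lorentz_simp Nf (lorentzC g) mulr1.
  have E2 : c = a * c + b by rewrite /c {1}E !lorentz_simp Ng -/c mulr1.
  have : b * (1 - c ^+ 2) = 0.
    have -> : b * (1 - c ^+ 2) = (a * c + b) - c * (a + b * c) by ring.
    by rewrite -E1 -E2; ring.
  move/eqP; rewrite mulf_eq0 subr_eq0 [1 == _]eq_sym sqrf_eq1 (negPf c1) (negPf c1') /= orbF.
  by move/eqP => b0; rewrite b0 mul0r addr0 in E1; rewrite b0 -E1.
have zw : z ^+ 2 * w = (1 + w) ^+ 2.
  apply/eqP; rewrite eq_sym -subr_eq0 -Ew; apply/eqP; ring.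
have w1 : 1 + w != 0.
  rewrite -sqrf_eq0 -zw mulf_neq0 //.
    by rewrite sqrf_eq0 fmorph_eq0 mulf_neq0.
  by apply: contra_eq_neq Ew => ->; rewrite mulr0 expr0n subr0 add0r oner_eq0.
apply: (cosine_like_unity q0 _ zw).
by apply: (mulIf w1); rewrite mul1r -phis sq /phi /= rmorph1 rmorph0 mulr1 mulr0 addr0.
Qed.

End MirrorAngles.

(** * Chambers of a reflection group *)

Section Tits.
Variables (R : realType) (n : nat) (I : eqType) (e : I -> 'cV[R]_n.+1).
Hypothesis e_unit : forall i, lorentz (e i) (e i) = 1.
Hypothesis e_gram : forall i j, i != j ->
  [\/ lorentz (e i) (e j) = 0, lorentz (e i) (e j) = - (1 / 2) | lorentz (e i) (e j) <= -1].

Let r i := reflection_mx (e i).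

Definition word_mx (w : seq I) : 'M[R]_n.+1 := \big[mulmx/1%:M]_(i <- w) reflection_mx (e i).

Lemma word_mx_nil : word_mx [::] = 1%:M. Proof. by rewrite /word_mx big_nil. Qed.

Lemma word_mx_cons i w : word_mx (i :: w) = reflection_mx (e i) *m word_mx w.
Proof. by rewrite /word_mx big_cons. Qed.

Lemma word_mx_cat v w : word_mx (v ++ w) = word_mx v *m word_mx w.
Proof.
elim: v => [|i v IHv]; first by rewrite word_mx_nil mul1mx.
by rewrite cat_cons !word_mx_cons IHv mulmxA.
Qed.

Lemma word_mx_rcons w i : word_mx (rcons w i) = word_mx w *m reflection_mx (e i).
Proof. by rewrite -cats1 word_mx_cat word_mx_cons word_mx_nil mulmx1. Qed.

Lemma word_mx_iso w : is_isometry (word_mx w).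
Proof.
elim: w => [|i w IHw]; first by rewrite word_mx_nil => x y; rewrite !mul1mx.
by rewrite word_mx_cons; apply: isometryM => //; apply: reflection_isometry.
Qed.

Lemma word_mx_inv w : invmx (word_mx w) = word_mx (rev w).
Proof.
have E : word_mx w *m word_mx (rev w) = 1%:M.
  elim: w => [|i w IHw]; first by rewrite word_mx_nil mul1mx.
  rewrite rev_cons word_mx_rcons word_mx_cons -mulmxA (mulmxA (word_mx w)) IHw mul1mx.
  exact: reflection_invol.
by rewrite -[RHS]mul1mx -(mulVmx (isometry_unit (word_mx_iso w))) -mulmxA E mulmx1.
Qed.

Definition open_chamber (x : 'cV[R]_n.+1) := forall i, lorentz x (e i) < 0.

(** Positivity is expressed through the chamber, not through nonnegative coefficients: four normals
    in 3-space are linearly dependent, so coefficients are not unique. *)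
Definition positive_root (f : 'cV[R]_n.+1) := forall x, open_chamber x -> lorentz x f < 0.

Lemma positive_root_comb f g a b : positive_root f -> positive_root g ->
  0 <= a -> 0 <= b -> 0 < a + b -> positive_root (a *: f + b *: g).
Proof.
move=> pf pg a0 b0 ab x cx; rewrite !lorentz_simp.
have := pf x cx; have := pg x cx => h1 h2.
have k1 : a * lorentz x f <= 0 by rewrite mulr_ge0_le0 // ltW.
have k2 : b * lorentz x g <= 0 by rewrite mulr_ge0_le0 // ltW.
have [a_eq0|a_neq0] := eqVneq a 0.
  have : b * lorentz x g < 0 by rewrite pmulr_rlt0 //; rewrite a_eq0 add0r in ab.
  lra.
have : a * lorentz x f < 0 by rewrite pmulr_rlt0 // lt_neqAle eq_sym a_neq0.
lra.
Qed.

Section Dihedral.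
Variables (s t : I).
Hypothesis st : s != t.
Let g := lorentz (e s) (e t).

(** With [positive_word], the two alternatives of the rank two dichotomy between length and sign of
    roots, which [dihedral] proves for every word in [s] and [t]. *)
Definition shortened (u : seq I) := exists u', [/\ all [in [:: s; t]] u',
  (size u' < size u)%N & word_mx u' = word_mx u *m reflection_mx (e s)].

Definition positive_word (u : seq I) := exists a b, [/\ 0 <= a, 0 <= b, 0 < a + b &
  word_mx u *m e s = a *: e s + b *: e t].

Lemma shortened_cons x v : x \in [:: s; t] -> shortened v -> shortened (x :: v).
Proof.
move=> xst [v' [av' sv' Ev']]; exists (x :: v'); split=> /=.
- by rewrite av' andbT.
- by rewrite ltnS.
- by rewrite !word_mx_cons Ev' mulmxA.
Qed.

Lemma shortened1 : shortened [:: s].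
Proof. by exists [::]; split=> //; rewrite word_mx_cons word_mx_nil mulmx1 reflection_invol. Qed.

Lemma shortened_square x v : all [in [:: s; t]] v -> shortened [:: x, x & v].
Proof.
move=> av; exists (rcons v s); split; first by rewrite all_rcons av !inE eqxx.
  by rewrite size_rcons.
by rewrite word_mx_rcons !word_mx_cons mulmxA reflection_invol // mul1mx.
Qed.

Lemma reflect_root_s a b : reflection_mx (e s) *m (a *: e s + b *: e t) =
  (- a - 2 * g * b) *: e s + b *: e t.
Proof.
rewrite reflection_mxE !lorentz_simp e_unit (lorentzC (e t)) -/g.
by apply/matrixP => i j; rewrite !mxE; ring.
Qed.

Lemma reflect_root_t a b : reflection_mx (e t) *m (a *: e s + b *: e t) =
  a *: e s + (- b - 2 * g * a) *: e t.
Proof.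
rewrite reflection_mxE !lorentz_simp e_unit -/g.
by apply/matrixP => i j; rewrite !mxE; ring.
Qed.

Lemma reflect_s_t : reflection_mx (e t) *m e s = e s + (- 2 * g) *: e t.
Proof. by have := reflect_root_t 1 0; rewrite scale1r scale0r addr0 oppr0 add0r mulr1 mulNr. Qed.

Lemma reflect_t_s : reflection_mx (e s) *m e t = (- 2 * g) *: e s + e t.
Proof. by have := reflect_root_s 0 1; rewrite scale1r scale0r add0r oppr0 add0r mulr1 mulNr. Qed.

(** In an alternating word each new letter makes its own coefficient the larger one, because - 2 g
    >= 2. A repeated letter, or a last letter [s], allows shortening. *)
Lemma dihedral_infinite u : g <= -1 -> all [in [:: s; t]] u -> shortened u \/
  exists a b, word_mx u *m e s = a *: e s + b *: e t /\
    [\/ [/\ u = [::], a = 1 & b = 0], [/\ ohead u = Some t, 0 <= a, 0 < b & a <= b] |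
        [/\ ohead u = Some s, 0 <= b, 0 < a & b <= a]].
Proof.
move=> g_le; elim: u => [|x v IHv] /=.
  move=> _; right; exists 1, 0; rewrite word_mx_nil mul1mx scale1r scale0r addr0.
  by split => //; apply: Or31.
move=> /andP[xst av]; have [sv|[a [b [Ev H]]]] := IHv av.
  by left; apply: shortened_cons.
move: xst; rewrite !inE => /orP[] /eqP ->; last first.
  case: H => [[-> a1 b0]|[hv a0 b0 ab]|[hv b0 a0 ba]].
  - right; exists 1, (- 2 * g); rewrite word_mx_cons word_mx_nil mulmx1 reflect_s_t scale1r.
    by split => //; apply: Or32; split => //; lra.
  - left; case: v hv av {IHv Ev} => //= y v [->] /andP[_ av].
    exact: shortened_square.
  - right; exists a, (- b - 2 * g * a).
    rewrite word_mx_cons -mulmxA Ev reflect_root_t; split=> //.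
    by apply: Or32; split => //; nra.
case: H => [[-> a1 b0]|[hv a0 b0 ab]|[hv b0 a0 ba]].
- by left; exact: shortened1.
- right; exists (- a - 2 * g * b), b.
  rewrite word_mx_cons -mulmxA Ev reflect_root_s; split=> //.
  by apply: Or33; split => //; nra.
- left; case: v hv av {IHv Ev} => //= y v [->] /andP[_ av].
  exact: shortened_square.
Qed.

Lemma dihedral_commute : g = 0 ->
  reflection_mx (e s) *m reflection_mx (e t) = reflection_mx (e t) *m reflection_mx (e s).
Proof.
move=> g0; have := reflection_conj (e t) (reflection_isometry (e_unit s)).
rewrite reflect_t_s g0 mulr0 scale0r add0r reflection_inv // => E.
by rewrite -[in RHS]E -!mulmxA reflection_invol // mulmx1.
Qed.

Lemma dihedral_braid : g = - (1 / 2) ->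
  reflection_mx (e s) *m reflection_mx (e t) *m reflection_mx (e s) =
  reflection_mx (e t) *m reflection_mx (e s) *m reflection_mx (e t).
Proof.
move=> g0; have E : - 2 * g = 1 by rewrite g0; lra.
have := reflection_conj (e t) (reflection_isometry (e_unit s)).
have := reflection_conj (e s) (reflection_isometry (e_unit t)).
by rewrite reflect_t_s reflect_s_t E !scale1r !reflection_inv // => -> ->.
Qed.

Lemma dihedral_2 u : g = 0 -> all [in [:: s; t]] u ->
  shortened u \/ u \in [:: [::]; [:: t]].
Proof.
move=> g0; elim: u => [|x v IHv] /=; first by right.
move=> /andP[xst av]; have [sv|] := IHv av; first by left; apply: shortened_cons.
rewrite !inE => /orP[] /eqP {IHv av}->; move: xst; rewrite !inE => /orP[] /eqP ->.
- by left; exact: shortened1.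
- by right; rewrite eqxx orbT.
- left; exists [:: t]; split; [by rewrite /= ?inE eqxx ?orbT | by [] |].
  rewrite !word_mx_cons word_mx_nil !mulmx1 dihedral_commute //.
  by rewrite -mulmxA reflection_invol // mulmx1.
- by left; apply: shortened_square.
Qed.

(** The three words are the minimal representatives of the cosets modulo [s] in the dihedral group
    of order 6; the braid relation shortens the next longer one. *)
Lemma dihedral_3 u : g = - (1 / 2) -> all [in [:: s; t]] u ->
  shortened u \/ u \in [:: [::]; [:: t]; [:: s; t]].
Proof.
move=> g0; elim: u => [|x v IHv] /=; first by right.
move=> /andP[xst av]; have [sv|] := IHv av; first by left; apply: shortened_cons.
rewrite !inE => /or3P[] /eqP E; rewrite {IHv}E in av *;
  move: xst; rewrite !inE => /orP[] /eqP ->.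
- by left; exact: shortened1.
- by right; rewrite eqxx orbT.
- by right; rewrite eqxx !orbT.
- by left; apply: shortened_square.
- left; exists [:: t; s]; split; [by rewrite /= ?inE !eqxx ?orbT | by [] |].
  rewrite !word_mx_cons word_mx_nil !mulmx1.
  by rewrite !mulmxA reflection_invol // mul1mx.
- left; exists [:: s; t]; split; [by rewrite /= ?inE !eqxx ?orbT | by [] |].
  rewrite !word_mx_cons word_mx_nil !mulmx1 !mulmxA -dihedral_braid //.
  by rewrite -!mulmxA reflection_invol // !mulmx1.
Qed.

Lemma dihedral u : all [in [:: s; t]] u -> shortened u \/ positive_word u.
Proof.
move=> au; have [g0|g0|g0] := e_gram st.
- have [|] := dihedral_2 g0 au; first by left.
  rewrite !inE => /orP[] /eqP ->; right; exists 1, 0; split; rewrite ?addr0 //.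
  - by rewrite word_mx_nil mul1mx scale1r scale0r addr0.
  - by rewrite word_mx_cons word_mx_nil mulmx1 reflect_s_t /g g0 mulr0 scale1r.
- have E : - 2 * g = 1 by rewrite /g g0; lra.
  have [|] := dihedral_3 g0 au; first by left.
  rewrite !inE => /or3P[] /eqP ->; right.
  + exists 1, 0; split; [lra | lra | lra |].
    by rewrite word_mx_nil mul1mx scale1r scale0r addr0.
  + exists 1, 1; split; [lra | lra | lra |].
    by rewrite word_mx_cons word_mx_nil mulmx1 reflect_s_t E !scale1r.
  + exists 0, 1; split; [lra | lra | lra |].
    rewrite !word_mx_cons word_mx_nil mulmx1 -mulmxA reflect_s_t E !scale1r.
    have := reflect_root_s 1 1; rewrite !scale1r => ->.
    by congr (_ *: _ + _); rewrite /g g0; lra.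
- have [|[a [b [E H]]]] := dihedral_infinite g0 au; first by left.
  by right; exists a, b; case: H => -[] *; split=> //; lra.
Qed.

End Dihedral.

(* Tits' argument: split off a maximal suffix in the dihedral group of [s] and the
   last letter of [w], and apply the induction hypothesis to the prefix. *)
Lemma positive_root_ascent k w s : size w = k ->
  (forall w', word_mx w' = word_mx w *m reflection_mx (e s) -> (k <= size w')%N) ->
  positive_root (word_mx w *m e s).
Proof.
have [m] := ubnP k; elim: m k w s => // m IHm k w s /ltnSE le_km sw asc.
have [[w1 [sw1 Ew1]]|min_w] :=
    pselect (exists w1, (size w1 < size w)%N /\ word_mx w1 = word_mx w).
  rewrite -Ew1; apply: (IHm (size w1)) => // [|w' Ew'].
    by rewrite sw in sw1; apply: leq_trans le_km.
  by apply: leq_trans (asc w' _); [rewrite -sw ltnW | rewrite Ew' Ew1].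
case/lastP: w sw asc min_w => [|w0 t] sw asc min_w.
  by rewrite word_mx_nil mul1mx => x; apply.
have st : s != t.
  apply: contra_notN min_w => /eqP st; have := asc w0.
  rewrite word_mx_rcons st -mulmxA reflection_invol // mulmx1 => /(_ erefl).
  by rewrite -sw size_rcons ltnn.
pose fact (l : nat) := `[< exists v u, [/\ all [in [:: s; t]] u, size v = l,
   (size v + size u <= k)%N & word_mx v *m word_mx u = word_mx (rcons w0 t)] >].
have fact0 : fact (size w0).
  apply/asboolP; exists w0, [:: t]; split=> //=.
  - by rewrite !inE eqxx orbT.
  - by rewrite addn1 -sw size_rcons.
  - by rewrite word_mx_rcons word_mx_cons word_mx_nil mulmx1.
case: (ex_minnP (ex_intro fact _ fact0)) => l /asboolP[v [u [au sv suv Ew]]] min_l.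
have lt_l : (l < k)%N by apply: leq_ltn_trans (min_l _ fact0) _; rewrite -sw size_rcons.
have pos_v x : x \in [:: s; t] -> positive_root (word_mx v *m e x).
  move=> xst; apply: (IHm l) => // [|w' Ew']; first exact: leq_trans le_km.
  rewrite leqNgt; apply/negP => lt_w'.
  have : fact (size w').
    apply/asboolP; exists w', (x :: u); split=> //=.
    - by rewrite xst.
    - by rewrite addnS; apply: leq_trans suv; rewrite sv -addSn leq_add2r.
    - rewrite word_mx_cons Ew' -mulmxA (mulmxA (reflection_mx (e x))).
      by rewrite reflection_invol // mul1mx.
  by move/min_l; rewrite leqNgt lt_w'.
have [[u' [au' su' Eu']]|[a [b [a0 b0 ab Eab]]]] := dihedral st au.
  have := asc (v ++ u'); rewrite word_mx_cat Eu' mulmxA Ew => /(_ erefl).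
  by rewrite size_cat leqNgt (leq_trans _ suv) // ltn_add2l.
rewrite -Ew -mulmxA Eab mulmxDr -!scalemxAr; apply: positive_root_comb => //.
  by apply: pos_v; rewrite !inE eqxx.
by apply: pos_v; rewrite !inE eqxx orbT.
Qed.

(** If a shortest word ends in [s], the element sends e_s to the opposite of a positive root, so the
    image of a point of the chamber is on the wrong side of that root. *)
Theorem chamber_disjoint w x : word_mx w <> 1%:M -> open_chamber x ->
  ~ open_chamber (word_mx w *m x).
Proof.
move=> w1 cx cwx.
pose len (l : nat) := `[< exists w', size w' = l /\ word_mx w' = word_mx w >].
have len0 : len (size w) by apply/asboolP; exists w.
case: (ex_minnP (ex_intro len _ len0)) => l /asboolP[w' [sw' Ew']] min_l.
case/lastP: w' sw' Ew' => [|w0 s] sw' Ew'; first by rewrite -Ew' word_mx_nil in w1.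
have pos : positive_root (word_mx w0 *m e s).
  apply: (positive_root_ascent erefl) => w2 Ew2.
  have : len (size w2) by apply/asboolP; exists w2; rewrite Ew2 -Ew' word_mx_rcons.
  by move/min_l; apply: leq_trans; rewrite -sw' size_rcons.
have Es : word_mx w *m e s = - (word_mx w0 *m e s).
  by rewrite -Ew' word_mx_rcons -mulmxA reflection_self // mulmxN.
have neg := pos _ cwx; have := cx s; rewrite -(word_mx_iso w x) Es lorentzNr.
lra.
Qed.

End Tits.

(** * Reflection groups and the quadrilateral *)

Lemma finite_pos_lb (R : realType) (I : finType) (f : I -> R) : (forall i, 0 < f i) ->
  exists2 eps, 0 < eps & forall i, eps <= f i.
Proof.
move=> f0; exists (\big[Order.min/1]_i f i); last by move=> i; apply: bigmin_le.
exact: lt_bigmin.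
Qed.

Lemma cos_pi_3 (R : realType) : cos (pi / 3 : R) = 1 / 2.
Proof.
have pi0 := pi_gt0 R.
have c0 : 0 < cos (pi / 3 : R) by apply: cos_gt0_pihalf; apply/andP; split; lra.
have : cos (pi / 3 + pi / 3 + pi / 3 : R) = -1.
  by rewrite -cospi; congr cos; field.
rewrite 2!cosD sinD; set c := cos _ in c0 *; set s := sin _.
have s2 : s ^+ 2 = 1 - c ^+ 2 by rewrite sin2cos2.
have -> : (c * c - s * s) * c - (s * c + c * s) * s = c ^+ 3 - 3 * s ^+ 2 * c by ring.
rewrite s2 => E.
have : (c + 1) * (2 * c - 1) ^+ 2 = 0.
  have -> : (c + 1) * (2 * c - 1) ^+ 2 = c ^+ 3 - 3 * (1 - c ^+ 2) * c + 1 by ring.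
  by rewrite E addNr.
move/eqP; rewrite mulf_eq0 sqrf_eq0 gt_eqF ?addr_gt0 //=.
by move/eqP => k; lra.
Qed.

Lemma acos_half (R : realType) : acos (1 / 2 : R) = pi / 3.
Proof.
have pi0 := pi_gt0 R.
by rewrite -cos_pi_3 cosK // in_itv /=; apply/andP; split; lra.
Qed.

(** The triangle inequality through cosh (a + b) <= 2 cosh a cosh b, with base point (1, 0, 0). *)
Lemma hyperbolic_dist_bound (R : realType) (y z : 'cV[R]_3) : hyperbolic_space y ->
  hyperbolic_space z -> y 0 0 <= 2 * z 0 0 * - lorentz y z.
Proof.
move=> Hy Hz; have yz : lorentz y z < 0.
  by case: Hz => Nz z0; apply: hyperbolic_neg => //; rewrite Nz lerN10.
move: Hy Hz yz; have [y0 [y1 [y2 ->]]] := vec3P y; have [z0 [z1 [z2 ->]]] := vec3P z.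
rewrite !hyperbolic_vec3 !vec3_0 lorentz_vec3 => -[Ny y0_gt] [Nz z0_gt] yz.
set q := - _; have q0 : 0 < q by rewrite oppr_gt0.
rewrite -(ler_pM2l y0_gt).
have k : (y1 * z1 + y2 * z2) ^+ 2 <= (y0 ^+ 2 - 1) * (z0 ^+ 2 - 1).
  rewrite Ny Nz -subr_ge0; set w := (_ - _ : R).
  by have -> : w = (y1 * z2 - y2 * z1) ^+ 2; [rewrite /w; ring | exact: sqr_ge0].
have E : y1 * z1 + y2 * z2 = y0 * z0 - q by rewrite /q; ring.
rewrite E in k; have z2_sqr : 1 <= z0 ^+ 2.
  by rewrite Nz; have := sqr_ge0 z1; have := sqr_ge0 z2; lra.
have := sqr_ge0 q; lra.
Qed.

Section ReflectionGroup.
Variables (R : realType) (m : nat) (e : 'I_m -> 'cV[R]_3).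
Hypothesis e_unit : forall i, lorentz (e i) (e i) = 1.

Lemma word_mx_isom w : @isom_hyperbolic R 2 (word_mx e w).
Proof.
elim: w => [|i w IHw]; first by rewrite word_mx_nil; exact: isom1.
by rewrite word_mx_cons; apply: isom_mul => //; apply: reflection_isom.
Qed.

Lemma words_subgroup : @is_isom_subgroup R 2 [set word_mx e w | w in setT].
Proof.
split.
- by move=> _ [w _ <-]; exact: word_mx_isom.
- by exists [::] => //; rewrite word_mx_nil.
- by move=> _ _ [v _ <-] [w _ <-]; exists (v ++ w) => //; rewrite word_mx_cat.
- by move=> _ [w _ <-]; exists (rev w) => //; rewrite word_mx_inv.
Qed.

Lemma reflection_groupE : reflection_group e = [set word_mx e w | w in setT].
Proof.
apply/seteqP; split.
- apply: smallest_sub; first exact: words_subgroup.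
  by move=> _ [i _ <-]; exists [:: i] => //; rewrite word_mx_cons word_mx_nil mulmx1.
- move=> _ [w _ <-] H [[_ H1 HM _] sub].
  elim: w => [|i w IHw]; first by rewrite word_mx_nil.
  by rewrite word_mx_cons; apply: HM => //; apply: sub; exists i.
Qed.

Hypothesis e_gram : forall i j, i != j ->
  [\/ lorentz (e i) (e j) = 0, lorentz (e i) (e j) = - (1 / 2) | lorentz (e i) (e j) <= -1].
Variable p0 : 'cV[R]_3.
Hypotheses (Hp0 : hyperbolic_space p0) (cp0 : open_chamber e p0).

(** If v is close to g, then g^-1 v moves [p0] so little that it stays in the open chamber, and
    [chamber_disjoint] gives g^-1 v = 1. *)
Lemma words_discrete : @discrete_subset R 2 [set word_mx e w | w in setT].
Proof.
move=> _ [w _ <-]; split; first by rewrite inE; exists w.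
set g := word_mx e w.
pose K (i : 'I_m) : R := 1 + \sum_(s < 3) `|(g *m e i) s 0| * \sum_(t < 3) `|p0 t 0|.
have K0 i : 0 < K i.
  by rewrite ltr_pwDl // sumr_ge0 // => s _; rewrite mulr_ge0 // sumr_ge0.
have [eps eps0 epsP] : exists2 eps, 0 < eps & forall i, eps <= - lorentz p0 (e i) / K i.
  by apply: finite_pos_lb => i; rewrite divr_gt0 // oppr_gt0.
exists (ball g eps); first exact: nbhsx_ballx.
apply/seteqP; split; last first.
  by move=> _ ->; split; [exact: ballxx | exists w].
move=> y [Bv [v _ Ey]]; rewrite -{}Ey in Bv *.
have /= near_g i j : `|word_mx e v i j - g i j| < eps.
  by case: Bv => _ /(_ i j); rewrite /ball /= distrC.
have isog : is_isometry g by apply: word_mx_iso.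
have : word_mx e (rev w ++ v) = 1%:M.
  apply: contrapT => ne1; apply: (chamber_disjoint e_unit e_gram ne1 cp0) => i.
  rewrite word_mx_cat -word_mx_inv // -/g -mulmxA lorentz_inv //.
  have -> : word_mx e v *m p0 = g *m p0 + (word_mx e v - g) *m p0.
    by rewrite mulmxBl addrC subrK.
  rewrite lorentzDl isog -ltrBrDl add0r; set D := word_mx e v - g.
  apply: (@le_lt_trans _ _ (eps * (K i - 1))); last first.
    have := epsP i; rewrite ler_pdivlMr // mulrBr mulr1; lra.
  apply: le_trans (ler_norm _) _; rewrite -lorentzE /lorentz_mx mul_mx_diag mxE.
  apply: le_trans (ler_norm_sum _ _ _) _.
  rewrite /K [1 + _]addrC addrK mulr_sumr; apply: ler_sum => s _.
  move: (g *m e i) => z; rewrite !mxE normrM mulrCA [leLHS]mulrC ler_wpM2l //.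
  have -> : `|(\sum_j D s j * p0 j 0) * (if s == 0 then -1 else 1)| =
      `|\sum_j D s j * p0 j 0|.
    by case: ifP; rewrite ?mulrN1 ?normrN ?mulr1.
  rewrite mulr_sumr; apply: le_trans (ler_norm_sum _ _ _) _.
  by apply: ler_sum => t _; rewrite normrM ler_wpM2r // !mxE ltW // near_g.
rewrite word_mx_cat -word_mx_inv // => E; apply/esym.
rewrite -[LHS]mulmx1 -E mulmxA mulmxV ?mul1mx //.
exact/isometry_unit/word_mx_iso.
Qed.

(** Reflecting in a violated side strictly decreases the distance to [p0]. Without end, this would
    produce infinitely many elements of a discrete group with bounded entries. *)
Lemma words_cover x : hyperbolic_space x ->
  exists w, polytope e (word_mx e w *m x).
Proof.
move=> Hx; apply: contrapT => nocover.
have ex_next w : exists i, 0 < lorentz (word_mx e w *m x) (e i).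
  apply: contrapT => nope; apply: nocover; exists w; split.
    by have [_] := word_mx_isom w; apply.
  by move=> i; rewrite leNgt; apply/negP => h; apply: nope; exists i.
have [nx nxP] := choice ex_next.
pose s k := iter k (fun w => nx w :: w) [::].
pose F k := - lorentz (word_mx e (s k) *m x) p0.
have Fs k : F k.+1 < F k.
  rewrite /F /= word_mx_cons -mulmxA reflection_mxE lorentzBl lorentzZl.
  rewrite ltrN2 ltrBrDl gtrDr -mulrA pmulr_rlt0 // pmulr_rlt0 ?nxP // lorentzC.
  exact: cp0.
have F_anti k l : (k < l)%N -> F l < F k.
  elim: l => // l IHl; rewrite ltnS leq_eqVlt => /orP[/eqP->|/IHl]; first exact: Fs.
  exact/lt_trans/Fs.
have F_le k : F k <= F 0%N by case: k => // k; apply/ltW/F_anti.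
have Hs k : hyperbolic_space (word_mx e (s k) *m x).
  by have [_] := word_mx_isom (s k); apply.
apply: (no_bounded_seq words_subgroup words_discrete
  (h := fun k => word_mx e (s k)) (B := 4 * x 0 0 * (2 * p0 0 0 * F 0%N))).
- by move=> k; exists (s k).
- move=> k l /= E; have FE : F k = F l by rewrite /F E.
  by have [/F_anti|/F_anti|] := ltngtP k l => //; rewrite FE ltxx.
- move=> k i j; apply: le_trans (isom_entry_bound i j (word_mx_isom _) Hx) _.
  have x0 : 0 < x 0 0 by case: Hx.
  have p00 : 0 < p0 0 0 by case: Hp0.
  rewrite ler_pM2l ?mulr_gt0 //; apply: le_trans (hyperbolic_dist_bound (Hs k) Hp0) _.
  by rewrite ler_pM2l ?mulr_gt0 // F_le.
Qed.

(** Otherwise pushing [x] slightly towards [p0] would put a point and its image into the open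
    chamber. The overlap of two chambers thus lies on finitely many lines and is null. *)
Lemma chamber_overlap w x : word_mx e w <> 1%:M -> polytope e x ->
  polytope e (word_mx e w *m x) -> exists i, lorentz (word_mx e w *m x) (e i) = 0.
Proof.
move=> w1 [_ cx] [_ cwx]; apply: contrapT => no0.
set y := word_mx e w *m x in cwx no0.
have y0 i : lorentz y (e i) < 0.
  by rewrite lt_neqAle cwx andbT; apply/eqP => E; apply: no0; exists i.
pose b i := `|lorentz (word_mx e w *m p0) (e i)|.
have [eps eps0 epsP] : exists2 eps, 0 < eps & forall i, eps <= - lorentz y (e i) / (1 + b i).
  by apply: finite_pos_lb => i; rewrite divr_gt0 ?oppr_gt0 // ltr_pwDl // normr_ge0.
pose z := x + eps *: p0.
apply: (chamber_disjoint e_unit e_gram w1 (x := z)) => i.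
  rewrite /z lorentzDl lorentzZl; have := cx i.
  have : eps * lorentz p0 (e i) < 0 by rewrite pmulr_rlt0.
  lra.
rewrite /z mulmxDr -scalemxAr lorentzDl lorentzZl -/y.
have b0 : 0 <= b i by rewrite normr_ge0.
have := epsP i; rewrite ler_pdivlMr ?ltr_pwDl // mulrDr mulr1.
have : eps * lorentz (word_mx e w *m p0) (e i) <= eps * b i.
  by rewrite ler_wpM2l ?ler_norm ?(ltW eps0).
lra.
Qed.

End ReflectionGroup.

(** Stated over any ring with units so that the same table serves over the abstract field of entries
    and for its conjugates. *)
Definition quad_gram_table (K : unitRingType) (C D : K) (i j : nat) : K :=
  nth 0 (nth [::] [:: [:: 1; 0; - C; 0]; [:: 0; 1; 0; - D];
    [:: - C; 0; 1; - (1 / 2)]; [:: 0; - D; - (1 / 2); 1]] i) j.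

(** * The quadrilateral as a Coxeter polytope *)

Section Quadrilateral.
Variables (R : realType) (u C S D : R).
Hypothesis P : quad_params u C S D.

Definition quad_normal (i : 'I_4) : 'cV[R]_3 :=
  nth 0 [:: vec3 0 (-1) 0; vec3 0 0 (-1); vec3 S C 0; vec3 (1 / (2 * S)) 0 D] i.

Lemma ord4P (Q : 'I_4 -> Prop) : Q (inord 0) -> Q (inord 1) -> Q (inord 2) -> Q (inord 3) ->
  forall i, Q i.
Proof.
move=> Q0 Q1 Q2 Q3 [[|[|[|[|i]]]] lt_i] //.
- by move: Q0; congr Q; apply: val_inj; rewrite /= inordK.
- by move: Q1; congr Q; apply: val_inj; rewrite /= inordK.
- by move: Q2; congr Q; apply: val_inj; rewrite /= inordK.
- by move: Q3; congr Q; apply: val_inj; rewrite /= inordK.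
Qed.

Lemma quad_normal0 : quad_normal (inord 0) = vec3 0 (-1) 0.
Proof. by rewrite /quad_normal inordK. Qed.
Lemma quad_normal1 : quad_normal (inord 1) = vec3 0 0 (-1).
Proof. by rewrite /quad_normal inordK. Qed.
Lemma quad_normal2 : quad_normal (inord 2) = vec3 S C 0.
Proof. by rewrite /quad_normal inordK. Qed.
Lemma quad_normal3 : quad_normal (inord 3) = vec3 (1 / (2 * S)) 0 D.
Proof. by rewrite /quad_normal inordK. Qed.

Definition quad_normalE := (quad_normal0, quad_normal1, quad_normal2, quad_normal3).

Lemma quad_normal_unit i : lorentz (quad_normal i) (quad_normal i) = 1.
Proof.
have S0 := qS_gt0 P; have u0 := u_gt0 P.
move: i; apply: ord4P; rewrite !quad_normalE lorentz_vec3; try ring.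
  by ring: (qC2 P) (qS2 P).
have D2 : D ^+ 2 = 1 + 1 / (4 * u).
  by apply: (@mulfI _ (4 * u)); [lra | rewrite (qD2 P); field; lra].
by rewrite -!expr2 D2 -(qS2 P); field; lra.
Qed.

Lemma quad_gram i j : lorentz (quad_normal i) (quad_normal j) = quad_gram_table C D i j.
Proof.
have S0 := qS_gt0 P.
have [<-|ij] := eqVneq i j.
  by rewrite quad_normal_unit; case: i => [[|[|[|[|i]]]] //].
move: j ij; move: i; apply: ord4P; apply: ord4P; rewrite ?eqxx // => _;
  rewrite /quad_gram_table !inordK // !quad_normalE lorentz_vec3 /=; (try ring); field; lra.
Qed.

Lemma quad_D_ge : 1 <= D.
Proof.
have u0 := u_gt0 P; have D0 := qD_gt0 P.
rewrite -(@ler_pXn2r _ 2) ?nnegrE ?(ltW D0) // expr1n -(@ler_pM2l _ (4 * u)); last by lra.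
by rewrite (qD2 P); lra.
Qed.

Lemma quad_gram_cases i j : i != j ->
  [\/ lorentz (quad_normal i) (quad_normal j) = 0,
      lorentz (quad_normal i) (quad_normal j) = - (1 / 2) |
      lorentz (quad_normal i) (quad_normal j) <= -1].
Proof.
have [C1 _] := C_bounds P; have D1 := quad_D_ge.
rewrite quad_gram; move: j; move: i; apply: ord4P; apply: ord4P; rewrite ?eqxx // => _;
  rewrite /quad_gram_table !inordK //=.
all: try (by apply: Or31); try (by apply: Or32); by apply: Or33; lra.
Qed.

(** The Klein model: the point of the hyperboloid above the point (b, c) of the open unit disc. *)
Lemma ray_point b c : b ^+ 2 + c ^+ 2 < 1 -> exists2 k : R, 0 < k &
  hyperbolic_space (vec3 k (k * b) (k * c)).
Proof.
move=> bc; have k0 : 0 < 1 - b ^+ 2 - c ^+ 2 by lra.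
exists (Num.sqrt (1 - b ^+ 2 - c ^+ 2))^-1; first by rewrite invr_gt0 sqrtr_gt0.
rewrite hyperbolic_vec3; split; last by rewrite invr_gt0 sqrtr_gt0.
by rewrite !exprMn !exprVn sqr_sqrtr ?ltW //; field; lra.
Qed.

(** In the Klein model the quadrilateral is a rectangle with opposite corners (0, 0) and
    ([quad_width], [quad_height]). *)
Definition quad_width := S / C.
Definition quad_height := 1 / (2 * S * D).

Lemma quad_width_gt0 : 0 < quad_width.
Proof. by rewrite divr_gt0 ?(qS_gt0 P) ?(qC_gt0 P). Qed.

Lemma quad_height_gt0 : 0 < quad_height.
Proof. by rewrite divr_gt0 // !mulr_gt0 ?(qS_gt0 P) ?(qD_gt0 P). Qed.

(** The corner with angle pi / 3 lies inside the unit disc, which makes the quadrilateral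
    compact. *)
Lemma quad_width_height : quad_width ^+ 2 + quad_height ^+ 2 < 1.
Proof.
have u0 := u_gt0 P.
rewrite /quad_width /quad_height !expr_div_n expr1n !exprMn (qS2 P) (qC2 P).
have -> : 2 ^+ 2 * u * D ^+ 2 = 1 + 4 * u by rewrite -(qD2 P); ring.
have -> : u / (1 + u) + 1 / (1 + 4 * u) = 1 - 3 * u / ((1 + u) * (1 + 4 * u)).
  by field; apply/andP; split; lra.
rewrite gtrBl divr_gt0 ?mulr_gt0 //; lra.
Qed.

Lemma quad_normal_ray k b c : 0 < k ->
  [/\ lorentz (vec3 k (k * b) (k * c)) (quad_normal (inord 0)) = - (k * b),
      lorentz (vec3 k (k * b) (k * c)) (quad_normal (inord 1)) = - (k * c),
      lorentz (vec3 k (k * b) (k * c)) (quad_normal (inord 2)) = - (k * C) * (quad_width - b) &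
      lorentz (vec3 k (k * b) (k * c)) (quad_normal (inord 3)) = - (k * D) * (quad_height - c)].
Proof.
move=> k0; have S0 := qS_gt0 P; have C0 := qC_gt0 P; have D0 := qD_gt0 P.
rewrite !quad_normalE !lorentz_vec3 /quad_width /quad_height.
by split; [ring | ring | field; lra | field; apply/andP; split; lra].
Qed.

Lemma quad_stratum (A : {set 'I_4}) b c : b ^+ 2 + c ^+ 2 < 1 ->
  (if inord 0 \in A then b == 0 else 0 < b) ->
  (if inord 1 \in A then c == 0 else 0 < c) ->
  (if inord 2 \in A then b == quad_width else b < quad_width) ->
  (if inord 3 \in A then c == quad_height else c < quad_height) ->
  open_stratum quad_normal A !=set0.
Proof.
move=> bc; have [k k0 Hk] := ray_point bc.
have [E0 E1 E2 E3] := quad_normal_ray b c k0.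
have C0 := qC_gt0 P; have D0 := qD_gt0 P.
move=> h0 h1 h2 h3; exists (vec3 k (k * b) (k * c)); split => //.
apply: ord4P.
- move: h0; rewrite E0; case: ifP => _; first by move/eqP->; rewrite mulr0 oppr0.
  by move=> b0; rewrite oppr_lt0 mulr_gt0.
- move: h1; rewrite E1; case: ifP => _; first by move/eqP->; rewrite mulr0 oppr0.
  by move=> c0; rewrite oppr_lt0 mulr_gt0.
- move: h2; rewrite E2; case: ifP => _; first by move/eqP->; rewrite subrr mulr0.
  by move=> b0; rewrite mulNr oppr_lt0 !mulr_gt0 ?subr_gt0.
- move: h3; rewrite E3; case: ifP => _; first by move/eqP->; rewrite subrr mulr0.
  by move=> c0; rewrite mulNr oppr_lt0 !mulr_gt0 ?subr_gt0.
Qed.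

Lemma inord4_eq (i j : nat) : (i < 4)%N -> (j < 4)%N -> ((inord i : 'I_4) == inord j) = (i == j).
Proof. by move=> i4 j4; rewrite -val_eqE /= !inordK. Qed.

Lemma quad_is_polytope : is_polytope quad_normal.
Proof.
have w0 := quad_width_gt0; have h0 := quad_height_gt0; have wh := quad_width_height.
have w2 := sqr_ge0 quad_width; have h2 := sqr_ge0 quad_height.
have wE : (quad_width / 2) ^+ 2 = quad_width ^+ 2 / 4 by field.
have hE : (quad_height / 2) ^+ 2 = quad_height ^+ 2 / 4 by field.
split; first exact: quad_normal_unit.
- apply: (@quad_stratum _ (quad_width / 2) (quad_height / 2)); rewrite ?finset.inE ?wE ?hE; lra.
- apply: ord4P.
  + apply: (@quad_stratum _ 0 (quad_height / 2)); rewrite ?finset.inE ?inord4_eq //= ?expr0n ?hE /=; lra.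
  + apply: (@quad_stratum _ (quad_width / 2) 0); rewrite ?finset.inE ?inord4_eq //= ?expr0n ?wE /=; lra.
  + apply: (@quad_stratum _ quad_width (quad_height / 2)); rewrite ?finset.inE ?inord4_eq //= ?hE; lra.
  + apply: (@quad_stratum _ (quad_width / 2) quad_height); rewrite ?finset.inE ?inord4_eq //= ?wE; lra.
Qed.

Lemma quad_is_Coxeter : is_Coxeter quad_normal.
Proof.
split; first exact: quad_is_polytope.
have S0 := qS_gt0 P; have C0 := qC_gt0 P; have D0 := qD_gt0 P.
have adj_sub i j x : open_stratum quad_normal [set i; j]%SET x ->
    [/\ hyperbolic_space x, lorentz x (quad_normal i) = 0 & lorentz x (quad_normal j) = 0].
  by move=> [Hx st]; split => //; [have := st i | have := st j]; rewrite !finset.inE eqxx ?orbT.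
have no_ac x : hyperbolic_space x -> lorentz x (quad_normal (inord 0)) = 0 ->
    lorentz x (quad_normal (inord 2)) = 0 -> False.
  have [x0 [x1 [x2 ->]]] := vec3P x; rewrite hyperbolic_vec3 !quad_normalE !lorentz_vec3.
  move=> [_ x00] h1 h2; have x10 : x1 = 0 by lra.
  by have := mulr_gt0 x00 S0; rewrite x10 in h2; lra.
have no_bd x : hyperbolic_space x -> lorentz x (quad_normal (inord 1)) = 0 ->
    lorentz x (quad_normal (inord 3)) = 0 -> False.
  have [x0 [x1 [x2 ->]]] := vec3P x; rewrite hyperbolic_vec3 !quad_normalE !lorentz_vec3.
  move=> [_ x00] h1 h2; have x20 : x2 = 0 by lra.
  have : 0 < x0 * (1 / (2 * S)) by rewrite mulr_gt0 // divr_gt0 // mulr_gt0.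
  by rewrite x20 in h2; lra.
have right_angle : exists2 q, (2 <= q)%N & acos (- 0) = pi / q%:R :> R.
  by exists 2%N => //; rewrite oppr0 acos0.
have third_angle : exists2 q, (2 <= q)%N & acos (- - (1 / 2)) = pi / q%:R :> R.
  by exists 3%N => //; rewrite opprK acos_half.
move=> i j [ij [x /adj_sub[Hx xi xj]]]; rewrite /dihedral_angle quad_gram.
move: j ij xj; move: i xi; apply: ord4P => xi; apply: ord4P; rewrite ?eqxx // => _ xj;
  rewrite /quad_gram_table !inordK //=.
- by case: (no_ac x).
- by case: (no_bd x).
- by case: (no_ac x).
- by case: (no_bd x).
Qed.

Lemma quad_interior_point :
  exists2 p, @hyperbolic_space R 2 p & open_chamber quad_normal p.
Proof.
have [_ [p [Hp st]] _] := quad_is_polytope; exists p => // i.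
by have := st i; rewrite finset.in_set0.
Qed.

End Quadrilateral.

(** * Area *)

Section Area.
Variable R : realType.

Let plane := (measurableTypeR R * measurableTypeR R)%type.
Let leb2 := (@lebesgue_measure R \x @lebesgue_measure R)%E.

Lemma chart_hyperbolic (p : plane) : hyperbolic_space (graph_chart p).
Proof.
have h : 0 < 1 + p.1 ^+ 2 + p.2 ^+ 2 by rewrite -addrA ltr_pwDl // addr_ge0 ?sqr_ge0.
have -> : graph_chart p = vec3 (Num.sqrt (1 + p.1 ^+ 2 + p.2 ^+ 2)) p.1 p.2 by [].
by rewrite hyperbolic_vec3 sqr_sqrtr ?sqrtr_gt0 ?(ltW h).
Qed.

Lemma chart_height_ge1 (p : plane) : 1 <= graph_chart p 0 0.
Proof.
rewrite /graph_chart mxE /= -[leLHS]sqrtr1 ler_wsqrtr // -addrA lerDl.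
by rewrite addr_ge0 ?sqr_ge0.
Qed.

Lemma measurable_chart_height :
  measurable_fun setT (fun p : plane => graph_chart p 0 0).
Proof.
have -> : (fun p : plane => graph_chart p 0 0) =
    Num.sqrt \o (fun p : plane => 1 + p.1 ^+ 2 + p.2 ^+ 2).
  by apply/funext => p; rewrite mxE.
apply: measurableT_comp.
  by apply: continuous_measurable_fun; exact: sqrt_continuous.
apply: measurable_funD; first apply: measurable_funD.
- exact: measurable_cst.
- by apply: measurable_funX; exact: measurable_fst.
- by apply: measurable_funX; exact: measurable_snd.
Qed.

Lemma measurable_chart_lorentz (v : 'cV[R]_3) :
  measurable_fun setT (fun p : plane => lorentz (graph_chart p) v).
Proof.
have [a [b [c ->]]] := vec3P v.
have -> : (fun p : plane => lorentz (graph_chart p) (vec3 a b c)) =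
    (fun p : plane => - (graph_chart p 0 0 * a) + p.1 * b + p.2 * c).
  by apply/funext => p; rewrite -lorentz_vec3; congr lorentz; rewrite mxE.
apply: measurable_funD; first apply: measurable_funD.
- apply: measurableT_comp => //; apply: measurable_funM => //.
  exact: measurable_chart_height.
- by apply: measurable_funM => //; exact: measurable_fst.
- by apply: measurable_funM => //; exact: measurable_snd.
Qed.

Lemma measurable_half_plane (v : 'cV[R]_3) :
  measurable [set p : plane | lorentz (graph_chart p) v <= 0].
Proof.
rewrite -[X in measurable X]setTI; apply: measurable_fun_le => //.
exact: measurable_chart_lorentz.
Qed.

Lemma measurable_chart_line (v : 'cV[R]_3) :
  measurable [set p : plane | lorentz (graph_chart p) v = 0].
Proof.
have -> : [set p : plane | lorentz (graph_chart p) v = 0] =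
    [set p : plane | lorentz (graph_chart p) v <= 0] `&`
    [set p : plane | lorentz (graph_chart p) (- v) <= 0].
  apply/seteqP; split => p /=; first by rewrite lorentzNr => ->; rewrite oppr0 lexx.
  by rewrite lorentzNr oppr_le0 => -[h1 h2]; apply/eqP; rewrite eq_le h1.
by apply: measurableI; exact: measurable_half_plane.
Qed.

Lemma Borel_polytope m (e : 'I_m -> 'cV[R]_3) : Borel_plane (polytope e).
Proof.
rewrite /Borel_plane.
have -> : (graph_chart (R:=R)) @^-1` polytope e =
    \bigcap_(i in [set: 'I_m]) [set p : plane | lorentz (graph_chart p) (e i) <= 0].
  apply/seteqP; split => p /=; first by move=> [_ H] i _; exact: H.
  by move=> H; split; [exact: chart_hyperbolic | move=> i; exact: H].
apply: fin_bigcap_measurable; first exact: finite_finset.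
by move=> i _; exact: measurable_half_plane.
Qed.

Lemma measurable_density (A : set plane) : measurable_fun A
  (fun p : plane => ((graph_chart p 0 0)^-1)%:E).
Proof.
apply/measurable_EFinP; apply: measurable_funTS.
have -> : (fun p : plane => (graph_chart p 0 0)^-1) =
    (fun p : plane => (graph_chart p 0 0) `^ (-1)).
  apply/funext => p; rewrite powR_inv1 //.
  exact: le_trans (chart_height_ge1 p).
exact: measurableT_comp (measurable_powR (-1)) measurable_chart_height.
Qed.

Lemma quadratic_roots_countable (a b c : R) : ~~ [&& a == 0, b == 0 & c == 0] ->
  countable [set y | a * y ^+ 2 + b * y + c = 0].
Proof.
move=> abc; apply: finite_set_countable.
have [a0|a0] := eqVneq a 0.
  have [b0|b0] := eqVneq b 0.
    rewrite a0 b0 !eqxx /= in abc.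
    apply: (sub_finite_set (B := set0)) => // y /=.
    by rewrite a0 b0 !mul0r !add0r => c0; rewrite c0 eqxx in abc.
  apply: (sub_finite_set (B := [set - c / b])) => // y /=.
  by rewrite a0 mul0r add0r => E; apply: (mulIf b0); rewrite divfK //; lra.
pose s := Num.sqrt (b ^+ 2 - 4 * a * c).
apply: (sub_finite_set (B := [set (- b + s) / (2 * a); (- b - s) / (2 * a)])) => [y /= E|].
  have a20 : 2 * a != 0 by rewrite mulf_neq0.
  have E2 : (2 * a * y + b) ^+ 2 = b ^+ 2 - 4 * a * c.
    have -> : (2 * a * y + b) ^+ 2 = 4 * a * (a * y ^+ 2 + b * y + c) + b ^+ 2 - 4 * a * c by ring.
    by rewrite E mulr0 add0r.
  have : (2 * a * y + b) ^+ 2 == s ^+ 2 by rewrite sqr_sqrtr -?E2 ?sqr_ge0.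
  rewrite eqf_sqr => /orP[] /eqP Es; [left|right]; apply: (mulIf a20); rewrite divfK //; lra.
by rewrite finite_setU; split; exact: finite_set1.
Qed.

(* Fubini: a vertical line meets the line in the roots of a quadratic equation. *)
Lemma null_chart_line (v : 'cV[R]_3) : lorentz v v = 1 ->
  leb2 [set p : plane | lorentz (graph_chart p) v = 0] = 0%E.
Proof.
have [a [b [c ->]]] := vec3P v; rewrite lorentz_vec3 => Nv.
set N := [set p : plane | _].
have mN : measurable N by exact: measurable_chart_line.
(* The section at x = 0 can be a full line, as for the first side; this single x is negligible. *)
have section0 (x : R) : x != 0 -> lebesgue_measure (xsection N x) = 0%E.
  move=> x0; apply: countable_lebesgue_measure0.
  have sub : xsection N x `<=` [set y | (c ^+ 2 - a ^+ 2) * y ^+ 2 + (2 * b * c * x) * y +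
      (b ^+ 2 * x ^+ 2 - a ^+ 2 * (1 + x ^+ 2)) = 0].
    move=> y; rewrite /xsection /= inE /N /=.
    have -> : graph_chart (x, y) = vec3 (Num.sqrt (1 + x ^+ 2 + y ^+ 2)) x y by [].
    rewrite lorentz_vec3 => E.
    have h : 0 <= 1 + x ^+ 2 + y ^+ 2 by rewrite -addrA addr_ge0 // addr_ge0 ?sqr_ge0.
    have : (x * b + y * c) ^+ 2 = (1 + x ^+ 2 + y ^+ 2) * a ^+ 2.
      by rewrite -(sqr_sqrtr h) -exprMn; congr (_ ^+ 2); lra.
    lra.
  apply: sub_countable (subset_card_le sub) _.
  (* All three coefficients vanish only for the zero vector, which is not a unit normal. *)
  apply: quadratic_roots_countable; apply/and3P => -[/eqP h1 /eqP h2 /eqP h3].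
  have bc : b * c = 0.
    by apply: (mulIf x0); rewrite mul0r; lra.
  move/eqP: bc; rewrite mulf_eq0 => /orP[] /eqP z0.
  - rewrite z0 expr0n /= mul0r sub0r in h3.
    have : a ^+ 2 = 0.
      by apply: (@mulIf _ (1 + x ^+ 2)); rewrite ?mul0r; [have := sqr_ge0 x; lra | lra].
    by move=> a2; rewrite a2 subr0 in h1; rewrite z0 -!expr2 h1 a2 expr0n /= in Nv; lra.
  - rewrite z0 expr0n /= sub0r in h1.
    have a2 : a ^+ 2 = 0 by lra.
    rewrite a2 mul0r subr0 in h3; move/eqP: h3; rewrite mulf_eq0 !sqrf_eq0 (negPf x0) orbF.
    by move/eqP => b0; rewrite z0 b0 -!expr2 a2 expr0n /= in Nv; lra.
rewrite /leb2 /product_measure1.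
have m0 : measurable [set 0 : measurableTypeR R] by exact: measurable_set1.
have mf := @measurable_fun_xsection _ _ (measurableTypeR R) (measurableTypeR R) R (@lebesgue_measure R) N mN.
rewrite (@ge0_negligible_integral _ _ _ _ setT [set (0 : measurableTypeR R)]) //; last exact: lebesgue_measure_set1.
rewrite integral0_eq // => x [_ /= x0].
by rewrite section0 //; apply/eqP.
Qed.

Lemma area_null m (e : 'I_m -> 'cV[R]_3) (A : set 'cV[R]_3) :
  (forall i, lorentz (e i) (e i) = 1) -> Borel_plane A ->
  (forall x, A x -> exists i, lorentz x (e i) = 0) -> area A = 0%E.
Proof.
move=> e1 bA sub; apply: null_set_integral => //; first exact: measurable_density.
pose N := \big[setU/set0]_(i < m) [set p : plane | lorentz (graph_chart p) (e i) = 0].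
have [mN N0] : measurable N /\ leb2 N = 0%E.
  apply: (big_ind (fun B : set plane => measurable B /\ leb2 B = 0%E)).
  - by split; [exact: measurable0 | exact: measure0].
  - move=> B1 B2 [m1 z1] [m2 z2]; split; first exact: measurableU.
    exact: null_set_setU.
  - by move=> i _; split; [exact: measurable_chart_line | exact: null_chart_line].
apply: (subset_measure0 (B := N)) => //.
move=> p /= Ap; have [i Ei] := sub _ Ap.
by rewrite /N (bigD1 i) //=; left.
Qed.

(** The density is at most 1, so the Lebesgue measure of a square bounds the area. *)
Lemma area_lt_pinfty (A : set 'cV[R]_3) (B : R) : Borel_plane A ->
  (forall x1 x2, A (graph_chart (x1, x2)) -> (0 <= x1 <= B) && (0 <= x2 <= B)) ->
  (area A < +oo)%E.
Proof.
move=> bA sub.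
pose box : set plane := [set` `[0, B]] `*` [set` `[0, B]].
have mbox : measurable box by apply: measurableX; exact: measurable_itv.
apply: (@le_lt_trans _ _ (leb2 box)); last first.
  rewrite /leb2 product_measure1E //; try exact: measurable_itv.
  have [r Er] : exists r, lebesgue_measure [set` `[0, B]] = r%:E :> \bar R.
    by rewrite lebesgue_measure_itv /=; case: ifP => _; [exists (B - 0); rewrite EFinB | exists 0].
  by apply: (@le_lt_trans _ _ (r%:E * r%:E)%E); [rewrite -Er; exact: lexx | rewrite -EFinM ltry].
apply: (@le_trans _ _ (leb2 (graph_chart (R:=R) @^-1` A))); last first.
  apply: le_measure; rewrite ?inE //.
  by move=> [x1 x2] /= /sub /andP[h1 h2]; split; rewrite /= in_itv.
rewrite -[leRHS]mul1e -(integral_cst _ bA); apply: ge0_le_integral => //.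
- by move=> p _; rewrite lee_fin invr_ge0 (le_trans _ (chart_height_ge1 p)).
- exact: measurable_density.
- by move=> p _; rewrite lee_fin invf_le1 ?chart_height_ge1 // (lt_le_trans _ (chart_height_ge1 p)).
Qed.

End Area.

(** * The polytope as a fundamental domain *)

Section FundamentalPolytope.
Variables (R : realType) (m : nat) (e : 'I_m -> 'cV[R]_3).
Hypothesis e_unit : forall i, lorentz (e i) (e i) = 1.
Hypothesis e_gram : forall i j, i != j ->
  [\/ lorentz (e i) (e j) = 0, lorentz (e i) (e j) = - (1 / 2) | lorentz (e i) (e j) <= -1].
Variable p0 : 'cV[R]_3.
Hypotheses (Hp0 : hyperbolic_space p0) (cp0 : open_chamber e p0).

Lemma image_polytope (g : 'M[R]_3) : @isom_hyperbolic R 2 g ->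
  [set g *m x | x in polytope e] = polytope (fun i => g *m e i).
Proof.
move=> hg; have [iso pres] := hg; have [_ presV] := isom_inv hg.
apply/seteqP; split.
- move=> _ [x [Hx cx] <-]; split; first exact: pres.
  by move=> i; rewrite iso.
- move=> y [Hy cy]; exists (invmx g *m y); last first.
    by rewrite mulmxA mulmxV ?mul1mx // isometry_unit.
  by split; [exact: presV | move=> i; rewrite lorentz_inv].
Qed.

Lemma reflection_group_fundamental :
  fundamental_domain (reflection_group e) (polytope e).
Proof.
rewrite reflection_groupE //; split.
- by move=> x [].
- exact: Borel_polytope.
- move=> x Hx; have [w cw] := words_cover e_unit e_gram Hp0 cp0 Hx.
  exists (word_mx e (rev w)); first by exists (rev w).
  exists (word_mx e w *m x) => //.
  rewrite -word_mx_inv // mulmxA mulVmx ?mul1mx //.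
  exact/isometry_unit/word_mx_iso.
- move=> _ [w _ <-] w1; apply: (area_null e_unit).
    rewrite image_polytope; last exact: word_mx_isom.
    by rewrite /Borel_plane preimage_setI; apply: measurableI; exact: Borel_polytope.
  move=> y [cx [x cy Ey]]; rewrite -{}Ey in cx *.
  exact: (chamber_overlap e_unit e_gram cp0 w1 cy cx).
Qed.

Lemma reflection_group_lattice : (area (polytope e) < +oo)%E ->
  is_lattice (reflection_group e).
Proof.
move=> fin; split.
- by rewrite reflection_groupE //; exact: words_subgroup.
- by rewrite reflection_groupE //; exact: (words_discrete e_unit e_gram cp0).
- by exists (polytope e) => //; exact: reflection_group_fundamental.
Qed.

End FundamentalPolytope.

Section QuadLattice.
Variables (R : realType) (u C S D : R).
Hypothesis P : quad_params u C S D.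

Let e := quad_normal C S D.

Lemma quad_area_finite : (area (polytope e) < +oo)%E.
Proof.
have u0 := u_gt0 P; have S0 := qS_gt0 P; have C0 := qC_gt0 P; have D0 := qD_gt0 P.
have wh := quad_width_height P.
set k := 1 - quad_width C S ^+ 2 - quad_height S D ^+ 2.
have k0 : 0 < k by rewrite /k; lra.
apply: (@area_lt_pinfty _ _ (1 + k^-1)); first exact: Borel_polytope.
move=> x1 x2 [Hx cx].
have := Hx; have E : graph_chart (x1, x2) = vec3 (Num.sqrt (1 + x1 ^+ 2 + x2 ^+ 2)) x1 x2 by [].
rewrite {}E in Hx cx *; move: (Num.sqrt _) Hx cx => x0 _ cx.
rewrite hyperbolic_vec3 => -[Nx x00].
have := cx (inord 0); have := cx (inord 1); have := cx (inord 2); have := cx (inord 3).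
rewrite /e !quad_normalE !lorentz_vec3 => c3 c2 c1 c0.
have x1_ge0 : 0 <= x1 by lra.
have x2_ge0 : 0 <= x2 by lra.
have x1_le : x1 <= quad_width C S * x0.
  by rewrite /quad_width mulrAC ler_pdivlMr //; lra.
have x2_le : x2 <= quad_height S D * x0.
  rewrite /quad_height mulrAC ler_pdivlMr ?mulr_gt0 // mul1r.
  have : 2 * S * (x2 * D) <= 2 * S * (x0 * (1 / (2 * S))) by rewrite ler_pM2l ?mulr_gt0 //; lra.
  have -> : 2 * S * (x0 * (1 / (2 * S))) = x0 by field; lra.
  lra.
have b1 : x1 ^+ 2 <= quad_width C S ^+ 2 * x0 ^+ 2.
  by rewrite -exprMn ler_pXn2r ?nnegrE // (le_trans x1_ge0).
have b2 : x2 ^+ 2 <= quad_height S D ^+ 2 * x0 ^+ 2.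
  by rewrite -exprMn ler_pXn2r ?nnegrE // (le_trans x2_ge0).
have kx : k * x0 ^+ 2 <= 1 by rewrite /k; lra.
have x0k : x0 ^+ 2 <= k^-1 by rewrite -[leRHS]mul1r ler_pdivlMr // mulrC.
have bound x : 0 <= x -> x ^+ 2 <= x0 ^+ 2 -> 0 <= x <= 1 + k^-1.
  move=> x_ge0 x_le; rewrite x_ge0 /=.
  have : 0 <= (x - 1 / 2) ^+ 2 by exact: sqr_ge0.
  have -> : (x - 1 / 2) ^+ 2 = x ^+ 2 - x + 1 / 4 by field.
  lra.
have s1 := sqr_ge0 x1; have s2 := sqr_ge0 x2.
by rewrite !bound //; lra.
Qed.

Lemma quad_lattice : is_lattice (reflection_group e).
Proof.
have [p Hp cp] := quad_interior_point P.
apply: (reflection_group_lattice (quad_normal_unit P) (quad_gram_cases P) Hp cp).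
exact: quad_area_finite.
Qed.

End QuadLattice.

(** * Maximality *)

Lemma expr2n_archi (R : realType) (a e : R) : 0 < e -> exists n, a <= 2 ^+ n * e.
Proof.
move=> e0; exists (Num.truncn (a / e)).+1.
have /ltW := truncnS_gt (a / e); rewrite ler_pdivrMr // => /le_trans; apply.
by rewrite ler_pM2r // -natrX ler_nat ltnW // ltn_expl.
Qed.

Section Maximal.
Variables (R : realType) (u C S D : R).
Hypothesis P : quad_params u C S D.
Hypothesis C_nonint : forall r, prime r -> ~ alg_int (r%:R * real_complex R (2 * C)).
Hypothesis CD : C != D.

Let e := quad_normal C S D.

Variable G : set 'M[R]_3.
Hypotheses (Gsub : @is_isom_subgroup R 2 G) (Gdisc : @discrete_subset R 2 G).
Hypothesis subG : reflection_group e `<=` G.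

Let M f0 f1 f2 := lorentz (vec3 f0 f1 f2) (vec3 f0 f1 f2) = 1 /\ G (reflection_mx (vec3 f0 f1 f2)).

Lemma group_isometry g : G g -> is_isometry g.
Proof. by have [sub _ _ _] := Gsub => /sub/isom_isometry. Qed.

Lemma mirror_image (g : 'M[R]_3) f : G g -> lorentz f f = 1 -> G (reflection_mx f) ->
  lorentz (g *m f) (g *m f) = 1 /\ G (reflection_mx (g *m f)).
Proof.
move=> Gg Nf Gf; have [_ _ GM GV] := Gsub; have iso := group_isometry Gg.
by rewrite iso Nf -(reflection_conj _ iso); split=> //; apply: (GM _ _ (GM _ _ Gg Gf) (GV _ Gg)).
Qed.

Lemma mirrors_refl f0 f1 f2 g0 g1 g2 : M f0 f1 f2 -> M g0 g1 g2 ->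
    let s := 2 * (f1 * g1 + f2 * g2 - f0 * g0) in
    M (f0 - s * g0) (f1 - s * g1) (f2 - s * g2).
Proof.
move=> [Nf Gf] [Ng Gg] s; rewrite /M.
have -> : vec3 (f0 - s * g0) (f1 - s * g1) (f2 - s * g2) =
    reflection_mx (vec3 g0 g1 g2) *m vec3 f0 f1 f2.
  rewrite reflection_mxE lorentz_vec3 vec3Z vec3B /s; congr vec3; ring.
exact: mirror_image.
Qed.

Lemma mirrors_side i : lorentz (e i) (e i) = 1 /\ G (reflection_mx (e i)).
Proof.
split; first exact: (quad_normal_unit P).
apply: subG; rewrite reflection_groupE; last exact: (quad_normal_unit P).
by exists [:: i] => //; rewrite word_mx_cons word_mx_nil mulmx1.
Qed.

Lemma mirrors_opp f0 f1 f2 : M f0 f1 f2 -> M (- f0) (- f1) (- f2).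
Proof.
by move=> [Nf Gf]; rewrite /M -vec3N lorentzNl lorentzNr opprK reflection_mxN.
Qed.

Lemma mirrors_sparse sh ch : M sh ch 0 -> M (C * sh + S * ch) (C * ch + S * sh) 0 ->
  M (C * sh - S * ch) (C * ch - S * sh) 0 -> frame_sparse C S M sh ch.
Proof.
move=> [N0 G0] [N1 G1] [N2 G2] f0 f1 f2 [Nf Gf] p q p0 pb p1b p2b.
have := mirror_angle Gsub Gdisc Nf N0 Gf G0; have := mirror_angle Gsub Gdisc Nf N1 Gf G1.
have := mirror_angle Gsub Gdisc Nf N2 Gf G2; rewrite !lorentz_vec3.
have -> : - (f0 * sh) + f1 * ch + f2 * 0 = p by rewrite /p; ring.
have -> : - (f0 * (C * sh + S * ch)) + f1 * (C * ch + S * sh) + f2 * 0 = C * p - S * q.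
  by rewrite /p /q; ring.
have -> : - (f0 * (C * sh - S * ch)) + f1 * (C * ch - S * sh) + f2 * 0 = C * p + S * q.
  by rewrite /p /q; ring.
move=> /(_ p2b) c2 /(_ p1b) c1 /(_ pb) c0.
have [] := @cosine_like_ratio _ (real_complex R (2 * C)) _ _ _ c1 c0 c2.
- by rewrite fmorph_eq0 mulf_neq0.
- by rewrite -rmorphM -rmorphD; congr (real_complex R _); ring.
- by move=> r pr; apply: C_nonint.
Qed.

Lemma mirrors_system : mirror_system u C S D M.
Proof.
have S2 := qS2 P; have C2 := qC2 P.
have Ma : M 0 (-1) 0 by have := mirrors_side (inord 0); rewrite /e quad_normalE.
have Mb : M 0 0 (-1) by have := mirrors_side (inord 1); rewrite /e quad_normalE.
have Mc : M S C 0 by have := mirrors_side (inord 2); rewrite /e quad_normalE.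
have Md : M (1 / (2 * S)) 0 D by have := mirrors_side (inord 3); rewrite /e quad_normalE.
have M0 : M 0 1 0 by have := mirrors_opp Ma; congr M; ring.
have flip f0 f1 : M f0 f1 0 -> M (- f0) f1 0.
  by move=> Mf; have := mirrors_opp (mirrors_refl Mf Ma) => /=; congr M; ring.
(* n_2 and n_3 are the images of n_0 and n_(-1) in the third side, up to sign. *)
have M2 : M (2 * S * C) (1 + 2 * u) 0.
  by have := mirrors_opp (mirrors_refl M0 Mc) => /=; congr M; [ring | ring: C2 | ring].
have M3 : M (C * (2 * S * C) + S * (1 + 2 * u)) (C * (1 + 2 * u) + S * (2 * S * C)) 0.
  have := mirrors_opp (mirrors_refl (flip _ _ Mc) Mc) => /=.
  by congr M; [ring: C2 S2 | ring: C2 S2 | ring].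
split.
- by move=> f0 f1 f2 [Nf _]; rewrite -Nf lorentz_vec3; ring.
- exact: mirrors_refl.
- exact: Ma.
- exact: Mb.
- exact: Mc.
- exact: Md.
- apply: mirrors_sparse; first exact: flip.
  + by have := M0; congr M; [ring | ring: C2 S2].
  + by have := flip _ _ M2; congr M; [ring | ring: C2 S2].
- apply: mirrors_sparse => //.
  + by have := Mc; congr M; ring.
  + by have := flip _ _ Mc; congr M; ring.
- apply: mirrors_sparse => //.
  + by have := M2; congr M; [ring | ring: C2 S2].
  + by have := M0; congr M; [ring | ring: C2 S2].
- apply: mirrors_sparse => //.
  by have := Mc; congr M; [ring: C2 S2 | ring: C2 S2].
Qed.

(** The open chamber is a cone in the ambient space. Since the corners of the quadrilateral are not
    at infinity, it lies inside the light cone and can be scaled to the hyperboloid. *)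
Lemma chamber_normalize x : open_chamber e x ->
  exists2 k, 0 < k & @hyperbolic_space R 2 (k *: x).
Proof.
have S0 := qS_gt0 P; have C0 := qC_gt0 P; have D0 := qD_gt0 P.
have wh := quad_width_height P.
have [x0 [x1 [x2 ->]]] := vec3P x => cx.
have := cx (inord 0); have := cx (inord 1); have := cx (inord 2); have := cx (inord 3).
rewrite /e !quad_normalE !lorentz_vec3 => c3 c2 c1 c0.
have x1_gt0 : 0 < x1 by lra.
have x2_gt0 : 0 < x2 by lra.
have Cx1 : 0 < x1 * C by rewrite mulr_gt0.
have x0_gt0 : 0 < x0 by rewrite -(pmulr_lgt0 _ S0); lra.
have x1_le : x1 <= quad_width C S * x0.
  by rewrite /quad_width mulrAC ler_pdivlMr //; lra.
have x2_le : x2 <= quad_height S D * x0.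
  rewrite /quad_height mulrAC ler_pdivlMr ?mulr_gt0 // mul1r.
  have : 2 * S * (x2 * D) <= 2 * S * (x0 * (1 / (2 * S))) by rewrite ler_pM2l ?mulr_gt0 //; lra.
  have -> : 2 * S * (x0 * (1 / (2 * S))) = x0 by field; lra.
  lra.
have b1 : x1 ^+ 2 <= quad_width C S ^+ 2 * x0 ^+ 2.
  by rewrite -exprMn ler_pXn2r ?nnegrE ?(le_trans (ltW x1_gt0)) // ltW.
have b2 : x2 ^+ 2 <= quad_height S D ^+ 2 * x0 ^+ 2.
  by rewrite -exprMn ler_pXn2r ?nnegrE ?(le_trans (ltW x2_gt0)) // ltW.
have b3 : (quad_width C S ^+ 2 + quad_height S D ^+ 2) * x0 ^+ 2 < x0 ^+ 2.
  by rewrite gtr_pMl // exprn_gt0.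
have vv : lorentz (vec3 x0 x1 x2) (vec3 x0 x1 x2) < 0 by rewrite lorentz_vec3 -!expr2; lra.
have [k k0 Hk] := timelike_normalize vv; exists k => //.
by case: Hk => _; rewrite vec3Z vec3_0 pmulr_lgt0.
Qed.

Lemma no_mirror_in_chamber f x : lorentz f f = 1 -> G (reflection_mx f) ->
  open_chamber e x -> lorentz x f <> 0.
Proof.
move=> Nf Gf cx; have [k k0 Hk] := chamber_normalize cx => xf.
have {cx} : open_chamber e (k *: x) by move=> i; rewrite lorentzZl pmulr_rlt0.
have {xf} : lorentz (k *: x) f = 0 by rewrite lorentzZl xf mulr0.
move: (k *: x) Hk => y; have [x0 [x1 [x2 ->]]] := vec3P y.
have [f0 [f1 [f2 Ef]]] := vec3P f; rewrite {}Ef in Nf Gf *.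
rewrite hyperbolic_vec3 lorentz_vec3 => -[Nx x0_gt0] xf cx.
have := cx (inord 0); have := cx (inord 1); have := cx (inord 2); have := cx (inord 3).
rewrite /e !quad_normalE !lorentz_vec3 => c3 c2 c1 c0.
have X : quad_point C S D x0 x1 x2 by split => //; lra.
apply: (no_mirror_meets P mirrors_system X (f0 := f0) (f1 := f1) (f2 := f2)).
- by move=> eps; exact: expr2n_archi.
- by split.
- by lra.
Qed.

Section ChamberMap.
Variables (h : 'M[R]_3) (p : 'cV[R]_3).
Hypotheses (Gh : G h) (cp : open_chamber e p) (chp : forall i, lorentz (h *m p) (e i) <= 0).

(** If [h] sent [p] and [x] to different sides of a mirror, a positive combination of them would lie
    on the preimage of that mirror, which is a mirror of [G] meeting the chamber. *)
Lemma chamber_map_open x : open_chamber e x -> open_chamber e (h *m x).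
Proof.
move=> cx i; have [_ _ _ GV] := Gsub; have iso := group_isometry Gh.
have [Ni Gi] := mirrors_side i.
have [Nf Gf] := mirror_image (GV _ Gh) Ni Gi.
have nz y : open_chamber e y -> lorentz (h *m y) (e i) <> 0.
  move=> cy; rewrite lorentzC -lorentz_inv // lorentzC.
  exact: no_mirror_in_chamber.
have hp : lorentz (h *m p) (e i) < 0.
  by rewrite lt_neqAle chp andbT; apply/eqP/nz.
rewrite ltNge; apply/negP => hx.
have [hx0|hx0] := eqVneq (lorentz (h *m x) (e i)) 0; first exact: (nz x).
have {}hx : 0 < lorentz (h *m x) (e i) by rewrite lt_neqAle eq_sym hx0.
apply: (nz (lorentz (h *m x) (e i) *: p + (- lorentz (h *m p) (e i)) *: x)).
  move=> j; rewrite lorentzDl !lorentzZl; have h1 := cp j; have h2 := cx j.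
  have : lorentz (h *m x) (e i) * lorentz p (e j) < 0 by rewrite pmulr_rlt0.
  have : - lorentz (h *m p) (e i) * lorentz x (e j) < 0 by rewrite pmulr_rlt0 // oppr_gt0.
  lra.
by rewrite mulmxDr -!scalemxAr lorentzDl !lorentzZl; ring.
Qed.

End ChamberMap.

Section ChamberSymmetry.
Variables (h : 'M[R]_3) (p : 'cV[R]_3).
Hypotheses (Gh : G h) (cp : open_chamber e p) (chp : forall i, lorentz (h *m p) (e i) <= 0).

Lemma chamber_map_inv x : open_chamber e x -> open_chamber e (invmx h *m x).
Proof.
have [_ _ _ GV] := Gsub; have iso := group_isometry Gh.
have chp' := chamber_map_open Gh cp chp cp.
apply: (chamber_map_open (GV _ Gh) chp') => i.
rewrite mulmxA mulVmx ?mul1mx; last exact: isometry_unit. exact: ltW.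
Qed.

Lemma chamber_side_neg j y : (forall l, lorentz y (e l) <= 0) -> lorentz y (h *m e j) <= 0.
Proof.
have iso := group_isometry Gh.
move=> cy; rewrite leNgt; apply/negP => pos.
have c0 : 0 <= `|lorentz p (h *m e j)| by rewrite normr_ge0.
set b := `|lorentz p (h *m e j)| in c0.
pose t := lorentz y (h *m e j) / (1 + b).
have t0 : 0 < t by rewrite divr_gt0 // ltr_pwDl.
have : open_chamber e (y + t *: p).
  move=> l; rewrite lorentzDl lorentzZl; have := cy l.
  have : t * lorentz p (e l) < 0 by rewrite pmulr_rlt0.
  lra.
move/chamber_map_inv/(_ j); rewrite lorentz_inv // lorentzDl lorentzZl.
have : - (t * b) <= t * lorentz p (h *m e j).
  by rewrite -mulrN ler_pM2l // lerNl ler_normr lexx orbT.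
have -> : lorentz y (h *m e j) = t * (1 + b) by rewrite /t divfK // gt_eqF // ltr_pwDl.
lra.
Qed.

(** At a point x on side i alone some [h *m e j] vanishes. It has a constant sign on the chamber,
    and moving from x both ways along the side makes it vanish on the whole side; so it is a
    multiple of e_i, and norm and sign make the factor 1. *)
Lemma chamber_side_image i : exists j, h *m e j = e i.
Proof.
have iso := group_isometry Gh.
have [_ _ /(_ i)[x [Hx st]]] := quad_is_polytope P.
have xi : lorentz x (e i) = 0 by have := st i; rewrite finset.inE eqxx.
have xj j : j != i -> lorentz x (e j) < 0 by move=> ji; have := st j; rewrite finset.inE (negPf ji).
have xle j : lorentz x (e j) <= 0.
  by have [->|/xj/ltW] := eqVneq j i; rewrite ?xi.
have [j xhj] : exists j, lorentz x (h *m e j) = 0.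
  apply: contrapT => no0.
  have : open_chamber e (invmx h *m x).
    move=> j; rewrite lorentz_inv // lt_neqAle chamber_side_neg // andbT.
    by apply/eqP => E; apply: no0; exists j.
  move/(chamber_map_open Gh cp chp)/(_ i); rewrite mulmxA mulmxV ?isometry_unit // mul1mx xi.
  by rewrite ltxx.
have perp v : lorentz v (e i) = 0 -> lorentz v (h *m e j) = 0.
  move=> vi.
  have [eps eps0 epsP] : exists2 eps, 0 < eps & forall l,
      eps <= (if l == i then 1 else - lorentz x (e l) / (1 + `|lorentz v (e l)|)).
    apply: finite_pos_lb => l; case: eqVneq => [_ //|li].
    by rewrite divr_gt0 ?oppr_gt0 ?xj // ltr_pwDl.
  have le0 s : `|s| = eps -> s * lorentz v (h *m e j) <= 0.
    move=> s_eps; have := @chamber_side_neg j (x + s *: v).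
    rewrite lorentzDl xhj add0r lorentzZl; apply => l.
    rewrite lorentzDl lorentzZl; have := epsP l.
    case: (eqVneq l i) => [->|li]; first by rewrite xi vi mulr0 addr0.
    rewrite ler_pdivlMr ?ltr_pwDl // mulrDr mulr1.
    have : s * lorentz v (e l) <= eps * `|lorentz v (e l)|.
      by rewrite -s_eps -normrM ler_norm.
    lra.
  have h1 := le0 eps (gtr0_norm eps0).
  have := le0 (- eps); rewrite normrN => /(_ (gtr0_norm eps0)); rewrite mulNr => h2.
  apply/eqP; rewrite -(mulrI_eq0 _ (mulfI (lt0r_neq0 eps0))).
  by rewrite eq_le h1 -oppr_le0.
exists j; have Ni := quad_normal_unit P i.
set c := lorentz (e i) (h *m e j).
have E : h *m e j = c *: e i.
  apply: lorentz_nondeg => w; rewrite lorentzZr.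
  have := perp (w - lorentz w (e i) *: e i).
  rewrite !lorentzBl !lorentzZl Ni mulr1 subrr => /(_ erefl) /eqP.
  by rewrite subr_eq0 => /eqP ->; rewrite mulrC.
have c2 : c ^+ 2 = 1.
  have := iso (e j) (e j); rewrite (quad_normal_unit P j) E lorentzZl lorentzZr Ni mulr1.
  by rewrite expr2.
have c_neg : 0 <= c.
  have := chamber_side_neg j (fun l => ltW (cp l)); rewrite E lorentzZr.
  by rewrite nmulr_lle0 // cp.
have c1 : c = 1 by apply/eqP; rewrite -(@eqrXn2 _ 2) // c2 expr1n.
by rewrite E c1 scale1r.
Qed.

Lemma gram_half_pair (i j : 'I_4) : quad_gram_table C D i j = - (1 / 2) ->
  (i = inord 2 /\ j = inord 3) \/ (i = inord 3 /\ j = inord 2).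
Proof.
have [C1 _] := C_bounds P; have D1 := quad_D_ge P.
move: j; move: i; apply: ord4P; apply: ord4P; rewrite /quad_gram_table !inordK //= => E.
all: try (by left); try (by right).
all: exfalso; lra.
Qed.

Lemma gram_C (i : 'I_4) : quad_gram_table C D i 2 = - C -> i = inord 0.
Proof.
have [C1 _] := C_bounds P; have D1 := quad_D_ge P.
by move: i; apply: ord4P => //; rewrite /quad_gram_table !inordK //= => E; exfalso; lra.
Qed.

Lemma gram_D (i : 'I_4) : quad_gram_table C D i 3 = - D -> i = inord 1.
Proof.
have [C1 _] := C_bounds P; have D1 := quad_D_ge P.
by move: i; apply: ord4P => //; rewrite /quad_gram_table !inordK //= => E; exfalso; lra.
Qed.

Lemma gram_not_C (i : 'I_4) : quad_gram_table C D i 3 <> - C.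
Proof.
have [C1 _] := C_bounds P; have D1 := quad_D_ge P.
move: i; apply: ord4P; rewrite /quad_gram_table !inordK //= => E; [lra | | lra | lra].
by move/eqP: CD; apply; apply: oppr_inj.
Qed.

(** The permutation of the sides preserves the Gram matrix, hence the one angle pi / 3. Its two
    sides cannot be exchanged, since their distances to the opposite sides have the different cosh C
    and D. The fixed normals span the space. *)
Lemma chamber_symmetry_trivial : h = 1%:M.
Proof.
have [sg sgP] := choice chamber_side_image.
have G_eq i j : quad_gram_table C D (sg i) (sg j) = quad_gram_table C D i j.
  by rewrite -!(quad_gram P) -/e -[in RHS](sgP i) -[in RHS](sgP j) (group_isometry Gh).
have G23 : quad_gram_table C D (sg (inord 2)) (sg (inord 3)) = - (1 / 2).
  by rewrite G_eq /quad_gram_table !inordK.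
have G02 : quad_gram_table C D (sg (inord 0)) (sg (inord 2)) = - C.
  by rewrite G_eq /quad_gram_table !inordK.
have G13 : quad_gram_table C D (sg (inord 1)) (sg (inord 3)) = - D.
  by rewrite G_eq /quad_gram_table !inordK.
case: (gram_half_pair G23) => -[E2 E3]; last first.
  by case: (@gram_not_C (sg (inord 0))); rewrite -G02 E2 inordK.
have E0 : sg (inord 0) = inord 0 by apply: gram_C; rewrite -G02 E2 inordK.
have E1 : sg (inord 1) = inord 1 by apply: gram_D; rewrite -G13 E3 inordK.
have := sgP (inord 0); have := sgP (inord 1); have := sgP (inord 2).
rewrite E0 E1 E2 /e !quad_normalE => h2 h1 h0.
have S0 := qS_gt0 P; have hv (v : 'cV[R]_3) : h *m v = v.
  have [a [b [c ->]]] := vec3P v.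
  have -> : vec3 a b c = (a / S) *: vec3 S C 0 + (a / S * C - b) *: vec3 0 (-1) 0
      + (- c) *: vec3 0 0 (-1).
    by rewrite !vec3Z !vec3D; congr vec3; field; lra.
  by rewrite !mulmxDr -!scalemxAr h0 h1 h2.
by apply/matrixP => i j; have := hv (delta_mx j 0); rewrite -colE => /matrixP/(_ i 0); rewrite !mxE eqxx andbT.
Qed.

End ChamberSymmetry.

Lemma reflection_group_maximal : G = reflection_group e.
Proof.
have e1 := quad_normal_unit P; have eg := quad_gram_cases P.
apply/seteqP; split=> // g Gg.
have [p Hp cp] := quad_interior_point P.
have Hgp : hyperbolic_space (g *m p).
  by have [sub _ _ _] := Gsub; have [_] := sub _ Gg; apply.
have [w [_ cw]] := words_cover e1 eg Hp cp Hgp.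
have Gw : G (word_mx e w) by apply: subG; rewrite reflection_groupE //; exists w.
have [_ _ GM _] := Gsub.
have h1 : word_mx e w *m g = 1%:M.
  apply: (chamber_symmetry_trivial (GM _ _ Gw Gg) cp) => i.
  by rewrite -mulmxA.
rewrite reflection_groupE //; exists (rev w) => //.
rewrite -word_mx_inv // -[RHS]mul1mx -(mulVmx (isometry_unit (word_mx_iso e1 w))).
by rewrite -mulmxA h1 mulmx1.
Qed.

End Maximal.

(** * The adjoint trace field *)

Section AdjointTrace.
Variables (R : realType) (n : nat).

Let J := lorentz_mx R n.

(** so(n,1) is the fixed space of the involution sending X to - J X^T J; this is the average of X
    and its image. *)
Definition lie_proj (X : 'M[R]_n.+1) : 'M[R]_n.+1 := 2^-1 *: (X - J *m X^T *m J).

Lemma lie_proj_linear : linear lie_proj.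
Proof.
move=> a X Y; rewrite /lie_proj linearP /= mulmxDr mulmxDl -scalemxAr -scalemxAl.
by apply/matrixP => i j; rewrite !mxE; ring.
Qed.

Lemma lie_proj_mem X : lie_proj X \in lie_algebra R n.
Proof.
rewrite mem_lie_algebra /lie_proj -/J linearZ /= linearB /= !trmx_mul trmxK.
rewrite lorentz_mx_trmx -/J -scalemxAl -scalemxAr -scalerDr mulmxBl mulmxBr.
rewrite -!mulmxA lorentz_mx_invol mulmx1 !mulmxA lorentz_mx_invol mul1mx.
by rewrite -opprB addNr scaler0.
Qed.

Lemma lie_proj_id X : X \in lie_algebra R n -> lie_proj X = X.
Proof.
rewrite mem_lie_algebra -/J addr_eq0 => /eqP E.
rewrite /lie_proj -mulmxA E mulmxN mulmxA lorentz_mx_invol mul1mx opprK.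
by rewrite -mulr2n -[X *+ 2]scaler_nat scalerA mulVf ?scale1r // pnatr_eq0.
Qed.

Lemma adjoint_lie (g X : 'M[R]_n.+1) : is_isometry g -> X \in lie_algebra R n ->
  adjoint g X \in lie_algebra R n.
Proof.
move=> iso; rewrite !mem_lie_algebra -/J !addr_eq0 => /eqP E.
rewrite /adjoint (isometry_inv iso) -/J !trmx_mul trmxK lorentz_mx_trmx -/J.
have JJ A : J *m (J *m A) = A by rewrite mulmxA lorentz_mx_invol mul1mx.
have -> : X^T = - (J *m X *m J).
  by rewrite -[LHS]mulmx1 -lorentz_mx_invol mulmxA -/J E mulNmx.
by rewrite mulNmx !mulmxN !mulNmx -!mulmxA !JJ.
Qed.

(* [lie_proj] is a projection onto the Lie algebra, so the trace of [Ad g] is the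
   trace of [Ad g] composed with [lie_proj] on all matrices. *)
Lemma adjoint_trace_proj (g : 'M[R]_n.+1) : is_isometry g ->
  adjoint_trace g = \sum_i \sum_j (adjoint g (lie_proj (delta_mx i j))) i j.
Proof.
move=> iso; pose Pi : {linear 'M[R]_n.+1 -> 'M[R]_n.+1} :=
  HB.pack lie_proj (GRing.isLinear.Build _ _ _ _ lie_proj lie_proj_linear).
set X := vbasis (lie_algebra R n).
have Xmem (i : 'I_(\dim (lie_algebra R n))) : X`_i \in lie_algebra R n.
  by apply: vbasis_mem; apply: mem_nth; rewrite size_tuple.
have expand i j : adjoint g (lie_proj (delta_mx i j)) =
    \sum_k coord X k (lie_proj (delta_mx i j)) *: adjoint g X`_k.
  rewrite {1}(coord_vbasis (lie_proj_mem (delta_mx i j))) /adjoint.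
  rewrite mulmx_sumr mulmx_suml; apply: eq_bigr => k _.
  by rewrite -scalemxAr -scalemxAl.
have -> : \sum_i \sum_j (adjoint g (lie_proj (delta_mx i j))) i j =
    \sum_k \sum_i \sum_j coord X k (lie_proj (delta_mx i j)) * (adjoint g X`_k) i j.
  rewrite exchange_big /=; under eq_bigr => j _.
    under eq_bigr => i _ do rewrite expand summxE.
    rewrite exchange_big /=; over.
  rewrite exchange_big /=; apply: eq_bigr => k _.
  rewrite exchange_big /=; apply: eq_bigr => i _; apply: eq_bigr => j _.
  by rewrite mxE.
rewrite /adjoint_trace -/X; apply: eq_bigr => k _.
have Ymem := adjoint_lie iso (Xmem k); move: (adjoint g X`_k) Ymem => Y Ymem.
rewrite -{1}(lie_proj_id Ymem) {1}(matrix_sum_delta Y).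
rewrite -[lie_proj]/(Pi : _ -> _) linear_sum linear_sum; apply: eq_bigr => i _.
rewrite linear_sum linear_sum; apply: eq_bigr => j _.
have PZ a Z : Pi (a *: Z) = a *: Pi Z by exact: linearZ.
by rewrite PZ; move: (Pi _) => W; rewrite linearZ /= mulrC.
Qed.

(** The adjoint representation is the exterior square of the standard one, and the right-hand side
    is the character of an exterior square. *)
Lemma adjoint_traceE (g : 'M[R]_n.+1) : is_isometry g ->
  adjoint_trace g = 2^-1 * ((\tr g) ^+ 2 - \tr (g *m g)).
Proof.
move=> iso; rewrite adjoint_trace_proj //.
have trV : \tr (invmx g) = \tr g.
  rewrite (isometry_inv iso) mxtrace_mulC mulmxA lorentz_mx_invol mul1mx.
  exact: mxtrace_tr.
have E i j : (adjoint g (lie_proj (delta_mx i j))) i j =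
    2^-1 * (g i i * invmx g j j - g i j * g j i).
  rewrite /adjoint /lie_proj -scalemxAr -scalemxAl mxE; congr (_ * _).
  rewrite mulmxBr mulmxBl mxE [X in _ + X]mxE; congr (_ - _).
    rewrite mxE (bigD1 j) //= [X in _ + X]big1 ?addr0 => [|k kj].
      rewrite mxE (bigD1 i) //= [X in _ + X]big1 ?addr0 => [|k ki].
        by rewrite mxE !eqxx mulr1.
      by rewrite mxE (negPf ki) mulr0.
    rewrite mxE big1 ?mul0r // => l _.
    by rewrite mxE (negPf kj) andbF mulr0.
  rewrite (isometry_inv iso) -/J trmx_delta.
  have -> : g *m (J *m delta_mx j i *m J) *m (J *m g^T *m J) =
      (g *m J) *m delta_mx j i *m (g^T *m J).
    by rewrite -!mulmxA (mulmxA J J) lorentz_mx_invol mul1mx.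
  rewrite mxE (bigD1 i) //= [X in _ + X]big1 ?addr0 => [|k ki].
    rewrite mxE (bigD1 j) //= [X in _ + X]big1 ?addr0 => [|k kj].
      rewrite [delta_mx _ _ _ _]mxE !eqxx mulr1 /J /lorentz_mx !mul_mx_diag !mxE.
      by rewrite mulrACA; case: ifP => _; rewrite ?mulrNN !mulr1.
    by rewrite [delta_mx _ _ _ _]mxE (negPf kj) mulr0.
  rewrite mxE big1 ?mul0r // => l _.
  by rewrite [delta_mx _ _ _ _]mxE (negPf ki) andbF mulr0.
under eq_bigr => i _ do under eq_bigr => j _ do rewrite E.
under eq_bigr => i _ do rewrite -mulr_sumr sumrB -mulr_sumr.
rewrite -mulr_sumr sumrB -mulr_suml; congr (_ * (_ - _)).
  by rewrite -[X in _ * X]/(\tr (invmx g)) trV expr2.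
by rewrite /mxtrace; apply: eq_bigr => i _; rewrite mxE.
Qed.

End AdjointTrace.

(** * Subfields of the reals and traces of matrices conjugate into them *)

Section Subfields.
Variable R : realType.
Implicit Type F : set R.

Lemma field_generated_subfield (A : set R) : is_subfield (field_generated A).
Proof.
split.
- by move=> F [[F1 _ _] _].
- by move=> x y xA yA F HF; have [[_ FB _] _] := HF; apply: FB; [exact: xA | exact: yA].
- by move=> x y xA yA F HF; have [[_ _ FV] _] := HF; apply: FV; [exact: xA | exact: yA].
Qed.

Lemma field_generated_min (A F : set R) : is_subfield F -> A `<=` F -> field_generated A `<=` F.
Proof. by move=> sF AF x; apply; split. Qed.

Lemma sub_field_generated (A : set R) : A `<=` field_generated A.
Proof. by move=> x Ax F [_]; apply. Qed.

Variable F : set R.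
Hypothesis sF : is_subfield F.

Lemma subfield1 : F 1. Proof. by case: sF. Qed.
Lemma subfieldB x y : F x -> F y -> F (x - y). Proof. by case: sF => _ H _; apply: H. Qed.
Lemma subfieldV_div x y : F x -> F y -> F (x / y). Proof. by case: sF => _ _; apply. Qed.
Lemma subfield0 : F 0. Proof. by rewrite -(subrr 1); apply: subfieldB; exact: subfield1. Qed.
Lemma subfieldN x : F x -> F (- x).
Proof. by move=> Fx; rewrite -sub0r; apply: subfieldB => //; exact: subfield0. Qed.
Lemma subfieldD x y : F x -> F y -> F (x + y).
Proof. by move=> Fx Fy; rewrite -[y]opprK; apply: subfieldB => //; exact: subfieldN. Qed.
Lemma subfieldV x : F x -> F x^-1.
Proof. by move=> Fx; rewrite -div1r; apply: subfieldV_div => //; exact: subfield1. Qed.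
Lemma subfieldM x y : F x -> F y -> F (x * y).
Proof. by move=> Fx Fy; rewrite -[y]invrK; apply: subfieldV_div => //; exact: subfieldV. Qed.
Lemma subfield_nat n : F n%:R.
Proof.
elim: n => [|n IHn]; first exact: subfield0.
by rewrite -natr1; apply: subfieldD => //; exact: subfield1.
Qed.
Lemma subfieldX x n : F x -> F (x ^+ n).
Proof.
move=> Fx; elim: n => [|n IHn]; first exact: subfield1.
by rewrite exprS; apply: subfieldM.
Qed.
Lemma subfield_sum (I : Type) (r : seq I) (P : pred I) (f : I -> R) :
  (forall i, P i -> F (f i)) -> F (\sum_(i <- r | P i) f i).
Proof. by move=> Ff; apply: big_ind => //; [exact: subfield0 | exact: subfieldD]. Qed.

End Subfields.

Section ConjugateField.
Variables (R : realType) (F : set R).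
Hypothesis sF : is_subfield F.
Variable T : 'I_3 -> R.
Hypothesis T_neq0 : forall i, T i != 0.

(* [diag(T)^-1 g diag(T)] has entries in [F]. *)
Definition conj_over (g : 'M[R]_3) := forall i j, F (g i j * T j / T i).

Lemma conj_over1 : conj_over 1%:M.
Proof.
move=> i j; rewrite mxE; have [->|_] := eqVneq i j.
  by rewrite mul1r mulfV //; exact: (subfield1 sF).
by rewrite !mul0r; exact: (subfield0 sF).
Qed.

Lemma conj_overM g h : conj_over g -> conj_over h -> conj_over (g *m h).
Proof.
move=> Fg Fh i j; rewrite mxE !mulr_suml; apply: (subfield_sum sF) => k _.
have -> : g i k * h k j * T j / T i = (g i k * T k / T i) * (h k j * T j / T k).
  by field; rewrite !T_neq0.
exact: (subfieldM sF).
Qed.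

(** A reflection involves its normal only through e e^T, so the two factors may be rescaled by [c]
    and its inverse. *)
Lemma conj_over_reflection (e : 'cV[R]_3) c : c != 0 -> (forall i, F (c * e i 0 / T i)) ->
  (forall i, F (e i 0 * T i / c)) -> conj_over (reflection_mx e).
Proof.
move=> c0 F1 F2 i j; rewrite /reflection_mx /lorentz_mx -mulmxA mul_mx_diag !mxE.
rewrite big_ord1 !mxE.
have -> : ((i == j)%:R - 2 * (e i 0 * (e j 0 * (if j == 0 then -1 else 1)))) * T j / T i =
    (1%:M : 'M[R]_3) i j * T j / T i -
    2 * (c * e i 0 / T i) * (e j 0 * T j / c) * (if j == 0 then -1 else 1).
  by rewrite mxE; field; rewrite ?c0 ?T_neq0.
apply: (subfieldB sF); first exact: conj_over1.
apply: (subfieldM sF); last first.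
  by case: ifP => _; [apply: (subfieldN sF) |]; exact: (subfield1 sF).
by do 2!apply: (subfieldM sF) => //; exact: (subfield_nat sF 2).
Qed.

Lemma conj_over_trace g : conj_over g -> F (\tr g).
Proof.
move=> Fg; apply: (subfield_sum sF) => i _.
by have := Fg i i; rewrite mulfK.
Qed.

End ConjugateField.

Section QuadField.
Variables (R : realType) (u C S D : R).
Hypothesis P : quad_params u C S D.
Let e := quad_normal C S D.

(** Conjugation by diag(S, C, D) brings all four reflections into matrices over any field containing
    u. *)
Lemma quad_trace_field w (F : set R) : is_subfield F -> F u -> F (adjoint_trace (word_mx e w)).
Proof.
move=> sF Fu; rewrite adjoint_traceE; last exact/word_mx_iso/(quad_normal_unit P).
have S0 := qS_gt0 P; have C0 := qC_gt0 P; have D0 := qD_gt0 P; have u0 := u_gt0 P.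
pose T (i : 'I_3) := [:: S; C; D]`_i.
have T0 i : T i != 0 by rewrite /T; case: i => [[|[|[|i]]] //= _]; rewrite gt_eqF.
have F1 := subfield1 sF; have F0 := subfield0 sF; have FN1 := subfieldN sF F1.
have F2 := subfield_nat sF 2; have Fhalf := subfieldV sF F2.
have FC2 : F (C * C) by rewrite -expr2 (qC2 P); exact: (subfieldD sF).
have FS2 : F (S * S) by rewrite -expr2 (qS2 P).
have FD2 : F (D * D).
  have -> : D * D = 1 + (4 * u)^-1.
    by apply: (@mulfI _ (4 * u)); [lra | rewrite -expr2 (qD2 P); field; lra].
  apply: (subfieldD sF) => //; apply: (subfieldV sF); apply: (subfieldM sF) => //.
  exact: (subfield_nat sF 4).
have gen : forall i, conj_over F T (reflection_mx (e i)).
  apply: ord4P; rewrite /e quad_normalE.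
  - apply: (@conj_over_reflection _ _ sF _ T0 _ C); first by rewrite gt_eqF.
      by move=> [[|[|[|i]]] //= lt]; rewrite mxE /T /= ?mulr0 ?mul0r //;
        rewrite mulrN1 mulNr mulfV ?gt_eqF.
    by move=> [[|[|[|i]]] //= lt]; rewrite mxE /T /= ?mulr0 ?mul0r //;
        rewrite mulN1r mulNr mulfV ?gt_eqF.
  - apply: (@conj_over_reflection _ _ sF _ T0 _ D); first by rewrite gt_eqF.
      by move=> [[|[|[|i]]] //= lt]; rewrite mxE /T /= ?mulr0 ?mul0r //;
        rewrite mulrN1 mulNr mulfV ?gt_eqF.
    by move=> [[|[|[|i]]] //= lt]; rewrite mxE /T /= ?mulr0 ?mul0r //;
        rewrite mulN1r mulNr mulfV ?gt_eqF.
  - apply: (@conj_over_reflection _ _ sF _ T0 _ 1); first exact: oner_neq0.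
      by move=> [[|[|[|i]]] //= lt]; rewrite mxE /T /= ?mulr0 ?mul0r // mul1r mulfV ?gt_eqF.
    by move=> [[|[|[|i]]] //= lt]; rewrite mxE /T /= ?mul0r // divr1.
  - apply: (@conj_over_reflection _ _ sF _ T0 _ 1); first exact: oner_neq0.
      move=> [[|[|[|i]]] //= lt]; rewrite mxE /T /= ?mulr0 ?mul0r //.
        have -> : 1 * (1 / (2 * S)) / S = (2 * (S * S))^-1 by field; lra.
        by apply: (subfieldV sF); exact: (subfieldM sF).
      by rewrite mul1r mulfV ?gt_eqF.
    move=> [[|[|[|i]]] //= lt]; rewrite mxE /T /= ?mul0r // divr1 //.
    by have -> : 1 / (2 * S) * S = 2^-1 by field; lra.
have FW : conj_over F T (word_mx e w).
  elim: w => [|i w IHw]; first by rewrite word_mx_nil; exact: conj_over1.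
  by rewrite word_mx_cons; exact: conj_overM.
apply: (subfieldM sF) => //; apply: (subfieldB sF).
  by apply: (subfieldX sF); exact: (conj_over_trace sF T0).
by apply: (conj_over_trace sF T0); exact: conj_overM.
Qed.

(** The product of the reflections in the first and third sides is a translation by 2 arcosh C; its
    trace puts u into the field of definition. *)
Lemma quad_trace_ac :
  adjoint_trace (word_mx e [:: inord 0; inord 2]) = 3 + 4 * u.
Proof.
rewrite adjoint_traceE; last exact/word_mx_iso/(quad_normal_unit P).
rewrite !word_mx_cons word_mx_nil mulmx1 /e !quad_normalE.
set g := _ *m _.
have gE i j : g i j = nth 0 (nth [::] [:: [:: 1 + 2 * u; - (2 * S * C); 0];
    [:: - (2 * S * C); 1 + 2 * u; 0]; [:: 0; 0; 1]] i) j.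
  have -> : g i j = (g *m delta_mx j (0 : 'I_1)) i 0 by rewrite -colE [col _ _ _ _]mxE.
  rewrite /g -mulmxA !reflection_mxE.
  have -> : delta_mx j 0 = vec3 (j == 0 :> nat)%:R (j == 1%N :> nat)%:R (j == 2%N :> nat)%:R :> 'cV[R]_3.
    apply/matrixP => k l; rewrite ord1 !mxE andbT.
    by case: j => [[|[|[|j]]] //= lt_j]; case: k => [[|[|[|k]]] //= lt_k].
  rewrite !lorentz_vec3 !vec3Z !vec3B !lorentz_vec3 ?vec3Z ?vec3B mxE.
  by case: j => [[|[|[|j]]] //= lt_j]; case: i => [[|[|[|i]]] //= lt_i];
    ring: (qC2 P) (qS2 P).
rewrite /mxtrace; under [X in _ - X]eq_bigr => i _ do rewrite mxE.
by rewrite !big_ord_recl !big_ord0 !gE /=; field: (qC2 P) (qS2 P).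
Qed.

Lemma quad_field_of_definition :
  field_of_definition (reflection_group e) = field_generated [set u].
Proof.
have e1 := quad_normal_unit P.
rewrite /field_of_definition reflection_groupE //; apply/seteqP; split.
- apply: field_generated_min; first exact: field_generated_subfield.
  move=> _ [_ [w _ <-] <-]; apply: quad_trace_field; first exact: field_generated_subfield.
  exact: sub_field_generated.
- have sF := field_generated_subfield (@adjoint_trace R 2 @` [set word_mx e w | w in setT]).
  apply: field_generated_min => // _ ->.
  have -> : u = (3 + 4 * u - 3%:R) / 4%:R by field.
  apply: (subfieldV_div sF); last exact: (subfield_nat sF 4).
  apply: (subfieldB sF); last exact: (subfield_nat sF 3).
  apply: sub_field_generated; exists (word_mx e [:: inord 0; inord 2]); last exact: quad_trace_ac.
  by exists [:: inord 0; inord 2].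
Qed.

End QuadField.

(** * The number field *)

(** The number is rational, so its integrality can be tested in [algC], where a rational algebraic
    integer is an integer. *)
Lemma odd_half_not_alg_int (K : numFieldType) (m : int) : ~~ (2 %| m)%Z ->
  ~ alg_int (m%:~R / 2 : K).
Proof.
move=> odd_m [p mon_p].
have -> : (m%:~R / 2 : K) = ratr (m%:~R / 2) by rewrite fmorph_div rmorph_int rmorph_nat.
have -> : map_poly intr p = map_poly ratr (map_poly (intr : int -> rat) p) :> {poly K}.
  by rewrite -map_poly_comp; apply: eq_map_poly => a /=; rewrite rmorph_int.
rewrite fmorph_root -(fmorph_root (ratr : rat -> algC)) => rt.
have : ratr (m%:~R / 2) \in Aint.
  apply: (root_monic_Aint rt); first by do 2!apply: monic_map.
  by apply/polyOverP => i; rewrite !coef_map /= rmorph_int; apply: intr_int.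
move/(Cint_rat_Aint (Crat_rat _)) => /intrP[k].
rewrite fmorph_div rmorph_int rmorph_nat => E.
have : (m%:~R : algC) = (k * 2)%:~R.
  by rewrite [RHS]rmorphM rmorph_nat /= -E divfK // pnatr_eq0.
by move/intr_inj => mk; rewrite mk dvdz_mull in odd_m.
Qed.

Lemma ndvdz_double_succ (z : int) : ~~ (2 %| 1 + 2 * z)%Z.
Proof. by apply/negP => /dvdzP[k]; lia. Qed.

Section Polynomial.
Variable d : nat.
Hypothesis d_gt0 : (0 < d)%N.

(** The roots are divided by this number. The exponent takes the root near 1 below 1/100, puts the
    centers -(2^(d+6) + i) just below -1/4, and leaves a factor 16 to handle the prime 2 in
    [spectral_not_alg_int]. *)
Definition root_scale : nat := 2 ^ (d + 8).
(** Besides being odd, c satisfies 2 c > 2^d, which is what [quad_poly_real_root] needs, as the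
    product of the y - a_i is at least 2^(-d) in absolute value at half integers. *)
Let c : int := 2 ^+ d + 1.

Definition root_center (i : nat) : int := if i is 0%N then 1 else - (2 ^ (d + 6) + i)%N%:Z.

Definition quad_poly_cofactor : {poly int} :=
  c%:P * \prod_(i < d) (1 - root_center i *: 'X).

(* The reciprocal polynomial of 2 c prod_i (y - a_i) + 1, with [a_i = root_center i]. *)
Definition quad_poly : {poly int} := 'X^d + 2 *: quad_poly_cofactor.

Lemma c_odd : ~~ (2 %| c)%Z.
Proof.
rewrite /c addrC; case: (d) d_gt0 => // n _; rewrite exprS.
exact: ndvdz_double_succ.
Qed.

Lemma size_cofactor : (size quad_poly_cofactor <= d.+1)%N.
Proof.
rewrite /quad_poly_cofactor mul_polyC; apply: leq_trans (size_scale_leq _ _) _.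
apply: leq_trans (size_poly_prod_leq _ _) _; rewrite cardT size_enum_ord.
have : (\sum_(i < d) size (1 - root_center i *: 'X)%R <= \sum_(i < d) 2)%N.
  apply: leq_sum => i _; apply: leq_trans (size_polyD _ _) _.
  rewrite geq_max size_poly1 size_polyN /=.
  by apply: leq_trans (size_scale_leq _ _) _; rewrite size_polyX.
rewrite sum_nat_const card_ord; move: (\sum_(i < d) _)%N => s; lia.
Qed.

Lemma coef_quad_poly i : quad_poly`_i = (i == d)%:R + 2 * quad_poly_cofactor`_i.
Proof. by rewrite /quad_poly coefD coefXn coefZ. Qed.

Lemma quad_poly_lead_odd : ~~ (2 %| quad_poly`_d)%Z.
Proof. by rewrite coef_quad_poly eqxx; exact: ndvdz_double_succ. Qed.

Lemma size_quad_poly : size quad_poly = d.+1.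
Proof.
apply/eqP; rewrite eqn_leq; apply/andP; split.
  apply: leq_trans (size_polyD _ _) _; rewrite geq_max size_polyXn leqnn /=.
  exact: leq_trans (size_scale_leq _ _) size_cofactor.
rewrite ltnNge; apply: contra quad_poly_lead_odd => /leq_sizeP -> //.
Qed.

Lemma quad_poly_irreducible : irreducible_poly (map_poly (intr : int -> rat) quad_poly).
Proof.
apply/irreducible_rat_int; apply: (@eisenstein_crit 2) => //.
- by rewrite size_quad_poly; case: (d) d_gt0.
- by rewrite lead_coefE size_quad_poly quad_poly_lead_odd.
- rewrite coef_quad_poly eq_sym gtn_eqF // add0r.
  have -> : quad_poly_cofactor`_0 = c.
    rewrite /quad_poly_cofactor mul_polyC coefZ -horner_coef0 horner_prod big1 ?mulr1 // => i _.
    by rewrite !hornerE /= ?mulr0 ?subr0.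
  by rewrite dvdzE abszM (_ : `|(2 ^ 2)%N|%N = (2 * 2)%N) // dvdn_pmul2l //; exact: c_odd.
- move=> i; rewrite size_quad_poly /= => lt_id.
  by rewrite coef_quad_poly ltn_eqF // add0r dvdz_mulr.
Qed.

Section Roots.
Variable K : fieldType.

Lemma horner_quad_poly (x : K) : (map_poly intr quad_poly).[x] =
  x ^+ d + 2 * c%:~R * \prod_(i < d) (1 - (root_center i)%:~R * x).
Proof.
rewrite /quad_poly rmorphD /= map_polyXn hornerD hornerXn; congr (_ + _).
rewrite -mul_polyC rmorphM /= map_polyC hornerCM /= -mulrA; congr (_ * _).
rewrite /quad_poly_cofactor rmorphM /= map_polyC hornerCM; congr (_ * _).
rewrite rmorph_prod horner_prod; apply: eq_bigr => i _.
by rewrite rmorphB rmorph1 /= -mul_polyC rmorphM /= map_polyC map_polyX !hornerE.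
Qed.

End Roots.

(** With y = 1/x, the equation of y times q^d gives q^d / 2 = - c prod_i (q y - q a_i). If q y were
    an algebraic integer, half of an odd integer would be one. *)
Lemma quad_poly_nonint (K : numFieldType) (x : K) (q : int) : ~~ (2 %| q)%Z ->
  root (map_poly intr quad_poly) x -> ~ alg_int (q%:~R / x).
Proof.
move=> odd_q /rootP; rewrite horner_quad_poly => rt iq.
have x0 : x != 0.
  apply: contra_eq_neq rt => ->; rewrite expr0n gtn_eqF // add0r.
  rewrite big1 => [|i _]; last by rewrite mulr0 subr0.
  rewrite mulr1 mulf_neq0 ?pnatr_eq0 // intr_eq0.
  by apply: contraNneq c_odd => ->.
have E : (q ^+ d)%:~R / 2 = - (c%:~R * \prod_(i < d) (q%:~R / x - q%:~R * (root_center i)%:~R)) :> K.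
  have xd : x ^+ d != 0 by rewrite expf_neq0.
  apply: (mulfI xd); rewrite mulrN [in RHS]mulrCA.
  have -> : x ^+ d * \prod_(i < d) (q%:~R / x - q%:~R * (root_center i)%:~R) =
      q%:~R ^+ d * \prod_(i < d) (1 - (root_center i)%:~R * x) :> K.
    have XD (z : K) : z ^+ d = \prod_(i < d) z by rewrite prodr_const card_ord.
    by rewrite !XD -!big_split /=; apply: eq_bigr => i _; field.
  have -> : x ^+ d = - (2 * c%:~R * \prod_(i < d) (1 - (root_center i)%:~R * x)).
    by apply/eqP; rewrite -addr_eq0 rt.
  by rewrite rmorphXn /=; field.
apply: (@odd_half_not_alg_int K (q ^+ d)).
  by rewrite dvdzE abszX Euclid_dvdX // d_gt0 andbT.
rewrite E; apply: alg_intN; apply: alg_intM; first exact: integral_id.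
apply: big_ind; [exact: (alg_int_nat _ 1) | exact: alg_intM|] => i _.
by apply: alg_intB => //; rewrite -intrM; exact: integral_id.
Qed.

Variable R : realType.

Let F (y : R) := \prod_(i < d) (y - (root_center i)%:~R).

Lemma root_center_inj (i j : nat) : root_center i = root_center j -> i = j.
Proof. by case: i j => [|i] [|j] //=; lia. Qed.

Lemma root_center_far (i j : nat) : i != j ->
  1 <= ((root_center i)%:~R - (root_center j)%:~R) ^+ 2 :> R.
Proof.
move=> ij; have k : root_center i - root_center j != 0.
  by apply: contraNneq ij => /eqP; rewrite subr_eq0 => /eqP /root_center_inj ->.
rewrite -intrB -rmorphXn /= -[1]/(1%:~R) ler_int.
by move: (_ - _) k => z z0; nia.
Qed.

(** At a half integer every factor y - a_j has absolute value at least 1/2. *)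
Lemma half_integer_bound (b : R) (i : 'I_d) : b ^+ 2 = 1 / 4 ->
  (1 / 4) ^+ d <= F ((root_center i)%:~R + b) ^+ 2.
Proof.
move=> b2; rewrite /F -prodrXl -[X in _ ^+ X]card_ord -prodr_const.
apply: ler_prod => j _; apply/andP; split; first by lra.
have [->|ij] := eqVneq i j; first by rewrite addrAC subrr add0r b2.
have k : root_center i - root_center j != 0.
  by apply: contraNneq ij => /eqP; rewrite subr_eq0 => /eqP /root_center_inj /val_inj ->.
have -> : (root_center i)%:~R + b - (root_center j)%:~R = (root_center i - root_center j)%:~R + b.
  by rewrite intrB; ring.
move: (_ - _) k => z z0.
have : 1 <= `|z|%:~R :> R by rewrite -[1]/(1%:~R) ler_int; lia.
rewrite intr_norm => z1.
have b1 : `|b| = 1 / 2.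
  apply/eqP; rewrite -(@eqrXn2 _ 2%N) ?divr_ge0 //.
  by rewrite real_normK ?num_real // b2; apply/eqP; field.
have : 1 / 2 <= `|z%:~R + b|.
  by have := lerB_dist z%:~R (- b); rewrite opprK normrN b1; lra.
move=> k; rewrite -(real_normK (num_real _)).
have -> : 1 / 4 = (1 / 2) ^+ 2 :> R by field.
by rewrite ler_pXn2r ?nnegrE //; lra.
Qed.

(** Between the two half integers next to a_i only the i-th factor changes sign. *)
Lemma quad_sign_change (i : 'I_d) :
  F ((root_center i)%:~R - 1 / 2) * F ((root_center i)%:~R + 1 / 2) < 0.
Proof.
rewrite /F -big_split /= (bigD1 i) //= pmulr_llt0.
  have -> : ((root_center i)%:~R - 1 / 2 - (root_center i)%:~R) *
     ((root_center i)%:~R + 1 / 2 - (root_center i)%:~R) = - (1 / 4) :> R by field.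
  lra.
apply: prodr_gt0 => j ji; have := @root_center_far i j; rewrite eq_sym => /(_ ji) k.
have -> : ((root_center i)%:~R - 1 / 2 - (root_center j)%:~R) *
     ((root_center i)%:~R + 1 / 2 - (root_center j)%:~R) =
     ((root_center i)%:~R - (root_center j)%:~R) ^+ 2 - 1 / 4 :> R by field.
lra.
Qed.

Lemma quad_poly_real_root (i : 'I_d) : exists2 y : R,
  (root_center i)%:~R - 1 / 2 < y < (root_center i)%:~R + 1 / 2 &
  2 * c%:~R * F y + 1 = 0.
Proof.
pose A : {poly R} := (2 * c%:~R) *: \prod_(j < d) ('X - (root_center j)%:~R%:P) + 1.
have AE y : A.[y] = 2 * c%:~R * F y + 1.
  rewrite /A hornerD hornerZ horner_prod hornerC; congr (_ * _ + _).
  by apply: eq_bigr => j _; rewrite !hornerE.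
(* The squared form of 2 c |F| > 1: adding the constant term 1 then keeps the sign at both end
   points. *)
have c_big b : b ^+ 2 = 1 / 4 -> 1 < (2 * c%:~R * F ((root_center i)%:~R + b)) ^+ 2.
  move=> b2; have := half_integer_bound i b2; move: (F _) => z hz.
  rewrite exprMn; apply: (@lt_le_trans _ _ ((2 * c%:~R) ^+ 2 * (1 / 4) ^+ d)); last first.
    by rewrite ler_pM2l // exprn_gt0 // mulr_gt0 // /c ltr0z.
  have -> : (1 / 4) ^+ d = ((2 ^+ d) ^+ 2)^-1 :> R.
    by rewrite -exprM mulnC exprM expr_div_n expr1n div1r; congr (_ ^+ _)^-1; ring.
  rewrite ltr_pdivlMr ?exprn_gt0 // mul1r ltr_pXn2r ?nnegrE ?exprn_ge0 //.
    rewrite /c rmorphD rmorphXn /= rmorph_nat rmorph1.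
    have : 0 < 2 ^+ d :> R by rewrite exprn_gt0.
    lra.
  by rewrite mulr_ge0 // ler0z /c addr_ge0 // exprn_ge0.
have b2 : (1 / 2 : R) ^+ 2 = 1 / 4 by field.
have b2' : (- (1 / 2) : R) ^+ 2 = 1 / 4 by field.
have k1 := c_big _ b2'; have k2 := c_big _ b2; have k3 := quad_sign_change i.
set a1 := (root_center i)%:~R - 1 / 2 in k1 k3 *.
set a2 := (root_center i)%:~R + 1 / 2 in k2 k3 *.
have a12 : a1 <= a2 by rewrite /a1 /a2; lra.
have c0 : 0 < c%:~R :> R by rewrite ltr0z /c addr_gt0 // exprn_gt0.
have [] := @polyrcf.poly_ivtoo R A a1 a2 a12.
  rewrite !AE; set x1 := 2 * c%:~R * F a1 in k1 *; set x2 := 2 * c%:~R * F a2 in k2 *.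
  have : x1 * x2 < 0.
    have -> : x1 * x2 = (2 * c%:~R) ^+ 2 * (F a1 * F a2) by rewrite /x1 /x2; ring.
    by rewrite pmulr_rlt0 // exprn_gt0 // mulr_gt0.
  by clear -k1 k2; move=> k; have [?|?] := leP x1 0; [have : x1 < -1 by nra | have : 1 < x1 by nra];
    (have [?|?] := leP x2 0; [have : x2 < -1 by nra | have : 1 < x2 by nra]); nra.
by move=> y; rewrite in_itv /= => yb /rootP; rewrite AE; exists y.
Qed.

Lemma quad_poly_root_inv (y : R) : y != 0 -> 2 * c%:~R * F y + 1 = 0 ->
  root (map_poly intr quad_poly) y^-1.
Proof.
move=> y0 Fy; apply/rootP; rewrite horner_quad_poly.
have yd : y ^+ d != 0 by rewrite expf_neq0.
have -> : \prod_(i < d) (1 - (root_center i)%:~R * y^-1) = F y / y ^+ d.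
  have XD : y ^+ d = \prod_(i < d) y by rewrite prodr_const card_ord.
  by rewrite XD /F -prodf_div; apply: eq_bigr => i _; field.
by rewrite exprVn mulrA -[X in X + _]mul1r -mulrDl addrC Fy mul0r.
Qed.

Lemma quad_poly_spectrum : exists u : R,
  [/\ 0 < u <= 1 / 100,
      root (map_poly intr quad_poly) (root_scale%:R * u)^-1 &
      forall z : R[i], root (map_poly intr quad_poly) z ->
        exists2 v : R, z = real_complex R (root_scale%:R * v)^-1 &
          v = u \/ -1 < v < - (1 / 4)].
Proof.
have /choice[y yP] (i : 'I_d) : exists y : R,
    ((root_center i)%:~R - 1 / 2 < y < (root_center i)%:~R + 1 / 2) /\
    2 * c%:~R * F y + 1 = 0.
  by have [y ? ?] := quad_poly_real_root i; exists y.
have y0 i : y i != 0.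
  have [/andP[y1 y2] _] := yP i; move: y1 y2; case: (val i) => [|j] /= y1 y2.
    by rewrite gt_eqF //; lra.
  rewrite lt_eqF //; apply: lt_trans y2 _; rewrite mulrNz.
  have : 1 <= (2 ^ (d + 6) + j.+1)%N%:~R :> R by rewrite -[1]/(1%:~R) ler_int; lia.
  lra.
have y_inj : injective y.
  move=> i j E; apply/eqP/negP => /negP ij.
  have ij' : nat_of_ord i != j by [].
  have := root_center_far ij'; have [/andP[i1 i2] _] := yP i; have [/andP[j1 j2] _] := yP j.
  rewrite E in i1 i2; nra.
have N0 : 0 < root_scale%:R :> R by rewrite ltr0n expn_gt0.
pose i0 := Ordinal d_gt0.
have Nu v : (root_scale%:R * (v / root_scale%:R))^-1 = v^-1 :> R by rewrite mulrC divfK ?gt_eqF.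
exists (y i0 / root_scale%:R); split.
- have [/andP[]] := yP i0; rewrite /= => y1 y2 _.
  have N9 : 512 <= root_scale%:R :> R.
    by rewrite ler_nat /root_scale (_ : 512 = 2 ^ 9)%N // leq_exp2l //; lia.
  apply/andP; split; first by rewrite divr_gt0 //; lra.
  by rewrite ler_pdivrMr //; lra.
- by rewrite Nu; apply: quad_poly_root_inv => //; case: (yP i0).
move=> z rz; pose rs := [seq real_complex R (y i)^-1 | i <- enum 'I_d].
have : z \in rs.
  apply: contraT => zN.
  have : (size (z :: rs) < size (map_poly intr quad_poly : {poly R[i]}))%N.
    apply: max_poly_roots.
    - rewrite -size_poly_eq0 size_map_inj_poly ?size_quad_poly //; exact: intr_inj.
    - rewrite /= rz /=; apply/allP => _ /mapP[i _ ->].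
      have -> : map_poly intr quad_poly = map_poly (real_complex R) (map_poly intr quad_poly) :> {poly R[i]}.
        by rewrite -map_poly_comp; apply: eq_map_poly => a /=; rewrite rmorph_int.
      by rewrite fmorph_root; apply: quad_poly_root_inv => //; case: (yP i).
    - rewrite /= zN map_inj_uniq ?enum_uniq // => i j /complexI /invr_inj; exact: y_inj.
  rewrite size_map_inj_poly ?size_quad_poly //=; last exact: intr_inj.
  by rewrite size_map size_enum_ord ltnn.
case/mapP => i _ ->; exists (y i / root_scale%:R); first by rewrite Nu.
have [->|ii0] := eqVneq i i0; [by left | right].
have [/andP[y1 y2] _] := yP i; move: y1 y2.
have : (nat_of_ord i != 0)%N by [].
case: (nat_of_ord i) (ltn_ord i) => // j lt_jd _ /=; rewrite mulrNz => y1 y2.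
have k1 : (2 ^ (d + 6))%N%:R + 1 <= (2 ^ (d + 6) + j.+1)%N%:~R :> R.
  by rewrite -pmulrn natrD lerD2l -[1]/(1%:R) ler_nat.
have k2 : (2 ^ (d + 6) + j.+1)%N%:~R + 1 <= root_scale%:R :> R.
  rewrite -pmulrn -[1]/(1%:R) -natrD ler_nat /root_scale.
  have := ltn_expl d (isT : 1 < 2)%N; rewrite !expnD; lia.
have k3 : root_scale%:R = 4 * (2 ^ (d + 6))%N%:R :> R.
  by rewrite -natrM /root_scale -(expnD 2 2); congr (_ ^ _)%:R; lia.
by apply/andP; split; [rewrite ltr_pdivlMr // | rewrite ltr_pdivrMr //]; lra.
Qed.

End Polynomial.

(** * Number fields generated by real numbers *)

Section Extension.
Variable R : realType.

Lemma map_in_alg (L : fieldExtType rat) (E : fieldType) (s : {rmorphism L -> E}) (q : {poly rat}) :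
  map_poly s (map_poly (in_alg L) q) = map_poly ratr q.
Proof. by rewrite -map_poly_comp; apply: eq_map_poly => a /=; rewrite alg_num_field fmorph_rat. Qed.

Lemma range_subfield (L : fieldType) (j : {rmorphism L -> R}) : is_subfield (range j).
Proof.
split.
- by exists 1; rewrite ?rmorph1.
- by move=> _ _ [x _ <-] [y _ <-]; exists (x - y); rewrite ?rmorphB.
- by move=> _ _ [x _ <-] [y _ <-]; exists (x / y); rewrite ?fmorph_div.
Qed.

Lemma subfield_ratr (F : set R) a : is_subfield F -> F (ratr a).
Proof.
move=> sF; rewrite -(divq_num_den a) fmorph_div !rmorph_int.
have Fint (m : int) : F m%:~R.
  case: m => n; first exact: subfield_nat.
  by rewrite NegzE mulrNz; apply: (subfieldN sF); exact: subfield_nat.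
exact: (subfieldV_div sF).
Qed.

Lemma subfield_horner (F : set R) (q : {poly rat}) x : is_subfield F -> F x ->
  F (map_poly ratr q).[x].
Proof.
move=> sF Fx; rewrite horner_coef; apply: (subfield_sum sF) => i _.
apply: (subfieldM sF); last exact: subfieldX.
by rewrite coef_map; exact: subfield_ratr.
Qed.

(** The field is Q[X]/(p), embedded by sending X to z. That every element is a polynomial in [t]
    lets an embedding be controlled by its value at [t]. *)
Lemma simple_extension (p : {poly rat}) (z : R) : irreducible_poly p ->
  root (map_poly ratr p) z ->
  exists (L : fieldExtType rat) (j : {rmorphism L -> R}) (t : L),
    [/\ \dim {:L} = (size p).-1, j t = z, range j = field_generated [set z] &
        forall x : L, exists q : {poly rat}, x = (map_poly (in_alg L) q).[t]].
Proof.
move=> irr_p pz; have p0 := irredp_neq0 irr_p.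
pose L : fieldExtType rat := SubFieldExtType pz irr_p.
pose j : {rmorphism L -> R} := (subfx_inj : subFExtend ratr z p -> R).
pose t : L := subfx_root ratr z p.
have jt : j t = z by apply: subfx_inj_root.
have Lt (x : L) : exists q : {poly rat}, x = (map_poly (in_alg L) q).[t].
  by have [q ->] := @subfxEroot _ _ ratr z p pz p0 x; exists q.
exists L, j, t; split => //.
- by rewrite dimvf.
- apply/seteqP; split.
  + move=> _ [x _ <-]; have [q ->] := Lt x.
    rewrite -horner_map map_in_alg jt; apply: (@subfield_horner (field_generated [set z])); first exact: field_generated_subfield.
    exact: sub_field_generated.
  + by apply: field_generated_min; [exact: range_subfield | move=> _ ->; exists t].
Qed.

Lemma real_generator_totally_real (L : fieldExtType rat) (t : L) :
  (forall x : L, exists q : {poly rat}, x = (map_poly (in_alg L) q).[t]) ->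
  (forall s : {rmorphism L -> R[i]}, s t \is Num.real) -> totally_real R L.
Proof.
move=> Lt t_real s x; have [q ->] := Lt x.
rewrite -horner_map map_in_alg; have /complex_realP[w ->] := t_real s.
have -> : map_poly ratr q = map_poly (real_complex R) (map_poly ratr q).
  by rewrite -map_poly_comp; apply: eq_map_poly => a /=; rewrite fmorph_rat.
by rewrite horner_map; apply/complex_realP; exists (map_poly ratr q).[w].
Qed.

Lemma algebraic_irreducible (z : R) : algebraicOver (ratr : rat -> R) z ->
  exists2 p : {poly rat}, irreducible_poly p & root (map_poly ratr p) z.
Proof.
move=> [q0 q0_neq0 q0z].
pose Q n := `[< exists q : {poly rat}, [/\ q != 0, root (map_poly ratr q) z & size q = n] >].
have [n /asboolP[p [p0 pz <-]] min_n] : {n | Q n & forall m, Q m -> (n <= m)%N}.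
  have exQ : exists n, Q n by exists (size q0); apply/asboolP; exists q0.
  by case: (ex_minnP exQ) => n; exists n.
exists p => //; apply/(subfx_irreducibleP pz p0) => q qz q_neq0.
by apply: min_n; apply/asboolP; exists q.
Qed.

Lemma algebraic_sqr (E : fieldType) (f : {rmorphism rat -> E}) (x : E) :
  algebraicOver f (x ^+ 2) -> algebraicOver f x.
Proof.
move=> [p p0 px]; exists (p \Po 'X^2); first by rewrite comp_poly_eq0 ?size_polyXn.
by rewrite map_comp_poly map_polyXn /root horner_comp hornerXn.
Qed.

(** The generator [b *+ n - a] is linear in a and b, so its conjugates are real once those of a and
    b are. *)
Lemma primitive_element (x y : R) : algebraicOver (ratr : rat -> R) x ->
  algebraicOver (ratr : rat -> R) y -> exists n (L : fieldExtType rat) (j : {rmorphism L -> R}) (a b : L),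
    [/\ j a = x, j b = y, range j = field_generated [set x; y] &
        forall z : L, exists q : {poly rat}, z = (map_poly (in_alg L) q).[b *+ n - a]].
Proof.
move=> ax ay; have [p p0 px] := ax; have [q q0 qy] := ay.
have char0 : [pchar rat] =i pred0 by exact: pchar_num.
have [n /= [[qx zx] [qy' zy]]] := pchar0_PET p0 px q0 qy char0.
have [r irr_r rz] : exists2 r : {poly rat}, irreducible_poly r & root (map_poly ratr r) (y *+ n - x).
  apply: algebraic_irreducible; apply: algebraic_sub => //.
  by rewrite -mulr_natl -(rmorph_nat (ratr : {rmorphism rat -> R})); apply: algebraic_mul => //; exact: algebraic_id.
have [L [j [t [_ jt rangej Lt]]]] := simple_extension irr_r rz.
pose a := (map_poly (in_alg L) qx).[t]; pose b := (map_poly (in_alg L) qy').[t].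
have ja : j a = x by rewrite /a -horner_map map_in_alg jt.
have jb : j b = y by rewrite /b -horner_map map_in_alg jt.
have tE : b *+ n - a = t.
  by apply: (fmorph_inj j); rewrite jt rmorphB rmorphMn /= ja jb.
exists n, L, j, a, b; split; rewrite ?tE //.
rewrite rangej; apply/seteqP; split; apply: field_generated_min; try exact: field_generated_subfield.
  have sF := field_generated_subfield [set x; y].
  move=> _ ->; apply: (subfieldB sF); last by apply: sub_field_generated; left.
  rewrite -mulr_natl; apply: (subfieldM sF); first exact: (subfield_nat sF).
  by apply: sub_field_generated; right.
by rewrite -rangej => _ [->|->]; [exists a | exists b].
Qed.

End Extension.

(** * Quasi-arithmeticity *)

Definition quad_admissible (R : realType) (u : R) : Prop :=
  algebraicOver (ratr : rat -> R) u /\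
  forall (L : fieldExtType rat) (j : {rmorphism L -> R}) (s : {rmorphism L -> R[i]}) (x : L),
    j x = u -> exists2 v : R, s x = real_complex R v & v = u \/ -1 < v < - (1 / 4).

Lemma map_quad_gram_table (K E : fieldType) (f : {rmorphism K -> E}) (c dl : K) (i j : 'I_4) :
  f (quad_gram_table c dl i j) = quad_gram_table (f c) (f dl) i j.
Proof.
move: j; move: i; apply: ord4P; apply: ord4P; rewrite /quad_gram_table !inordK //=;
  by rewrite ?rmorphN ?rmorph0 ?rmorph1 ?fmorph_div ?rmorph1 ?rmorph_nat.
Qed.

Lemma sum_ord4 (V : nmodType) (F : 'I_4 -> V) :
  \sum_i F i = F (inord 0) + F (inord 1) + F (inord 2) + F (inord 3).
Proof.
rewrite !big_ord_recl big_ord0 addr0 !addrA.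
by congr (F _ + F _ + F _ + F _); apply: val_inj; rewrite /= inordK.
Qed.

Lemma quad_gram_psd (R : realType) (v c dl : R) : -1 < v < - (1 / 4) ->
  c ^+ 2 = 1 + v -> dl ^+ 2 = 1 + 1 / (4 * v) ->
  positive_semidefinite (\matrix_(i < 4, j < 4) quad_gram_table c dl i j).
Proof.
move=> /andP[v1 v2] c2 dl2; split.
  apply/matrixP => i j; rewrite !mxE.
  by move: j; move: i; apply: ord4P; apply: ord4P; rewrite /quad_gram_table !inordK.
move=> x; rewrite -mulmxA mxE sum_ord4 !mxE !sum_ord4 !mxE /quad_gram_table !inordK //=.
set x0 := x (inord 0) 0; set x1 := x (inord 1) 0; set x2 := x (inord 2) 0; set x3 := x (inord 3) 0.
set Q := (X in 0 <= X).
(* Completing squares: the Gram matrix is singular, so three squares suffice, and the third has the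
   sign of - v. *)
have -> : Q = (x0 - c * x2) ^+ 2 + (x1 - dl * x3) ^+ 2 + (2 * v * x2 + x3) ^+ 2 / (4 * - v).
  apply/eqP; rewrite -subr_eq0; set d := (X in X == 0).
  have -> : d = - ((c ^+ 2 - 1 - v) * x2 ^+ 2) - (dl ^+ 2 - 1 - 1 / (4 * v)) * x3 ^+ 2.
    by rewrite /d /Q; field; lra.
  by rewrite c2 dl2; apply/eqP; ring.
by rewrite !addr_ge0 ?sqr_ge0 // divr_ge0 ?sqr_ge0 //; lra.
Qed.

Lemma real_of_sqr (R : realType) (z : R[i]) (w : R) : 0 <= w -> z ^+ 2 = real_complex R w ->
  z \is Num.real.
Proof.
move=> w0 E; have : z ^+ 2 = real_complex R (Num.sqrt w) ^+ 2.
  by rewrite E -rmorphXn /= sqr_sqrtr.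
have r : real_complex R (Num.sqrt w) \is Num.real by apply/complex_realP; exists (Num.sqrt w).
by move/eqP; rewrite eqf_sqr => /orP[] /eqP -> //; rewrite rpredN.
Qed.

Section QuadField.
Variables (R : realType) (u C S D : R).
Hypothesis P : quad_params u C S D.
Notation e := (quad_normal C S D).

Lemma quad_Gram : Gram e = \matrix_(i < 4, j < 4) quad_gram_table C D i j.
Proof. by apply/matrixP => i j; rewrite !mxE (quad_gram P). Qed.

Lemma quad_D2 : D ^+ 2 = 1 + 1 / (4 * u).
Proof.
have u0 := u_gt0 P; apply: (@mulfI _ (4 * u)); first by lra.
by rewrite (qD2 P); field; lra.
Qed.

(* Multiplying the normals by C, D, 1, 1 brings the Gram matrix into Q(u). *)
Lemma cyclic_field_sub : cyclic_field (Gram e) `<=` field_generated [set u].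
Proof.
have u0 := u_gt0 P; have C0 := qC_gt0 P; have D0 := qD_gt0 P.
have sF := field_generated_subfield [set u].
have Fu : field_generated [set u] u by exact: sub_field_generated.
have F1 := subfield1 sF.
have FC2 : field_generated [set u] (C ^+ 2) by rewrite (qC2 P); apply: (subfieldD sF).
have FD2 : field_generated [set u] (D ^+ 2).
  rewrite quad_D2; apply: (subfieldD sF F1); apply: (subfieldV_div sF F1).
  by apply: (subfieldM sF) => //; exact: (subfield_nat sF 4).
pose T (i : 'I_4) : R := nth 0 [:: C; D; 1; 1] i.
have T0 i : T i != 0.
  by move: i; apply: ord4P; rewrite /T !inordK //= ?oner_eq0 ?gt_eqF.
have FT2 i : field_generated [set u] (T i ^+ 2).
  by move: i; apply: ord4P; rewrite /T !inordK //= expr1n.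
have F_half : field_generated [set u] (- 2^-1).
  by apply: (subfieldN sF); rewrite -[_^-1]mul1r; apply: (subfieldV_div sF F1); exact: (subfield_nat sF 2).
have FG i j : field_generated [set u] (Gram e i j * T i * T j).
  rewrite quad_Gram mxE; move: j; move: i; apply: ord4P; apply: ord4P;
    rewrite /quad_gram_table /T !inordK //= ?mulr1 ?mul1r ?mul0r ?mulNr -?expr2 //;
    by [exact: (subfield0 sF) | exact: (subfieldN sF)].
have Fpath s i j : field_generated [set u]
    ((\prod_(p <- zip (i :: s) (rcons s j)) Gram e p.1 p.2) * T i * T j).
  elim: s i => [|k s IHs] i; first by rewrite /= big_seq1 /=.
  rewrite [zip _ _]/= big_cons /=; move: (IHs k); set Q := \prod_(p <- _) _ => IH.
  have -> : Gram e i k * Q * T i * T j = (Gram e i k * T i * T k) * (Q * T k * T j) / T k ^+ 2.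
    by have := T0 k => Tk; field.
  by apply: (subfieldV_div sF) => //; apply: (subfieldM sF).
apply: field_generated_min => // _ [i [s ->]].
have -> : cyclic_product (Gram e) i s = cyclic_product (Gram e) i s * T i * T i / T i ^+ 2.
  by have := T0 i => Ti; field.
by apply: (subfieldV_div sF) => //; exact: Fpath.
Qed.

Hypothesis u_adm : quad_admissible u.

Lemma algebraic_one_plus (x : R) : algebraicOver (ratr : rat -> R) x ->
  algebraicOver (ratr : rat -> R) (1 + x).
Proof. by apply: algebraic_add; exact: algebraic1. Qed.

Lemma quad_quasi_arithmetic : quasi_arithmetic_Gram (Gram e).
Proof.
have u0 := u_gt0 P; have [u_alg u_conj] := u_adm.
have C_alg : algebraicOver (ratr : rat -> R) C.
  by apply: algebraic_sqr; rewrite (qC2 P); exact: algebraic_one_plus.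
have D_alg : algebraicOver (ratr : rat -> R) D.
  apply: algebraic_sqr; rewrite quad_D2; apply: algebraic_one_plus.
  apply: algebraic_div; first exact: algebraic1.
  by rewrite -(rmorph_nat (ratr : {rmorphism rat -> R})); apply: algebraic_mul => //; exact: algebraic_id.
have [n [K [j [c [dl [jc jdl rangej Kgen]]]]]] := primitive_element C_alg D_alg.
pose u' := c ^+ 2 - 1.
have ju' : j u' = u by rewrite rmorphB rmorphXn rmorph1 /= jc (qC2 P) addrC addKr.
have c2 : c ^+ 2 = 1 + u' by rewrite /u' addrC subrK.
have dl2 : dl ^+ 2 = 1 + 1 / (4 * u').
  apply: (fmorph_inj j); rewrite rmorphXn /= jdl quad_D2 rmorphD fmorph_div rmorphM /=.
  by rewrite !rmorph1 ju' rmorph_nat.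
exists K, j, (\matrix_(i < 4, k < 4) quad_gram_table c dl i k); split.
- rewrite rangej; apply/seteqP; split; apply: field_generated_min; try exact: field_generated_subfield.
    have sF := field_generated_subfield [set x | exists i k, x = Gram e i k].
    have Gin i k : entry_field (Gram e) (Gram e i k) by apply: sub_field_generated; exists i, k.
    have Fopp x : entry_field (Gram e) (- x) -> entry_field (Gram e) x.
      by move=> /(subfieldN sF); rewrite opprK.
    move=> _ [->|->]; apply: Fopp.
      have -> : - C = Gram e (inord 0) (inord 2) by rewrite quad_Gram mxE /quad_gram_table !inordK.
      exact: Gin.
    have -> : - D = Gram e (inord 1) (inord 3) by rewrite quad_Gram mxE /quad_gram_table !inordK.
    exact: Gin.
  move=> _ [i [k ->]]; rewrite -rangej quad_Gram mxE -jc -jdl -map_quad_gram_table.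
  by eexists.
- by apply/matrixP => i k; rewrite quad_Gram !mxE map_quad_gram_table jc jdl.
- apply: (real_generator_totally_real Kgen) => s.
  have [v sv v_cases] := u_conj K j s u' ju'.
  rewrite rmorphB rmorphMn /=; apply: rpredB; first apply: rpredMn.
    apply: (@real_of_sqr _ _ (1 + 1 / (4 * v))).
      case: v_cases => [->|/andP[v1 v2]]; first by rewrite addr_ge0 // divr_ge0 // mulr_ge0 // ltW.
      have -> : 1 + 1 / (4 * v) = (4 * v + 1) / (4 * v) by field; lra.
      by rewrite -mulrNN -invrN divr_ge0 //; lra.
    rewrite -rmorphXn /= dl2 rmorphD fmorph_div rmorphM /= !rmorph1 rmorph_nat sv.
    by rewrite rmorphD fmorph_div rmorphM /= !rmorph1 rmorph_nat.
  apply: (@real_of_sqr _ _ (1 + v)).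
    by case: v_cases => [->|/andP[v1 v2]]; [rewrite addr_ge0 // ltW | lra].
  by rewrite -rmorphXn /= c2 rmorphD rmorph1 sv rmorphD rmorph1.
move=> s [x xcyc sx].
have [v /complexI sv v_cases] := u_conj K j (real_complex R \o s : {rmorphism K -> R[i]}) u' ju'.
case: v_cases => [vu|v_range].
  exfalso; apply: sx.
  (* The values at which [s] and [j] agree form a field. It contains u, hence all cyclic products,
     against the choice of [x]. *)
  pose F : set R := [set r | exists2 y, j y = r & s y = j y].
  have sF : is_subfield F.
    split; first by exists 1; rewrite !rmorph1.
      by move=> _ _ [y <- sy] [z <- sz]; exists (y - z); rewrite ?rmorphB //= sy sz.
    by move=> _ _ [y <- sy] [z <- sz]; exists (y / z); rewrite ?fmorph_div //= sy sz.
  have : F (j x).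
    apply: field_generated_min (cyclic_field_sub xcyc) => // _ ->.
    by exists u' => //; rewrite sv vu ju'.
  by case=> y /fmorph_inj ->.
have -> : map_mx s (\matrix_(i < 4, k < 4) quad_gram_table c dl i k) =
    \matrix_(i < 4, k < 4) quad_gram_table (s c) (s dl) i k.
  by apply/matrixP => i k; rewrite !mxE map_quad_gram_table.
apply: (quad_gram_psd v_range).
  by rewrite -rmorphXn /= c2 rmorphD rmorph1 /= sv.
by rewrite -rmorphXn /= dl2 rmorphD fmorph_div rmorphM /= !rmorph1 rmorph_nat sv.
Qed.

End QuadField.

Lemma quad_params_exist (R : realType) (u : R) : 0 < u <= 1 / 100 ->
  quad_params u (Num.sqrt (1 + u)) (Num.sqrt u) (Num.sqrt (1 + 1 / (4 * u))).
Proof.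
move=> /andP[u0 u1]; have w0 : 0 < 1 / (4 * u) by rewrite divr_gt0 // mulr_gt0.
split => //.
- by rewrite sqrtr_gt0.
- by rewrite sqrtr_gt0; lra.
- by rewrite sqrtr_gt0; lra.
- by rewrite sqr_sqrtr // ltW.
- by rewrite sqr_sqrtr; lra.
- by rewrite sqr_sqrtr; [field; lra | lra].
Qed.

Lemma quad_C_neq_D (R : realType) (u C S D : R) : quad_params u C S D -> C != D.
Proof.
move=> P; have u0 := u_gt0 P; have u1 := qu_le P; apply/eqP => CD.
have := qD2 P; rewrite -CD (qC2 P); nra.
Qed.

(** * The field generated by the chosen root *)

Section SpectralField.
Variables (R : realType) (d : nat) (d_gt0 : (0 < d)%N) (u : R).
Hypothesis u_root : root (map_poly intr (quad_poly d)) ((root_scale d)%:R * u)^-1.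
Hypothesis u_spectrum : forall z : R[i], root (map_poly intr (quad_poly d)) z ->
  exists2 v : R, z = real_complex R ((root_scale d)%:R * v)^-1 & v = u \/ -1 < v < - (1 / 4).

Notation N := (root_scale d)%:R.

Let N_neq0 (K : numFieldType) : N != 0 :> K.
Proof. by rewrite pnatr_eq0 -lt0n expn_gt0. Qed.

Lemma map_quad_poly_ratr (K : numFieldType) :
  map_poly intr (quad_poly d) = map_poly ratr (map_poly intr (quad_poly d)) :> {poly K}.
Proof. by rewrite -map_poly_comp; apply: eq_map_poly => a /=; rewrite rmorph_int. Qed.

Lemma root_quad_poly_morph (K E : fieldType) (f : {rmorphism K -> E}) (x : K) :
  root (map_poly intr (quad_poly d)) (f x) = root (map_poly intr (quad_poly d)) x.
Proof.
rewrite -(fmorph_root f) -map_poly_comp; congr (root _ _).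
by apply: eq_map_poly => a /=; rewrite rmorph_int.
Qed.

Lemma spectral_admissible : quad_admissible u.
Proof.
split.
  have -> : u = (N * u)^-1^-1 / N by rewrite invrK mulrAC divff ?mul1r ?N_neq0.
  apply: algebraic_div; last by rewrite -(rmorph_nat (ratr : {rmorphism rat -> R})); exact: algebraic_id.
  apply: algebraic_inv; exists (map_poly intr (quad_poly d)); last by rewrite -map_quad_poly_ratr.
  exact: (irredp_neq0 (quad_poly_irreducible d_gt0)).
move=> L j s x jx.
have xr : root (map_poly intr (quad_poly d)) (s (N * x)^-1).
  by rewrite root_quad_poly_morph -(root_quad_poly_morph j) fmorphV rmorphM rmorph_nat /= jx.
have [v sv v_cases] := u_spectrum xr; exists v => //.
move: sv; rewrite !fmorphV => /invr_inj; rewrite !rmorphM /= !rmorph_nat.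
exact: (mulfI (N_neq0 _)).
Qed.

Lemma spectral_field : exists (k : fieldExtType rat) (iota : {rmorphism k -> R}),
  [/\ \dim {:k} = d, totally_real R k & range iota = field_generated [set u]].
Proof.
have irr := quad_poly_irreducible d_gt0.
have rt : root (map_poly ratr (map_poly intr (quad_poly d))) (N * u)^-1.
  by rewrite -map_quad_poly_ratr.
have [k [iota [t [dimk it range_iota kgen]]]] := simple_extension irr rt.
exists k, iota; split.
- by rewrite dimk size_map_inj_poly ?size_quad_poly //; exact: intr_inj.
- apply: (real_generator_totally_real kgen) => s.
  have : root (map_poly intr (quad_poly d)) (s t).
    by rewrite root_quad_poly_morph -(root_quad_poly_morph iota) it.
  by move/u_spectrum => [v -> _]; apply/complex_realP; eexists.
rewrite range_iota; apply/seteqP; split; apply: field_generated_min; try exact: field_generated_subfield.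
  have sF := field_generated_subfield [set u].
  move=> _ ->; apply: (subfieldV sF); apply: (subfieldM sF); first exact: (subfield_nat sF).
  exact: sub_field_generated.
have sF := field_generated_subfield [set (N * u)^-1].
have : field_generated [set (N * u)^-1] ((N * u)^-1^-1 / N).
  apply: (subfieldV_div sF); last exact: (subfield_nat sF).
  by apply: (subfieldV sF); exact: sub_field_generated.
by rewrite invrK mulrAC divff ?mul1r ?N_neq0 // => Fu _ ->.
Qed.

(** If 2 r C were an algebraic integer, so would be (2 r C)^2 - 4 r^2 = 4 r^2 u, while N u = 1 / x
    for a root x of the polynomial, with N a multiple of 16. *)
Lemma spectral_not_alg_int C S D : quad_params u C S D ->
  forall r, prime r -> ~ alg_int (r%:R * real_complex R (2 * C)).
Proof.
move=> P r pr_r ir; pose x := real_complex R (N * u)^-1.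
have x_root : root (map_poly intr (quad_poly d)) x by rewrite root_quad_poly_morph.
have xV : x^-1 = N * real_complex R u by rewrite /x fmorphV invrK rmorphM rmorph_nat.
have i4 : alg_int (4 * r%:R ^+ 2 * real_complex R u).
  have -> : 4 * r%:R ^+ 2 * real_complex R u = (r%:R * real_complex R (2 * C)) ^+ 2 - (4 * r ^ 2)%:R.
    have C2 : real_complex R C ^+ 2 = 1 + real_complex R u.
      by rewrite -rmorphXn (qC2 P) rmorphD rmorph1.
    by rewrite [real_complex R (2 * C)]rmorphM rmorph_nat natrM natrX; ring: C2.
  by apply: alg_intB; [exact: alg_intX | exact: alg_int_nat].
have NE : N = 16 * (2 ^ (d + 4))%:R :> R[i].
  by rewrite -natrM /root_scale -(expnD 2 4); congr (_ ^ _)%:R; lia.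
(* For r = 2 the factor 4 r^2 = 16 divides N, and q = 1 serves; for odd r the factor 4 divides N,
   and q = r^2 is odd. *)
have [r2|odd_r] := even_prime pr_r.
  apply: (@quad_poly_nonint d d_gt0 _ x 1 _ x_root) => //.
  have -> : 1%:~R / x = (2 ^ (d + 4))%:R * (4 * r%:R ^+ 2 * real_complex R u).
    by rewrite mul1r xV NE r2; ring.
  by apply: alg_intM => //; exact: alg_int_nat.
apply: (@quad_poly_nonint d d_gt0 _ x (r ^ 2)%N _ x_root).
  by rewrite dvdzE /= Euclid_dvdX // dvdn2 odd_r.
have -> : (r ^ 2)%N%:~R / x = (4 * 2 ^ (d + 4))%:R * (4 * r%:R ^+ 2 * real_complex R u).
  by rewrite xV NE -pmulrn (natrX _ r 2) natrM; ring.
by apply: alg_intM => //; exact: alg_int_nat.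
Qed.

End SpectralField.

Theorem theorem1 (R : realType) (d : nat) (d_ge1 : (1 <= d)%N) :
  exists (k : fieldExtType rat) (iota : {rmorphism k -> R}) (G : set 'M[R]_3),
    [/\ \dim {:k} = d,
        totally_real R k,
        is_maximal_lattice G,
        is_quasi_arithmetic_reflection_group G &
        field_of_definition G = range iota].
Proof.
have [u [u_range u_root u_spectrum]] := quad_poly_spectrum d_ge1 R.
have P := quad_params_exist u_range.
have [k [iota [dimk real_k range_iota]]] := spectral_field d_ge1 u_root u_spectrum.
exists k, iota, (reflection_group (quad_normal (Num.sqrt (1 + u)) (Num.sqrt u) (Num.sqrt (1 + 1 / (4 * u))))).
split => //.
- split; first exact: (quad_lattice P).
  move=> G' [G'sub G'disc _] GG'.
  apply: (reflection_group_maximal P _ (quad_C_neq_D P) G'sub G'disc GG').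
  exact: (spectral_not_alg_int d_ge1 u_root P).
- eexists; eexists; split; [exact: (quad_is_Coxeter P) | exact: (quad_area_finite P) | by [] |].
  exact: (quad_quasi_arithmetic P (spectral_admissible d_ge1 u_root u_spectrum)).
- by rewrite (quad_field_of_definition P) range_iota.
Qed.
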